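(* Let $p$ be an odd prime and let $n\ge3$. Let $G$ be the group generated by $\{\sigma,Z,U',V'\}$ subject to the following relations. Then $G$ is isomorphic to $\Omega^+(2n,p)$. (i) Defining relations for $\langle U',V'\rangle$ as the group of signed permutation matrices of determinant $1$ and degree $n$; $[Z,U'^{V'^2}]=1$ if $n>3$; $[Z,V'U'U'^{V'}]=1$ if $n>4$; $Z^2=1$; $[Z,U'^{2V'}]=1$; $ZZ^{V'}=Z^{V'U'}$; $[Z,U']=1$; $[Z,Z^{V'}]=1$; $[Z,Z^{V'^2}]=1$ if $n>3$. (ii) Relations stating that $\sigma$ is centralised by: $U'^{V'^2}$ if $n>3$; $V'U'^{-1}U'^{-V'}$ if $n>4$; $Z^{V'^2}$ if $n>3$; $ZU'$. (iii) Relations that present $\mathrm{SL}(2,p)$ on $\{\sigma,U'\}$. (iv) (a) $[\sigma,\sigma^{V'}]=\sigma^{V'U'^{-1}}$; (b) $[\sigma,\sigma^{V'U'^{-1}}]=1$; (c) $[\sigma,\sigma^W]=1$, where $W=U'^{V'U'^{-1}}$; (d) if $n>3$ then $[\sigma,\sigma^{V'^2}]=1$; (e) $[\sigma,\sigma^{Z^{V'}}]=1$; (f) if $n=4$ then $[\sigma,\sigma^{Z^{V'}V'^2}]=1$.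
   Context: Conventions: $x^y=y^{-1}xy$, $[x,y]=x^{-1}y^{-1}xy$, $x^{ky}=(x^k)^y$ and $x^{-y}=(x^{-1})^y$ for $k$ an integer and $x,y$ group elements. Linear maps act on the right and fix unmentioned basis vectors. Generators of the presented group are denoted by the same symbols as the corresponding matrices. ''Relations that present (defining relations for) a group on given elements $g_1,\dots,g_k$'' means any set of relators in the free group on $k$ letters whose normal closure is the kernel of the natural map onto $\langle g_1,\dots,g_k\rangle$. Signed cycles: $(v_1,\dots,v_m)^{\epsilon}$ denotes $v_i\mapsto v_{i+1}$ ($i<m$), $v_m\mapsto\epsilon v_1$; $\epsilon_m=(-1)^{m+1}$. Matrices: $e_1,f_1,\dots,e_n,f_n$ is a hyperbolic basis of the natural module of $\Omega^+(2n,p)$ (symmetric form with $e_i.f_i=1$, other products zero). $\sigma=(e_1\mapsto e_1+e_2,\ f_2\mapsto f_2-f_1)$; $Z$ interchanges $e_1,f_1$ and $e_2,f_2$; $U'=(e_1,e_2)^-(f_1,f_2)^-$; $V'=(e_1,\dots,e_n)^{\epsilon_n}(f_1,\dots,f_n)^{\epsilon_n}$. In (i) $U'$ and $V'$ correspond to the signed permutations $(1,2)^-$ and $(1,\dots,n)^{\epsilon_n}$ of degree $n$. In (iii), $\sigma,U'$ act on $(e_1,e_2)$ as $\begin{pmatrix}1&1\\0&1\end{pmatrix}$, $\begin{pmatrix}0&1\\-1&0\end{pmatrix}$, and generate a copy of $\mathrm{SL}(2,p)$. *)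

(* Defs.v *)
From HB Require Import structures.
From mathcomp Require Import all_boot all_order all_fingroup all_algebra all_solvable.
From mathcomp Require Import boolp classical_sets.

Set Implicit Arguments.
Unset Strict Implicit.
Unset Printing Implicit Defensive.

Import GRing.Theory.
Local Open Scope group_scope.

(* A letter (x, false) stands for the generator x and (x, true) for its
  inverse; the elements of the free group are the reduced words.  The group
  notations of MathComp agree with the conventions used here:
  x ^ y = y^-1 * x * y and [~ x, y] = x^-1 * y^-1 * x * y. *)

Section FreeGroup.
Variable X : choiceType.
Implicit Types (a b : X * bool) (u v w : seq (X * bool)).

Definition flip a := (a.1, ~~ a.2).

Definition push a w := if w is b :: w' then if b == flip a then w' else a :: w
                       else [:: a].

Definition reduce w := foldr push [::] w.

Fixpoint reduced w :=
  if w is a :: w' then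
    (if w' is b :: _ then b != flip a else true) && reduced w'
  else true.

Lemma flipK : involutive flip.
Proof. by case=> x c; rewrite /flip /= negbK. Qed.

Lemma reduced_push a w : reduced w -> reduced (push a w).
Proof.
case: w => [|b w] //= /andP[hb hw]; case: ifP => [//|/negbT ba] /=.
by rewrite ba hb hw.
Qed.

Lemma reduced_foldr u w : reduced w -> reduced (foldr push w u).
Proof. by move=> hw; elim: u => //= a u IH; apply: reduced_push. Qed.

Lemma reduced_reduce w : reduced (reduce w).
Proof. exact: reduced_foldr. Qed.

Lemma pushK a w : reduced w -> push (flip a) (push a w) = w.
Proof.
case: w => [|b w] /=; first by rewrite flipK eqxx.
case: (eqVneq b (flip a)) => [-> | ba] /= hw; last by rewrite flipK eqxx.
by case: w hw => [|c w] //= /andP[/negbTE ->].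
Qed.

Lemma reduce_id w : reduced w -> reduce w = w.
Proof.
elim: w => //= a w IH /andP[ha hw]; rewrite /reduce /= -/(reduce w) IH //.
by case: w ha {IH hw} => //= b w /negbTE ->.
Qed.

Lemma foldr_reduce u w : reduced w -> foldr push w (reduce u) = foldr push w u.
Proof.
move=> hw; elim: u => //= a u <-; rewrite /reduce /= -/(reduce u).
have := reduced_reduce u; case: (reduce u) => [|b r] //= _.
case: (eqVneq b (flip a)) => [-> |] //=.
by have := pushK (flip a) (reduced_foldr r hw); rewrite flipK => ->.
Qed.

Lemma reduce_cat u v : reduce (u ++ v) = foldr push (reduce v) u.
Proof. by rewrite /reduce foldr_cat. Qed.

Definition inv_word w := map flip (rev w).

Lemma reduce_invl w : reduce (inv_word w ++ w) = [::].
Proof.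
elim: w => //= a w IH; rewrite /inv_word rev_cons map_rcons cat_rcons.
rewrite reduce_cat /= /reduce /= -/(reduce w) pushK ?reduced_reduce //.
by rewrite -IH reduce_cat.
Qed.

Record free_group :=
  FreeGroup { word_of :> seq (X * bool); word_of_reduced : reduced word_of }.

HB.instance Definition _ := [isSub for word_of].
HB.instance Definition _ := [Choice of free_group by <:].

Definition of_word w := FreeGroup (reduced_reduce w).
Definition free_mul (x y : free_group) := of_word (word_of x ++ word_of y).
Definition free_one := of_word [::].
Definition free_inv (x : free_group) := of_word (inv_word (word_of x)).

Lemma free_mulA : associative free_mul.
Proof.
move=> x y z; apply: val_inj => /=.
have catrr u v : reduce (reduce u ++ v) = reduce (u ++ v).
  by rewrite !reduce_cat foldr_reduce // reduced_reduce.
have catr u v : reduce (u ++ reduce v) = reduce (u ++ v).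
  by rewrite !reduce_cat (reduce_id (reduced_reduce v)).
by rewrite catrr catr catA.
Qed.

Lemma free_mul1 : left_id free_one free_mul.
Proof. by move=> x; apply: val_inj; apply: reduce_id (valP x). Qed.

Lemma free_mulr1 : right_id free_one free_mul.
Proof.
by move=> x; apply: val_inj; rewrite /= cats0; apply: reduce_id (valP x).
Qed.

Lemma free_mulV : left_inverse free_one free_inv free_mul.
Proof.
move=> x; apply: val_inj => /=.
by rewrite reduce_cat foldr_reduce ?reduced_reduce // -reduce_cat reduce_invl.
Qed.

Lemma free_mulrV : right_inverse free_one free_inv free_mul.
Proof.
move=> x; have invx := free_mulV x; have inv2x := free_mulV (free_inv x).
rewrite -[free_mul x _]free_mul1 -{1}inv2x -free_mulA [X in free_mul _ X]free_mulA.
by rewrite invx free_mul1.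
Qed.

HB.instance Definition _ := isGroup.Build free_group
  free_mulA free_mul1 free_mulr1 free_mulV free_mulrV.

Definition gen (x : X) : free_group := of_word [:: (x, false)].

(* The homomorphism from the free group to G extending h. *)
Definition free_lift (G : groupType) (h : X -> G) (w : free_group) : G :=
  \prod_(a <- word_of w) (if a.2 then (h a.1)^-1 else h a.1).

Lemma free_lift_push (G : groupType) (h : X -> G) a w :
  let ev u := \prod_(c <- u) (if c.2 then (h c.1)^-1 else h c.1) in
  ev (push a w) = (if a.2 then (h a.1)^-1 else h a.1) * ev w.
Proof.
move=> ev; rewrite /ev; case: w => [|b w] /=; first by rewrite big_seq1 big_nil mulg1.
case: (eqVneq b (flip a)) => [-> | _] /=; last by rewrite big_cons.
by rewrite big_cons; case: a => x [] /=; rewrite ?mulKg ?mulVKg.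
Qed.

Lemma free_lift_of_word (G : groupType) (h : X -> G) w :
  free_lift h (of_word w) = \prod_(a <- w) (if a.2 then (h a.1)^-1 else h a.1).
Proof.
rewrite /free_lift /=; elim: w => [|a w IH] //.
by rewrite big_cons -IH -free_lift_push.
Qed.

Lemma free_lift_gen (G : groupType) (h : X -> G) x :
  free_lift h (gen x) = h x.
Proof. by rewrite free_lift_of_word big_seq1. Qed.

Lemma free_liftM (G : groupType) (h : X -> G) :
  {morph free_lift h : x y / x * y}.
Proof. by move=> x y; rewrite free_lift_of_word big_cat. Qed.

End FreeGroup.

Section Presented.
Variable F : groupType.
Implicit Types (R N : set F) (x y : F).

Definition normal_subgroup N :=
  [/\ N 1, (forall x y, N x -> N y -> N (x * y)),
      (forall x, N x -> N x^-1) & (forall x y, N x -> N (x ^ y))].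

Definition normal_closure R : set F :=
  [set x | forall N, normal_subgroup N -> (R `<=` N)%classic -> N x].

Lemma normal_closure_normal R : normal_subgroup (normal_closure R).
Proof.
split.
- by move=> N [].
- move=> x y hx hy N nN RN; have [_ NM _ _] := nN.
  exact: NM (hx N nN RN) (hy N nN RN).
- by move=> x hx N nN RN; have [_ _ NV _] := nN; exact: NV (hx N nN RN).
- by move=> x y hx N nN RN; have [_ _ _ NJ] := nN; exact: NJ (hx N nN RN).
Qed.

Lemma sub_normal_closure R : (R `<=` normal_closure R)%classic.
Proof. by move=> x Rx N _; apply. Qed.

Variable R : set F.
Let N := normal_closure R.
Let nN : normal_subgroup N := normal_closure_normal R.

Definition coset_rel x y := `[< normal_closure R (x^-1 * y) >].

Lemma coset_rel_equiv : equiv_class_of coset_rel.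
Proof.
have [N1 NM NV NJ] := nN; split.
- by move=> x; apply/asboolP; rewrite mulVg.
- suff sym x y : coset_rel x y -> coset_rel y x by move=> x y; apply/idP/idP; apply: sym.
  by move/asboolP/NV => h; apply/asboolP; move: h; rewrite invgM invgK.
- move=> y x z /asboolP hxy /asboolP hyz; apply/asboolP.
  by have := NM _ _ hxy hyz; rewrite mulgA mulgK.
Qed.

Canonical coset_equiv := EquivRelPack coset_rel_equiv.

Local Open Scope quotient_scope.

Definition quot := {eq_quot coset_equiv}.
HB.instance Definition _ := Choice.on quot.

Definition quot_pi (x : F) : quot := \pi_({eq_quot coset_equiv}) x.
Definition quot_repr (q : quot) : F :=
  generic_quotient.repr (q : {eq_quot coset_equiv}).

Lemma quot_reprK : cancel quot_repr quot_pi.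
Proof. by move=> q; rewrite /quot_pi /quot_repr reprK. Qed.

Lemma quot_eqP x y : quot_pi x = quot_pi y <-> normal_closure R (x^-1 * y).
Proof.
split; first by move/eqmodP/asboolP.
by move=> h; apply/eqmodP/asboolP.
Qed.

Definition quot_mul (a b : quot) := quot_pi (quot_repr a * quot_repr b).
Definition quot_one := quot_pi 1.
Definition quot_inv (a : quot) := quot_pi (quot_repr a)^-1.

Lemma quot_mul_pi x y : quot_mul (quot_pi x) (quot_pi y) = quot_pi (x * y).
Proof.
have [N1 NM NV NJ] := nN; apply/quot_eqP.
have /quot_eqP hx := quot_reprK (quot_pi x).
have /quot_eqP hy := quot_reprK (quot_pi y).
set x' := quot_repr _ in hx *; set y' := quot_repr _ in hy *.
have -> : (x' * y')^-1 * (x * y) = (x'^-1 * x) ^ y' * (y'^-1 * y).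
  by rewrite conjgE invgM -!mulgA mulVKg.
by apply: NM => //; apply: NJ.
Qed.

Lemma quot_inv_pi x : quot_inv (quot_pi x) = quot_pi x^-1.
Proof.
have [N1 NM NV NJ] := nN; apply/quot_eqP.
have /quot_eqP hx := quot_reprK (quot_pi x).
set x' := quot_repr _ in hx *; rewrite invgK.
have -> : x' * x^-1 = ((x'^-1 * x)^-1) ^ x'^-1.
  by rewrite conjgE invgM !invgK -!mulgA mulgV mulg1.
exact: NJ (NV _ hx).
Qed.

Lemma quot_mulA : associative quot_mul.
Proof.
move=> a b c; rewrite -[a]quot_reprK -[b]quot_reprK -[c]quot_reprK.
by rewrite !quot_mul_pi mulgA.
Qed.

Lemma quot_mul1 : left_id quot_one quot_mul.
Proof. by move=> a; rewrite -[a]quot_reprK quot_mul_pi mul1g. Qed.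

Lemma quot_mulr1 : right_id quot_one quot_mul.
Proof. by move=> a; rewrite -[a]quot_reprK quot_mul_pi mulg1. Qed.

Lemma quot_mulV : left_inverse quot_one quot_inv quot_mul.
Proof. by move=> a; rewrite -[a]quot_reprK quot_inv_pi quot_mul_pi mulVg. Qed.

Lemma quot_mulrV : right_inverse quot_one quot_inv quot_mul.
Proof. by move=> a; rewrite -[a]quot_reprK quot_inv_pi quot_mul_pi mulgV. Qed.

HB.instance Definition _ := isGroup.Build quot
  quot_mulA quot_mul1 quot_mulr1 quot_mulV quot_mulrV.

Lemma quot_piM : {morph quot_pi : x y / x * y}.
Proof. by move=> x y; rewrite -quot_mul_pi. Qed.

Lemma quot_pi1 x : quot_pi x = 1 <-> normal_closure R x.
Proof.
split=> [/esym/quot_eqP | h]; first by rewrite invg1 mul1g.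
by symmetry; apply/quot_eqP; rewrite invg1 mul1g.
Qed.

End Presented.

Definition presented (k : nat) (R : set (free_group 'I_k)) : groupType :=
  quot R.

(* R is a set of defining relators for <g_0, ..., g_(k-1)> on the g_i. *)
Definition presents (k : nat) (G : groupType) (g : k.-tuple G)
    (R : set (free_group 'I_k)) : Prop :=
  normal_closure R = [set w | free_lift (tnth g) w = 1]%classic.

Definition isomorphic (G H : groupType) : Prop :=
  exists f : G -> H, bijective f /\ {morph f : x y / x * y}.

(* Matrices act on the right on row vectors, so row i is the image of the i-th
  basis vector.  'GL_n[F] consists of matrices of size n.-1.+1, which is n for
  n > 0. *)

Section Matrices.
Local Open Scope ring_scope.

(* The Gram matrix in the basis e_1, f_1, e_2, f_2, ..., e_n, f_n, where
   e_(i+1) has index 2i and f_(i+1) has index 2i+1. *)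
Definition hyperbolic_gram (F : finFieldType) (n : nat) :
    'M[F]_(n.*2.-1.+1) :=
  \matrix_(i, j) ((i./2 == j./2)%N && (i != j))%:R.

Definition orthogonal_set (F : finFieldType) (n : nat) :
    {set {'GL_(n.*2)[F]}} :=
  [set g | GLval g *m hyperbolic_gram F n *m (GLval g)^T
           == hyperbolic_gram F n].

Lemma orthogonal_group_set (F : finFieldType) (n : nat) :
  group_set (orthogonal_set F n).
Proof.
apply/group_setP; split=> [|x y]; first by rewrite inE trmx1 mulmx1 mul1mx.
rewrite !inE => /eqP hx /eqP hy; apply/eqP; rewrite -[RHS]hx -[X in _ = _ *m X *m _]hy.
by rewrite GL_ME -mulmxE trmx_mul !mulmxA.
Qed.

Canonical orthogonal_group (F : finFieldType) (n : nat) :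
    {group {'GL_(n.*2)[F]}} := Group (orthogonal_group_set F n).

(* For n >= 3 and odd characteristic, Omega^+(2n, F) is the derived subgroup of
   the isometry group O^+(2n, F). *)
Definition Omega_plus (F : finFieldType) (n : nat) :
    {group {'GL_(n.*2)[F]}} :=
  (orthogonal_group F n)^`(1)%G.

(* The signed permutation matrix b_i |-> (-1)^(d i) b_(s i). *)
Definition sperm_mx (F : finFieldType) (n : nat) (d : 'I_n -> bool)
    (s : 'S_n) : 'M[F]_n :=
  diag_mx (\row_i (-1) ^+ d i) *m perm_mx s.

Lemma sperm_mx_unit (F : finFieldType) (n : nat) (d : 'I_n -> bool)
  (s : 'S_n) : sperm_mx F d s \in unitmx.
Proof.
rewrite unitmx_mul unitmx_perm andbT unitmxE det_diag unitfE.
by apply/prodf_neq0 => i _; rewrite mxE signr_eq0.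
Qed.

Definition sperm (F : finFieldType) (n : nat) (d : 'I_n.-1.+1 -> bool)
    (s : 'S_n.-1.+1) : {'GL_n[F]} :=
  FinRing.unit _ (sperm_mx_unit F d s).

(* (b_1, b_2)^- *)
Definition sperm_U (F : finFieldType) (n : nat) : {'GL_n[F]} :=
  sperm F (fun i => i == 1%N :> nat) (tperm (inord 0) (inord 1)).

(* (b_1, ..., b_n)^(eps_n), where eps_n = (-1)^(n+1) *)
Definition sperm_V (F : finFieldType) (n : nat) : {'GL_n[F]} :=
  sperm F (fun i => (i == n.-1 :> nat) && odd n.+1) (perm (@ordS_inj _)).

Definition mx22 (F : finFieldType) (a b c d : F) : 'M[F]_2 :=
  \matrix_(i, j) if i == 0 then if j == 0 then a else b
                 else if j == 0 then c else d.

Lemma mx22_unit (F : finFieldType) (a b c d : F) :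
  a * d - b * c = 1 -> mx22 a b c d \in unitmx.
Proof.
move=> h; rewrite unitmxE (expand_det_row _ ord0) !big_ord_recl big_ord0.
rewrite /cofactor !det_mx11 !mxE /= addr0 expr0 mul1r expr1 mulN1r mulrN.
by rewrite h unitr1.
Qed.

Lemma sl2_sigma_det (F : finFieldType) : 1 * 1 - 1 * 0 = 1 :> F.
Proof. by rewrite mulr0 subr0 mulr1. Qed.

Lemma sl2_U_det (F : finFieldType) : 0 * 0 - 1 * - 1 = 1 :> F.
Proof. by rewrite mulr0 mul1r sub0r opprK. Qed.

Definition sl2_sigma (F : finFieldType) : {'GL_2[F]} :=
  FinRing.unit _ (mx22_unit (sl2_sigma_det F)).

Definition sl2_U (F : finFieldType) : {'GL_2[F]} :=
  FinRing.unit _ (mx22_unit (sl2_U_det F)).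

End Matrices.

(* S, Z, U, V stand for sigma, Z, U', V'; a relation x = y is encoded by the
  relator x * y^-1, and "S is centralised by x" by [~ S, x]. *)

Section Relators.
Variables (F : groupType) (n : nat) (S Z U V : F).

Inductive relator_i : F -> Prop :=
| rel_i_1 : 3 < n -> relator_i [~ Z, U ^ (V ^+ 2)]
| rel_i_2 : 4 < n -> relator_i [~ Z, V * U * U ^ V]
| rel_i_3 : relator_i (Z ^+ 2)
| rel_i_4 : relator_i [~ Z, (U ^+ 2) ^ V]
| rel_i_5 : relator_i (Z * Z ^ V * (Z ^ (V * U))^-1)
| rel_i_6 : relator_i [~ Z, U]
| rel_i_7 : relator_i [~ Z, Z ^ V]
| rel_i_8 : 3 < n -> relator_i [~ Z, Z ^ (V ^+ 2)].

Inductive relator_ii : F -> Prop :=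
| rel_ii_1 : 3 < n -> relator_ii [~ S, U ^ (V ^+ 2)]
| rel_ii_2 : 4 < n -> relator_ii [~ S, V * U^-1 * (U^-1) ^ V]
| rel_ii_3 : 3 < n -> relator_ii [~ S, Z ^ (V ^+ 2)]
| rel_ii_4 : relator_ii [~ S, Z * U].

Inductive relator_iv : F -> Prop :=
| rel_iv_a : relator_iv ([~ S, S ^ V] * (S ^ (V * U^-1))^-1)
| rel_iv_b : relator_iv [~ S, S ^ (V * U^-1)]
| rel_iv_c : relator_iv [~ S, S ^ (U ^ (V * U^-1))]
| rel_iv_d : 3 < n -> relator_iv [~ S, S ^ (V ^+ 2)]
| rel_iv_e : relator_iv [~ S, S ^ (Z ^ V)]
| rel_iv_f : n = 4 -> relator_iv [~ S, S ^ (Z ^ V * V ^+ 2)].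

(* The relators in x_0, ..., x_(k-1) become relators in g_0, ..., g_(k-1). *)
Definition relators_on (k : nat) (g : k.-tuple F)
    (R : set (free_group 'I_k)) : set F :=
  [set free_lift (tnth g) r | r in R]%classic.

(* R_UV: defining relators for <U', V'>; R_SU: defining relators for SL(2, p)
   on sigma, U'. *)
Definition relators (R_UV R_SU : set (free_group 'I_2)) : set F :=
  (relators_on [tuple U; V] R_UV `|` relator_i `|` relator_ii
   `|` relators_on [tuple S; U] R_SU `|` relator_iv)%classic.

End Relators.

Definition omega_plus_relators (n : nat) (R_UV R_SU : set (free_group 'I_2)) :
    set (free_group 'I_4) :=
  relators n (gen (inord 0)) (gen (inord 1)) (gen (inord 2)) (gen (inord 3))
    R_UV R_SU.

(* Main.v *)
Require Import Defs.
From mathcomp Require Import all_boot all_order all_fingroup all_algebra all_solvable.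
From mathcomp Require Import boolp classical_sets.
From mathcomp Require Import ring zify.

Set Implicit Arguments.
Unset Strict Implicit.
Unset Printing Implicit Defensive.
Import GRing.Theory.
Local Open Scope group_scope.

(** The presented group G maps onto Omega^+(2n, p), and the point is that nothing is
  lost. Let i, j stand for vectors of the hyperbolic basis, and let neg exchange
  e_k and f_k. For i, j of different planes there is the root element x i j t of
  the orthogonal group, with i -> i + t j and neg j -> neg j - t (neg i). The root
  elements satisfy the Steinberg relations of type D_n, and the two commuting
  copies of SL2 on the pairs (i, j) and (i, neg j) have the same central element.
  The proof finds such a family of elements in G, and shows that any group
  generated by such a family is faithfully represented by its matrices.

  Root elements in G. By the relators R_UV, U and V generate the signed
  permutations of determinant 1, and by relator_i the conjugates of Z under them
  are interchanges at two planes (Zc i j), multiplying as they should. Products of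
  these and signed permutations form the monomial group Ng, which is transitive on
  pairs of basis vectors of different planes. By relator_ii, a monomial element
  that fixes e_1 and e_2 (or negates both) centralises S (NS), so the conjugates
  of S are indexed by such pairs: X i j := S ^ g for a monomial g with e_1 -> e_i
  and e_2 -> e_j. A sign change must invert the root element; this is not among
  the relations, and is extracted in S_inv from those for the first three planes
  and from SL(2, p). The relations relator_iv are the Steinberg relations for one
  pair of positions of each shape, and transitivity of the monomial group on
  triples and quadruples spreads them to all (lift3, lift4, X_comm, X_disj). The
  interchanges come in pairs, so the monomial group preserves the parity of the
  number of vectors f_k in a triple or a quadruple that meets all planes. For
  triples the odd positions are reached through the symmetry X i j = (X (neg j)
  (neg i))^-1, which comes from the relation rel_ii_4; for quadruples a fifth
  plane serves, and in its absence, for n = 4, the relation rel_iv_f. Conjugating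
  the copy of SL(2, p) on S and U in the same way gives the copies fam i j of SL2,
  so fam is a Steinberg family (fam_steinberg). It generates G, because U and its
  conjugates give the signed permutations, and Z is a product of U^-1 and of the
  conjugate of U by an interchange (XA_all).

  Faithfulness (span_faithful). Let G_A be generated by the root elements whose
  indices lie in a set A of planes, and remove one plane {m, neg m}. With L
  generated by the root elements of the other planes, Q and Q- by those with head
  m and neg m, and h the torus of a pair, G_A = L h Q Q- Q: multiplying by a
  further root element stays in this set by a computation in SL2 (cell_low). Hence
  an element fixing e_(neg m) lies in L Q (stab_LQ); if it is represented by the
  identity, its Q-part, which can be read off the image of e_m, is trivial, and
  induction applies to L. Two planes are left at the end: there the group is a
  product of two commuting copies of SL2, and the condition on the central
  elements is what makes the representation injective (plane_faithful).

  The image. The derived subgroup of the full isometry group is generated by the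
  root elements (derived_EA): every isometry is, modulo root elements, an isometry
  of a single hyperbolic plane, and commutators of those are squares in its torus,
  which are products of root elements. The relations hold for the matrices because
  all the words concerned are monomial matrices or root elements (model_rel_i,
  model_rel_ii, model_rel_iv). *)

(** * Generated subgroups and elementary matrices *)

Section Generated.
Variable G : groupType.
Implicit Types (X P : G -> Prop) (g h : G).

(** Only products of generators, no inverses: the generating sets below are closed
  under inversion, and induction then has a single step to consider. *)
Inductive spanned X : G -> Prop :=
| spanned1 : spanned X 1
| spannedMr g h : spanned X g -> X h -> spanned X (g * h).

Lemma spanned_in X g : X g -> spanned X g.
Proof. by move=> Xg; rewrite -[g]mul1g; apply: spannedMr => //; apply: spanned1. Qed.

Lemma spannedM X g h : spanned X g -> spanned X h -> spanned X (g * h).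
Proof.
move=> Xg; elim=> [|h1 h2 _ IH Xh2]; first by rewrite mulg1.
by rewrite mulgA; apply: spannedMr.
Qed.

Lemma spannedV X g : (forall h, X h -> X h^-1) -> spanned X g -> spanned X g^-1.
Proof.
move=> XV; elim=> [|h1 h2 _ IH Xh2]; first by rewrite invg1; apply: spanned1.
by rewrite invgM; apply: spannedM => //; apply: spanned_in; apply: XV.
Qed.

Lemma spanned_conj X P y : P 1 -> (forall g h, P g -> P h -> P (g * h)) ->
  (forall g, X g -> P (g ^ y)) -> forall g, spanned X g -> P (g ^ y).
Proof.
move=> P1 PM PX g; elim=> [|h1 h2 _ IH Xh2]; first by rewrite conj1g.
by rewrite conjMg; apply: PM => //; apply: PX.
Qed.

Lemma conjg_commg (y z : G) : y ^ z = y * [~ y, z].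
Proof. by rewrite commgEl mulVKg. Qed.

End Generated.

Section SL2.
Variable F : fieldType.
Local Open Scope ring_scope.

(** Every matrix of determinant 1 is a product of elementary ones, so a property
  of such matrices can be checked on the elementary ones. *)
Lemma sl2_ind (P : F -> F -> F -> F -> Prop) :
  (forall t, P 1 t 0 1) -> (forall t, P 1 0 t 1) ->
  (forall a b c d a' b' c' d', a * d - b * c = 1 -> a' * d' - b' * c' = 1 ->
     P a b c d -> P a' b' c' d' ->
     P (a * a' + b * c') (a * b' + b * d') (c * a' + d * c') (c * b' + d * d')) ->
  forall a b c d, a * d - b * c = 1 -> P a b c d.
Proof.
move=> Pu Pl PM.
have det_u (t : F) : 1 * 1 - t * 0 = 1 by ring.
have det_l (t : F) : 1 * 1 - 0 * t = 1 by ring.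
have P0 a b c d : c != 0 -> a * d - b * c = 1 -> P a b c d.
  move=> c0 det.
  have := PM _ _ _ _ _ _ _ _ _ _ (PM _ _ _ _ _ _ _ _ _ _ (Pu ((a - 1) / c))
    (Pl c)) (Pu ((d - 1) / c)).
  have -> : b = (a * d - 1) / c by rewrite -det; field.
  set Q1 := P _ _ _ _; set Q2 := P _ _ _ _ => h.
  suff <- : Q1 = Q2 by apply: h => //; field.
  by rewrite /Q1 /Q2; congr (P _ _ _ _); field.
move=> a b c d det; case: (eqVneq c 0) => [c0|]; last by move=> ?; exact: P0.
have d0 : d != 0.
  by apply: contra_eq_neq det => ->; rewrite c0 !mulr0 subr0 eq_sym oner_neq0.
have cd0 : c + d != 0 by rewrite c0 add0r.
have det1 : (a + b) * d - b * (c + d) = 1 by rewrite -det; ring.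
have det2 : 1 * 1 - 0 * (-1) = 1 :> F by ring.
have := PM _ _ _ _ _ _ _ _ det1 det2 (P0 _ _ _ _ cd0 det1) (Pl (-1)).
set Q1 := P _ _ _ _; set Q2 := P _ _ _ _ => h; suff <- : Q1 = Q2 by [].
by rewrite /Q1 /Q2; congr (P _ _ _ _); ring.
Qed.

End SL2.

(** * Steinberg families *)

Section SteinbergFamily.
Variables (F : fieldType) (N : nat) (neg : 'I_N -> 'I_N).
Implicit Types (i j k l m : 'I_N) (s t a b c d : F).

(** The two basis vectors lie in different hyperbolic planes. *)
Definition apart i j := (j != i) && (j != neg i).
Local Notation dis := apart.

(** A copy phi i j of SL2 for each pair of planes and choice of a basis vector in
  each, its elementary matrices being the root elements of type D_n.  The last
  condition identifies the central elements of the commuting copies at (i, j) and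
  (i, neg j); both negate the two planes. *)
Record steinberg_family (G : groupType)
    (phi : 'I_N -> 'I_N -> F -> F -> F -> F -> G) : Prop := SteinbergFamily {
  sfM : forall i j a b c d a' b' c' d', dis i j ->
    (a * d - b * c = 1)%R -> (a' * d' - b' * c' = 1)%R ->
    phi i j a b c d * phi i j a' b' c' d' =
    phi i j (a * a' + b * c')%R (a * b' + b * d')%R
            (c * a' + d * c')%R (c * b' + d * d')%R;
  sf_low : forall i j t, dis i j -> phi i j 1%R 0%R t 1%R = phi j i 1%R t 0%R 1%R;
  sf_neg : forall i j t, dis i j ->
    phi i j 1%R t 0%R 1%R = phi (neg j) (neg i) 1%R (- t)%R 0%R 1%R;
  sf_comm : forall i j k s t, dis i j -> dis i k -> dis j k ->
    [~ phi i j 1%R s 0%R 1%R, phi j k 1%R t 0%R 1%R] = phi i k 1%R (s * t)%R 0%R 1%R;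
  sf_head : forall i j k s t, dis i j -> dis i k -> dis j k ->
    commute (phi i j 1%R s 0%R 1%R) (phi i k 1%R t 0%R 1%R);
  sf_opp : forall i j s t, dis i j ->
    commute (phi i j 1%R s 0%R 1%R) (phi i (neg j) 1%R t 0%R 1%R);
  sf_disj : forall i j k l s t, dis i j -> dis i k -> dis i l -> dis j k ->
    dis j l -> dis k l -> commute (phi i j 1%R s 0%R 1%R) (phi k l 1%R t 0%R 1%R);
  sf_center : forall i j, dis i j ->
    phi i j (-1)%R 0%R 0%R (-1)%R = phi i (neg j) (-1)%R 0%R 0%R (-1)%R
}.

Hypothesis negK : involutive neg.
Hypothesis neg_neq : forall i, neg i != i.

Lemma neg_eq i j : (neg i == j) = (i == neg j).
Proof. by rewrite -(can_eq negK) negK. Qed.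

Lemma dis_sym i j : dis i j = dis j i.
Proof. by rewrite /dis eq_sym -neg_eq (eq_sym (neg j)). Qed.

Lemma dis_negl i j : dis (neg i) j = dis i j.
Proof. by rewrite /dis negK andbC. Qed.

Lemma dis_negr i j : dis i (neg j) = dis i j.
Proof. by rewrite dis_sym dis_negl dis_sym. Qed.

Definition dis_neg := (dis_negl, dis_negr).

Lemma dis_irr i : dis i i = false.
Proof. by rewrite /dis eqxx. Qed.

Variables (G : groupType) (phi : 'I_N -> 'I_N -> F -> F -> F -> F -> G).
Hypothesis phiP : steinberg_family phi.

Definition x i j t := phi i j 1%R t 0%R 1%R.

Lemma xD i j s t : dis i j -> x i j s * x i j t = x i j (s + t)%R.
Proof.
move=> dij; rewrite /x (sfM phiP) //; try by ring.
by congr (phi _ _ _ _ _ _); ring.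
Qed.

Lemma x0 i j : dis i j -> x i j 0%R = 1.
Proof. by move=> dij; apply: (mulgI (x i j 0%R)); rewrite xD // addr0 mulg1. Qed.

Lemma xV i j t : dis i j -> (x i j t)^-1 = x i j (- t)%R.
Proof. by move=> dij; apply: mulg1_eq; rewrite xD // addrN x0. Qed.

Lemma phi1 i j : dis i j -> phi i j 1%R 0%R 0%R 1%R = 1.
Proof. exact: x0. Qed.

Lemma x_neg i j t : dis i j -> x i j t = x (neg j) (neg i) (- t)%R.
Proof. exact: (sf_neg phiP). Qed.

Lemma x_low i j t : dis i j -> phi i j 1%R 0%R t 1%R = x j i t.
Proof. exact: (sf_low phiP). Qed.

Lemma x_comm i j k s t : dis i j -> dis i k -> dis j k ->
  [~ x i j s, x j k t] = x i k (s * t)%R.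
Proof. exact: (sf_comm phiP). Qed.

Lemma x_headC i j k s t : dis i j -> dis i k -> k != j ->
  commute (x i j s) (x i k t).
Proof.
move=> dij dik kj; case: (eqVneq k (neg j)) => [->|knj]; first exact: (sf_opp phiP).
by apply: (sf_head phiP) => //; rewrite /dis kj.
Qed.

Lemma x_tailC i j k s t : dis i j -> dis k j -> k != i ->
  commute (x i j s) (x k j t).
Proof.
move=> dij dkj ki; rewrite (x_neg _ dij) (x_neg _ dkj).
by apply: x_headC; rewrite ?dis_neg 1?dis_sym // (can_eq negK).
Qed.

Lemma x_disjC i j k l s t : dis i j -> dis i k -> dis i l -> dis j k ->
    dis j l -> dis k l -> commute (x i j s) (x k l t).
Proof. exact: (sf_disj phiP). Qed.

(** The root elements from the pair (i, j) to a third index k form the dual of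
  the natural module of the copy of SL2 of that pair; those from k to the pair, in
  the next lemma, form the natural module. *)
Lemma phi_col i j k s s' a b c d : dis i j -> dis i k -> dis j k ->
  (a * d - b * c)%R = 1%R ->
  (x i k s * x j k s') ^ phi i j a b c d =
  x i k (d * s - b * s')%R * x j k (a * s' - c * s)%R.
Proof.
move=> dij dik djk det; move: a b c d det s s'; apply: sl2_ind => [t|t|].
- move=> s s'; rewrite -/(x i j t) conjMg.
  have -> : x i k s ^ x i j t = x i k s.
    apply/conjg_fixP/commgP; apply: x_headC => //.
    by apply: contraTneq djk => ->; rewrite dis_irr.
  have -> : x j k s' ^ x i j t = x j k s' * x i k (- (t * s'))%R.
    by rewrite conjg_commg -invgR x_comm // xV.
  rewrite x_tailC //; last by apply: contraTneq dij => ->; rewrite dis_irr.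
  rewrite mulgA xD //; congr (x _ _ _ * x _ _ _); ring.
- move=> s s'; rewrite x_low // conjMg.
  have -> : x j k s' ^ x j i t = x j k s'.
    apply/conjg_fixP/commgP; apply: x_headC => //; first by rewrite dis_sym.
    by apply: contraTneq dik => ->; rewrite dis_irr.
  have -> : x i k s ^ x j i t = x i k s * x j k (- (t * s))%R.
    by rewrite conjg_commg -invgR x_comm // ?xV // dis_sym.
  rewrite -mulgA xD //; congr (x _ _ _ * x _ _ _); ring.
- move=> a b c d a' b' c' d' det det' IH IH' s s'.
  rewrite -(sfM phiP) // conjgM IH IH'; congr (x _ _ _ * x _ _ _); ring.
Qed.

Lemma phi_row i j k s s' a b c d : dis i j -> dis k i -> dis k j ->
  (a * d - b * c)%R = 1%R ->
  (x k i s * x k j s') ^ phi i j a b c d =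
  x k i (s * a + s' * c)%R * x k j (s * b + s' * d)%R.
Proof.
move=> dij dki dkj det; move: a b c d det s s'.
have ij : j != i by case/andP: dij.
apply: sl2_ind => [t|t|].
- move=> s s'; rewrite -/(x i j t) conjMg.
  have -> : x k j s' ^ x i j t = x k j s'.
    apply/conjg_fixP/commgP; apply: x_tailC => //.
    by apply: contraTneq dki => ->; rewrite dis_irr.
  have -> : x k i s ^ x i j t = x k i s * x k j (s * t)%R.
    by rewrite conjg_commg x_comm.
  rewrite -mulgA xD //; congr (x _ _ _ * x _ _ _); ring.
- move=> s s'; rewrite x_low // conjMg.
  have -> : x k i s ^ x j i t = x k i s.
    apply/conjg_fixP/commgP; apply: x_tailC => //; first by rewrite dis_sym.
    by apply: contraTneq dkj => ->; rewrite dis_irr.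
  have -> : x k j s' ^ x j i t = x k j s' * x k i (s' * t)%R.
    by rewrite conjg_commg x_comm // dis_sym.
  have -> (u v : F) : x k j u * x k i v = x k i v * x k j u.
    by apply: x_headC => //; rewrite eq_sym.
  rewrite mulgA xD //.
  congr (x _ _ _ * x _ _ _); ring.
- move=> a b c d a' b' c' d' det det' IH IH' s s'.
  rewrite -(sfM phiP) // conjgM IH IH'; congr (x _ _ _ * x _ _ _); ring.
Qed.

Lemma phi_commute i j g a b c d : dis i j -> (a * d - b * c)%R = 1%R ->
  (forall t, commute g (x i j t)) -> (forall t, commute g (x j i t)) ->
  commute g (phi i j a b c d).
Proof.
move=> dij det Cu Cl; move: a b c d det; apply: sl2_ind => [t|t|].
- exact: Cu.
- by rewrite x_low.
- move=> a b c d a' b' c' d' det det' C C'.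
  by rewrite -(sfM phiP) //; apply: commuteM.
Qed.

(** The torus of a pair, to which w below adds the Weyl elements. *)
Definition h i j t := phi i j t 0%R 0%R t^-1%R.

Lemma det_h t : t != 0%R -> (t * t^-1 - 0 * 0)%R = 1%R.
Proof. by move=> t0; field. Qed.

Lemma hM i j s t : dis i j -> s != 0%R -> t != 0%R ->
  h i j s * h i j t = h i j (s * t)%R.
Proof.
move=> dij s0 t0; rewrite /h (sfM phiP) ?det_h //.
by congr (phi _ _ _ _ _ _); field; rewrite ?s0 ?t0.
Qed.

Lemma h1 i j : dis i j -> h i j 1%R = 1.
Proof. by move=> dij; rewrite /h invr1 phi1. Qed.

Lemma hV i j t : dis i j -> t != 0%R -> (h i j t)^-1 = h i j t^-1%R.
Proof.
move=> dij t0; apply: mulg1_eq.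
by rewrite hM ?invr_neq0 // divff // h1.
Qed.

Definition w i j t := phi i j 0%R t (- t^-1)%R 0%R.

Lemma det_w t : t != 0%R -> (0 * 0 - t * - t^-1)%R = 1%R.
Proof. by move=> t0; field. Qed.

Lemma x_h_head i j l s t : t != 0%R -> dis i j -> dis i l ->
  exists u, x i l s ^ h i j t = x i l u.
Proof.
move=> t0 dij dil; case: (eqVneq l j) => [->|lj].
  exists (t^-1 * (s * t^-1))%R.
  rewrite conjgE hV // /h /x invrK !(sfM phiP) ?det_h ?invr_neq0 //; try by field.
  by congr (phi _ _ _ _ _ _); field.
case: (eqVneq l (neg j)) => [->|lnj].
  exists s; apply/conjg_fixP/commgP; apply: phi_commute => // [|u|u].
  - exact: det_h.
  - by apply: x_headC; rewrite ?dis_neg // eq_sym.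
  - rewrite x_neg ?dis_neg // negK; apply: x_headC; rewrite ?dis_neg // 1?dis_sym //.
    by rewrite eq_sym.
have djl : dis j l by rewrite /dis lj lnj.
exists (t^-1 * s)%R.
have := phi_col s 0%R dij dil djl (det_h t0).
by rewrite x0 // mulg1 -/(h i j t) => ->; rewrite !mul0r mulr0 !subr0 x0 ?mulg1.
Qed.

Lemma x_h_tail i j k s t : t != 0%R -> dis i j -> dis k i ->
  exists u, x k i s ^ h i j t = x k i u.
Proof.
move=> t0 dij dki; case: (eqVneq k j) => [->|kj].
  exists (t * (s * t))%R.
  rewrite conjgE hV // -(x_low s dij) -(x_low (t * (s * t))%R dij) /h invrK.
  rewrite !(sfM phiP) ?det_h ?invr_neq0 //; try by field.
  by congr (phi _ _ _ _ _ _); field.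
case: (eqVneq k (neg j)) => [->|knj].
  exists s; apply/conjg_fixP/commgP; apply: phi_commute => // [|u|u].
  - exact: det_h.
  - rewrite x_neg ?dis_neg 1?dis_sym // negK.
    by apply: x_tailC; rewrite ?dis_neg // eq_sym.
  - by apply: x_tailC; rewrite ?dis_neg 1?dis_sym // eq_sym.
have dkj : dis k j by rewrite dis_sym /dis kj knj.
exists (s * t)%R.
have := phi_row s 0%R dij dki dkj (det_h t0).
by rewrite x0 // mulg1 -/(h i j t) => ->; rewrite ?mulr0 ?mul0r !addr0 x0 ?mulg1.
Qed.

Lemma phi_swap i j a b c d : dis i j -> (a * d - b * c)%R = 1%R ->
  phi i j a b c d = phi j i d c b a.
Proof.
move=> dij; have dji : dis j i by rewrite dis_sym.
move: a b c d; apply: sl2_ind => [t|t|].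
- by rewrite x_low.
- by rewrite x_low.
- move=> a b c d a' b' c' d' det det' IH IH'.
  rewrite -(sfM phiP) // IH IH' (sfM phiP) //; last 2 first.
  + by rewrite -det; ring.
  + by rewrite -det'; ring.
  by congr (phi _ _ _ _ _ _); ring.
Qed.

Lemma h_swap i j t : dis i j -> t != 0%R -> h i j t = h j i t^-1%R.
Proof. by move=> dij t0; rewrite /h invrK phi_swap // det_h. Qed.

(** The torus normalises every root subgroup.  Only the existence of the scalar
  matters; the cases are the positions of k and l relative to i and j. *)
Lemma x_h i j k l s t : t != 0%R -> dis i j -> dis k l ->
  exists u, x k l s ^ h i j t = x k l u.
Proof.
move=> t0 dij dkl.
have dji : dis j i by rewrite dis_sym.
have dlk : dis l k by rewrite dis_sym.
have base k' l' s' : dis k' l' -> [|| k' == i, k' == j, l' == i | l' == j] ->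
    exists u, x k' l' s' ^ h i j t = x k' l' u.
  move=> d /or4P[] /eqP e; subst.
  - exact: x_h_head.
  - by rewrite h_swap //; apply: x_h_head; rewrite ?invr_neq0.
  - exact: x_h_tail.
  - by rewrite h_swap //; apply: x_h_tail; rewrite ?invr_neq0.
case: (boolP [|| k == i, k == j, l == i | l == j]) => [|nb]; first exact: base.
case: (boolP [|| neg l == i, neg l == j, neg k == i | neg k == j]) => [b|nb'].
  have [|u eu] := base _ _ (- s)%R _ b; first by rewrite !dis_neg.
  by exists (- u)%R; rewrite x_neg // eu [RHS]x_neg // opprK.
have [dik djk dil djl] : [/\ dis i k, dis j k, dis i l & dis j l].
  move: nb nb'; rewrite !negb_or /dis -!neg_eq.
  by case/and4P=> -> -> -> -> /and4P[-> -> -> ->].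
exists s; apply/conjg_fixP/commgP; apply: phi_commute => // [|u|u].
- exact: det_h.
- by apply: x_disjC; rewrite // 1?dis_sym.
- by apply: x_disjC; rewrite // 1?dis_sym.
Qed.

(** Conjugation that carries both root subgroups of a pair to those of another pair
  carries the copy of SL2, up to a diagonal automorphism. *)
Lemma phi_conj i j i' j' u g a b c d : dis i j -> dis i' j' -> u != 0%R ->
  (forall t, x i j t ^ g = x i' j' (u * t)%R) ->
  (forall t, x j i t ^ g = x j' i' (u^-1 * t)%R) ->
  (a * d - b * c)%R = 1%R ->
  phi i j a b c d ^ g = phi i' j' a (u * b)%R (u^-1 * c)%R d.
Proof.
move=> dij dij' u0 eu el det; move: a b c d det; apply: sl2_ind => [t|t|].
- by rewrite -/(x i j t) eu mulr0.
- by rewrite x_low // el mulr0 x_low.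
- move=> a b c d a' b' c' d' det det' IH IH'.
  rewrite -(sfM phiP) // conjMg IH IH' (sfM phiP) //; last 2 first.
  + by rewrite -det; field.
  + by rewrite -det'; field.
  by congr (phi _ _ _ _ _ _); field.
Qed.

(** The coroot identity: the one-parameter tori of an A2 subsystem multiply.  The
  torus of one pair is carried to that of another by a Weyl element of the third
  pair, and that element is rescaled by the torus. *)
Lemma h_mul i j k t : t != 0%R -> dis i j -> dis i k -> dis j k ->
  h i j t = h i k t * h k j t.
Proof.
move=> t0 dij dik djk.
have dkj : dis k j by rewrite dis_sym.
have dki : dis k i by rewrite dis_sym.
have dji : dis j i by rewrite dis_sym.
have det1 := det_w (oner_neq0 F).
have -> : h i j t = h i k t ^ w k j 1%R.
  symmetry; rewrite [RHS]/h -[X in phi _ _ _ X](mulr0 1%R).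
  rewrite -[X in phi _ _ _ _ X](mulr0 1^-1%R).
  apply: phi_conj; rewrite ?oner_neq0 ?det_h // => s.
    have := phi_row s 0%R dkj dik dij det1.
    by rewrite x0 // mulg1 ?mulr0 ?mul0r ?addr0 x0 // mul1g mulr1 mul1r.
  have := phi_col s 0%R dkj dki dji det1.
  rewrite x0 // mulg1 ?mulr0 ?mul0r ?subr0 x0 // mul1g => ->.
  by congr (x _ _ _); field; rewrite oner_eq0.
have -> : h i k t ^ w k j 1%R = h i k t * ((w k j 1%R)^-1 ^ h i k t * w k j 1%R).
  by rewrite !conjgE !mulgA mulgV mul1g.
congr (_ * _).
have -> : (w k j 1%R)^-1 = w k j (-1)%R.
  apply: mulg1_eq; rewrite /w (sfM phiP) ?det_w ?oppr_eq0 ?oner_neq0 // -(phi1 dkj).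
  by congr (phi _ _ _ _ _ _); field; rewrite ?t0 ?oppr_eq0 ?oner_neq0.
rewrite [w k j (-1)%R]/w (@phi_conj k j k j t) ?det_w ?oppr_eq0 ?oner_neq0 //.
- rewrite (sfM phiP) //; try by field; rewrite ?t0 ?oppr_eq0 ?oner_neq0.
  by rewrite /h; congr (phi _ _ _ _ _ _); field; rewrite ?t0 ?oppr_eq0 ?oner_neq0.
- move=> s; have := phi_col 0%R s dik dij dkj (det_h t0).
  by rewrite x0 // mul1g ?mulr0 ?mul0r ?subr0 x0 // mul1g.
- move=> s; have := phi_row 0%R s dik dji djk (det_h t0).
  by rewrite x0 // mul1g ?mulr0 ?mul0r ?add0r x0 // mul1g mulrC.
Qed.

(** * Gauss decomposition and faithfulness *)

Implicit Types (T : rel 'I_N).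

(** The subgroup generated by the root subgroups at the positions T. *)
Definition XG T : G -> Prop :=
  spanned (fun g => exists i j t, [/\ T i j, dis i j & g = x i j t]).

Lemma XG_x (T : rel 'I_N) i j t : T i j -> dis i j -> XG T (x i j t).
Proof. by move=> Tij dij; apply: spanned_in; exists i, j, t. Qed.

Lemma XG_M T g g' : XG T g -> XG T g' -> XG T (g * g').
Proof. exact: spannedM. Qed.

Lemma XG_V T g : XG T g -> XG T g^-1.
Proof.
apply: spannedV => y [i] [j] [t] [Tij dij ->].
by exists i, j, (- t)%R; rewrite xV.
Qed.

Lemma XG_conj T (P : G -> Prop) y : P 1 -> (forall g g', P g -> P g' -> P (g * g')) ->
  (forall i j t, T i j -> dis i j -> P (x i j t ^ y)) -> forall g, XG T g -> P (g ^ y).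
Proof.
by move=> P1 PM PX; apply: spanned_conj => // g [i] [j] [t] [Tij dij ->]; apply: PX.
Qed.

Lemma XG_phi (T : rel 'I_N) i j a b c d : T i j -> T j i -> dis i j ->
  (a * d - b * c)%R = 1%R -> XG T (phi i j a b c d).
Proof.
move=> Tij Tji dij; move: a b c d; apply: sl2_ind => [t|t|].
- exact: XG_x.
- by rewrite x_low //; apply: XG_x; rewrite // dis_sym.
- move=> a b c d a' b' c' d' det det' IH IH'.
  by rewrite -(sfM phiP) //; apply: XG_M.
Qed.

Section Parabolic.
Variables (B : pred 'I_N).
Hypothesis B_neg : forall i, B (neg i) = B i.

(** For a set B of planes: the Levi part Lv on the planes of B and, for a further
  index m, the unipotent radical Qr m with head m. *)
Definition Lv := XG (fun i j => B i && B j).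
Definition Qr m := XG (fun i j => (i == m) && B j).

Lemma dis_B m k : ~~ B m -> B k -> dis m k.
Proof.
move=> Bm Bk; rewrite /dis; apply/andP; split; apply: contraNneq Bm => e.
  by rewrite -e.
by rewrite -B_neg -e.
Qed.

Lemma Qr_comm m g g' : ~~ B m -> Qr m g -> Qr m g' -> commute g g'.
Proof.
move=> Bm; elim=> [|g1 g2 _ IH [i] [j] [t] [/andP[/eqP-> Bj] dij ->]] Qg'.
  exact/commute_sym/commute1.
apply/commute_sym/commuteM; first exact/commute_sym/IH.
elim: Qg' => [|h1 h2 _ IH' [i'] [k] [s] [/andP[/eqP-> Bk] dik ->]].
  exact/commute_sym/commute1.
apply/commute_sym/commuteM; first exact/commute_sym/IH'.
case: (eqVneq k j) => [->|kj]; last by apply: x_headC; rewrite ?dis_B.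
by rewrite /commute !xD ?dis_B // addrC.
Qed.

Lemma Qr_norm m q y : ~~ B m -> Lv y -> Qr m q -> Qr m (q ^ y).
Proof.
move=> Bm Ll; elim: Ll q => [|y1 y2 _ IH [i] [j] [t] [/andP[Bi Bj] dij ->]] q Qq.
  by rewrite conjg1.
rewrite conjgM; move: (q ^ y1) (IH _ Qq) => {}q {IH} {}Qq.
have dmi := dis_B Bm Bi; have dmj := dis_B Bm Bj.
have xQ k u : B k -> Qr m (x m k u) by move=> Bk; apply: XG_x; rewrite ?eqxx ?dis_B.
move: q Qq; apply: XG_conj => [||m' k s /andP[/eqP-> Bk] dmk].
- exact: spanned1.
- exact: XG_M.
case: (eqVneq k i) => [->|ki].
  by rewrite conjg_commg x_comm //; apply: XG_M; apply: xQ.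
case: (eqVneq k (neg j)) => [->|kj].
  rewrite (x_neg _ dij) conjg_commg x_comm ?dis_neg // 1?dis_sym //.
  by apply: XG_M; apply: xQ; rewrite B_neg.
suff -> : x m k s ^ x i j t = x m k s by apply: xQ.
apply/conjg_fixP/commgP.
case: (eqVneq k j) => [->|kj'].
  apply: x_tailC => //; apply: contraTneq dmi => ->; by rewrite dis_irr.
case: (eqVneq k (neg i)) => [->|ki'].
  rewrite (x_neg _ dij); apply: x_tailC; rewrite ?dis_neg // 1?dis_sym //.
  by apply: contraTneq dmj => <-; rewrite dis_neg dis_irr.
apply: x_disjC => //.
- by rewrite dis_sym /dis ki.
- by rewrite dis_sym /dis kj'.
Qed.

(** Lv normalises Qr m, so this is a subgroup: the parabolic without its torus. *)
Definition LQ m g := exists y q, [/\ Lv y, Qr m q & g = y * q].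

Lemma LQ_L m y : Lv y -> LQ m y.
Proof. by move=> Ly; exists y, 1; rewrite mulg1; split=> //; apply: spanned1. Qed.

Lemma LQ_Q m q : Qr m q -> LQ m q.
Proof. by move=> Qq; exists 1, q; rewrite mul1g; split=> //; apply: spanned1. Qed.

Lemma LQ_M m g g' : ~~ B m -> LQ m g -> LQ m g' -> LQ m (g * g').
Proof.
move=> Bm [y [q [Ly Qq ->]]] [y' [q' [Ly' Qq' ->]]].
exists (y * y'), (q ^ y' * q'); split; first exact: XG_M.
  by apply: XG_M => //; apply: Qr_norm.
by rewrite conjgE !mulgA mulgK.
Qed.

(** The radical without the position j, on which the pair (m, j) acts below. *)
Definition Qr' m j := XG (fun i k => [&& i == m, B k & k != j]).

Lemma Qr_split m j q : ~~ B m -> B j -> Qr m q ->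
  exists c q1, Qr' m j q1 /\ q = q1 * x m j c.
Proof.
move=> Bm Bj; have dmj := dis_B Bm Bj.
elim=> [|q1 _ _ [c [q2 [Qq2 ->]]] [i [k [t [/andP[/eqP-> Bk] dmk ->]]]]].
  by exists 0%R, 1; rewrite x0 // mulg1; split=> //; apply: spanned1.
case: (eqVneq k j) => [->|kj].
  by exists (c + t)%R, q2; rewrite -mulgA xD.
exists c, (q2 * x m k t); split.
  by apply: XG_M => //; apply: XG_x; rewrite ?eqxx ?Bk.
by rewrite -!mulgA x_headC // eq_sym.
Qed.

Lemma x_opp_Qr m j t : ~~ B m -> B j -> Qr (neg m) (x j m t).
Proof.
move=> Bm Bj; have dmj := dis_B Bm Bj.
rewrite x_neg 1?dis_sym //.
by apply: XG_x; rewrite ?eqxx ?B_neg ?dis_neg.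
Qed.

(** Opposite to the position (m, j), the root element x j m multiplies the
  rest of the radical by elements of the Levi part. *)
Lemma Qr'_low m j g t : ~~ B m -> B j -> Qr' m j g -> LQ m (g ^ x j m t).
Proof.
move=> Bm Bj; have dmj := dis_B Bm Bj; have djm : dis j m by rewrite dis_sym.
move: g; apply: XG_conj => [||m' k s /and3P[/eqP-> Bk kj] dmk].
- exact/LQ_L/spanned1.
- by move=> g1 g2; apply: LQ_M.
have Qx u : Qr m (x m k u) by apply: XG_x; rewrite ?eqxx.
case: (eqVneq k (neg j)) => [ek|kj'].
  suff -> : x m k s ^ x j m t = x m k s by apply: LQ_Q.
  apply/conjg_fixP/commgP; rewrite (x_neg _ djm) ek.
  by apply: x_tailC; rewrite ?dis_neg.
have djk : dis j k by rewrite /dis kj.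
rewrite conjg_commg -invgR x_comm // xV //.
by apply: LQ_M => //; [apply: LQ_Q | apply: LQ_L; apply: XG_x; rewrite ?Bj].
Qed.

(** The Weyl element of (m, j) carries the rest of the radical of m to root
  elements with head j; the one at neg j it centralises. *)
Lemma Qr'_w m j g c : ~~ B m -> B j -> c != 0%R -> Qr' m j g -> LQ m (g ^ w m j c).
Proof.
move=> Bm Bj c0; have dmj := dis_B Bm Bj; have djm : dis j m by rewrite dis_sym.
move: g; apply: XG_conj => [||m' k s /and3P[/eqP-> Bk kj] dmk].
- exact/LQ_L/spanned1.
- by move=> g1 g2; apply: LQ_M.
have Qx u : Qr m (x m k u) by apply: XG_x; rewrite ?eqxx.
case: (eqVneq k (neg j)) => [ek|kj'].
  suff -> : x m k s ^ w m j c = x m k s by apply: LQ_Q.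
  apply/conjg_fixP/commgP; apply: phi_commute => // [|u|u]; first exact: det_w.
    by apply: x_headC => //; rewrite eq_sym.
  by rewrite (x_neg _ djm) ek; apply: x_tailC; rewrite ?dis_neg.
have djk : dis j k by rewrite /dis kj.
have := phi_col s 0%R dmj dmk djk (det_w c0).
rewrite x0 // mulg1 => ->; rewrite mul0r mulr0 subr0 x0 // mul1g.
by apply: LQ_L; apply: XG_x; rewrite ?Bj.
Qed.

Lemma XG_h T g i j t : dis i j -> t != 0%R -> XG T g -> XG T (g ^ h i j t).
Proof.
move=> dij t0; apply: XG_conj => [||k l s Tkl dkl]; [exact: spanned1|exact: XG_M|].
by have [u ->] := x_h s t0 dij dkl; apply: XG_x.
Qed.

Section Cell.
Variables (m j0 j1 : 'I_N).
Hypotheses (Bm : ~~ B m) (Bj0 : B j0) (Bj1 : B j1) (dj01 : dis j0 j1).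

Let dmB k : B k -> dis m k. Proof. exact: dis_B. Qed.

(** The parabolic with one torus.  A single one suffices, since the tori of the
  pairs (m, j) for different j agree modulo Lv by the coroot identity. *)
Definition Pm p := exists y b q,
  [/\ Lv y, b != 0%R, Qr m q & p = y * h m j0 b * q].

Lemma Pm_Q p q : Pm p -> Qr m q -> Pm (p * q).
Proof.
move=> [y [b [q' [Ly b0 Qq' ->]]]] Qq; exists y, b, (q' * q).
by split=> //; [apply: XG_M | rewrite !mulgA].
Qed.

Lemma Pm_L p y : Pm p -> Lv y -> Pm (p * y).
Proof.
move=> [y' [b [q [Ly' b0 Qq ->]]]] Ly.
exists (y' * y ^ (h m j0 b)^-1), b, (q ^ y); split=> //.
- apply: XG_M => //; rewrite hV ?dmB //.
  by apply: XG_h; rewrite ?invr_neq0 ?dmB.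
- exact: Qr_norm.
- by rewrite !conjgE invgK !mulgA mulgVK mulgK.
Qed.

Lemma h_base j t : B j -> t != 0%R -> exists2 y, Lv y & h m j t = h m j0 t * y.
Proof.
move=> Bj t0.
have hL k l : B k -> B l -> dis k l -> Lv (h k l t).
  by move=> Bk Bl dkl; apply: XG_phi; rewrite ?Bk ?Bl ?det_h.
have step k l : B k -> B l -> dis k l -> h m l t = h m k t * h k l t.
  by move=> Bk Bl dkl; apply: h_mul; rewrite ?dmB // dis_sym.
case: (eqVneq j j0) => [->|jj0]; first by exists 1; rewrite ?mulg1 //; apply: spanned1.
case: (eqVneq j (neg j0)) => [->|jj0'].
  exists (h j0 j1 t * h j1 (neg j0) t).
    by apply: XG_M; apply: hL; rewrite ?B_neg ?dis_neg // dis_sym.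
  by rewrite mulgA -!step ?B_neg ?dis_neg // dis_sym.
have d : dis j0 j by rewrite /dis jj0.
by exists (h j0 j t); [apply: hL | apply: step].
Qed.

Lemma Pm_h p j t : Pm p -> B j -> t != 0%R -> Pm (p * h m j t).
Proof.
move=> [y [b [q [Ly b0 Qq ->]]]] Bj t0.
have [y' Ly' e] := h_base Bj t0.
have -> : y * h m j0 b * q * h m j t = y * h m j0 (b * t)%R * y' * q ^ h m j t.
  rewrite -(hM _ b0 t0) ?dmB // -!mulgA; congr (y * (_ * _)).
  by rewrite [_ * (y' * _)]mulgA -e conjgE mulVKg.
apply: Pm_Q; last by apply: XG_h; rewrite ?dmB.
apply: Pm_L => //; exists y, (b * t)%R, 1; rewrite mulg1; split=> //.
  by rewrite mulf_neq0.
exact: spanned1.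
Qed.

(** The big cell, which turns out to be the whole group. *)
Definition cell g := exists p z q,
  [/\ Pm p, Qr (neg m) z, Qr m q & g = p * z * q].

Let Bm' : ~~ B (neg m). Proof. by rewrite B_neg. Qed.

Lemma cell_Q g q : cell g -> Qr m q -> cell (g * q).
Proof.
move=> [p [z [q' [Pp Qz Qq' ->]]]] Qq; exists p, z, (q' * q).
by split=> //; [apply: XG_M | rewrite !mulgA].
Qed.

Lemma cell_L g y : cell g -> Lv y -> cell (g * y).
Proof.
move=> [p [z [q [Pp Qz Qq ->]]]] Ly.
exists (p * y), (z ^ y), (q ^ y); split=> //; [exact: Pm_L|exact: Qr_norm|exact: Qr_norm|].
by rewrite !conjgE !mulgA !mulgK.
Qed.

Lemma cell_h p z r j t : Pm p -> Qr (neg m) z -> LQ m r -> B j -> t != 0%R ->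
  cell (p * z * r * h m j t).
Proof.
move=> Pp Qz [y [q [Ly Qq ->]]] Bj t0; have dmj := dis_B Bm Bj.
exists (p * y * h m j t), ((z ^ y) ^ h m j t), (q ^ h m j t); split.
- by apply: Pm_h => //; apply: Pm_L.
- by apply: XG_h => //; apply: Qr_norm.
- exact: XG_h.
- by rewrite !conjgE !mulgA !mulgK.
Qed.

(** A Weyl element is absorbed by splitting off the coordinate d of z at neg j, that
  is, a lower root element of the pair (m, j): in SL2, low (-d) w(c) is upper times
  lower times upper. *)
Lemma cell_w p z j c : Pm p -> Qr (neg m) z -> B j -> c != 0%R ->
  cell (p * z * w m j c).
Proof.
move=> Pp Qz Bj c0; have dmj := dis_B Bm Bj; have djm : dis j m by rewrite dis_sym.
have Bj' : B (neg j) by rewrite B_neg.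
have [d [z1 [Qz1 ->]]] := Qr_split Bm' Bj' Qz.
have -> : x (neg m) (neg j) d = x j m (- d)%R by rewrite (x_neg _ djm) opprK.
set u := ((- d * c - 1) * c)%R.
have -> : p * (z1 * x j m (- d)%R) * w m j c =
    p * x m j c * (z1 ^ x m j c) * x j m (- c^-1)%R * x m j (- u)%R.
  rewrite conjgE !mulgA mulgK -!mulgA; congr (p * (z1 * _)).
  rewrite -!(x_low _ dmj) /w /x !(sfM phiP) //; try by field.
  by congr (phi _ _ _ _ _ _); rewrite /u; field.
apply: cell_Q; last by apply: XG_x; rewrite ?eqxx.
have : LQ (neg m) (z1 ^ x m j c).
  by rewrite (x_neg _ dmj); apply: Qr'_low.
case=> y [z2 [Ly Qz2 ->]].
exists (p * x m j c * y), (z2 * x j m (- c^-1)%R), 1; split.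
- by apply: Pm_L => //; apply: Pm_Q => //; apply: XG_x; rewrite ?eqxx.
- by apply: XG_M => //; apply: x_opp_Qr.
- exact: spanned1.
- by rewrite mulg1 !mulgA.
Qed.

(** Multiplication by the lower root element of the pair (m, j).  Only the coordinate
  c of q at j interacts with it, and up(c) low(t) is computed in SL2: it is
  lower times torus times upper when 1 + c t is not 0, and w(c) up(-c) otherwise. *)
Lemma cell_low g j t : cell g -> B j -> cell (g * x j m t).
Proof.
move=> [p [z [q [Pp Qz Qq ->]]]] Bj.
have dmj := dis_B Bm Bj; have djm : dis j m by rewrite dis_sym.
have [c [q1 [Qq1 ->]]] := Qr_split Bm Bj Qq.
have Qx u : Qr m (x m j u) by apply: XG_x; rewrite ?eqxx.
case: (eqVneq (1 + c * t)%R 0%R) => [e|ne].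
  have c0 : c != 0%R.
    by apply: contra_eq_neq e => ->; rewrite mul0r addr0 oner_neq0.
  have te : t = (- c^-1)%R.
    apply: (mulfI c0); rewrite mulrN divff //.
    by apply/eqP; rewrite -subr_eq0 opprK addrC e.
  have -> : p * z * (q1 * x m j c) * x j m t =
      p * z * w m j c * (q1 ^ w m j c) * x m j (- c)%R.
    rewrite conjgE !mulgA mulgK -!mulgA; congr (p * (z * (q1 * _))).
    rewrite -!(x_low _ dmj) /w /x !(sfM phiP) //; try by field.
    by rewrite te; congr (phi _ _ _ _ _ _); field.
  have [y [q2 [Ly Qq2 ->]]] := Qr'_w Bm Bj c0 Qq1.
  rewrite mulgA; apply: cell_Q => //; apply: cell_Q => //.
  by apply: cell_L => //; apply: cell_w.
set a := (1 + c * t)%R in ne *.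
have -> : p * z * (q1 * x m j c) * x j m t =
   p * (z * x j m (t / a)%R) * (q1 ^ x j m (t / a)%R) * h m j a * x m j (c / a)%R.
  rewrite conjgE !mulgA mulgK -!mulgA; congr (p * (z * (q1 * _))).
  rewrite -!(x_low _ dmj) /h /x !(sfM phiP) //; try by field.
  by congr (phi _ _ _ _ _ _); rewrite /a; field; exact: ne.
apply: cell_Q => //; apply: cell_h => //; last exact: Qr'_low.
by apply: XG_M => //; apply: x_opp_Qr.
Qed.

Lemma XG_cell g :
  XG (fun i j => [|| i == m, i == neg m | B i] && [|| j == m, j == neg m | B j]) g ->
  cell g.
Proof.
elim=> [|g1 _ _ IH [i [j [t [/andP[Ai Aj] dij ->]]]]].
  exists 1, 1, 1; rewrite !mulg1; split=> //; try exact: spanned1.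
  exists 1, 1%R, 1; rewrite h1 ?dmB // !mulg1 oner_neq0.
  by split=> //; apply: spanned1.
have dji : dis j i by rewrite dis_sym.
case/or3P: Ai dij dji => [/eqP->|/eqP->|Bi] dij dji; case/or3P: Aj dij dji => [/eqP->|/eqP->|Bj] dij dji;
  rewrite ?dis_neg ?dis_irr in dij dji *; try by [].
- by apply: cell_Q => //; apply: XG_x; rewrite ?eqxx.
- rewrite x_neg ?dis_neg // negK; apply: cell_low; rewrite ?B_neg //.
- exact: cell_low.
- by apply: cell_Q => //; rewrite x_neg ?dis_neg // negK; apply: XG_x;
    rewrite ?eqxx ?B_neg ?dis_neg.
- by apply: cell_L => //; apply: XG_x; rewrite // Bi.
Qed.

End Cell.
End Parabolic.

(** ** The representation *)

Local Notation e k := (delta_mx (0 : 'I_1)%R k : 'rV[F]_N).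

(** The matrix of a determinant 1 matrix acting on the plane of two basis vectors
  and contragrediently on the dual plane. *)
Definition levi_mx i j a b c d : 'M[F]_N :=
  (\matrix_k (if k == i then a *: e i + b *: e j
    else if k == j then c *: e i + d *: e j
    else if k == neg i then d *: e (neg i) - c *: e (neg j)
    else if k == neg j then - b *: e (neg i) + a *: e (neg j)
    else e k))%R.
Local Notation phimx := levi_mx.

Variable rho : G -> 'M[F]_N.
Hypothesis rho1 : rho 1 = 1%:M%R.
Hypothesis rhoM : forall g g', rho (g * g') = (rho g *m rho g')%R.
Hypothesis rho_phi : forall i j a b c d, dis i j -> (a * d - b * c)%R = 1%R ->
  rho (phi i j a b c d) = phimx i j a b c d.

Local Open Scope ring_scope.

Lemma mul_phimx i j a b c d (v : 'rV[F]_N) : dis i j ->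
  v *m phimx i j a b c d = v
    + (v 0 i * (a - 1) + v 0 j * c) *: e i + (v 0 i * b + v 0 j * (d - 1)) *: e j
    + (v 0 (neg i) * (d - 1) - v 0 (neg j) * b) *: e (neg i)
    + (v 0 (neg j) * (a - 1) - v 0 (neg i) * c) *: e (neg j).
Proof.
move=> /andP[ji jni].
have nji : neg j != i by rewrite neg_eq.
have ninj : neg i != neg j by rewrite (can_eq negK) eq_sym.
rewrite mulmx_sum_row.
have rowE k : row k (phimx i j a b c d) = e k
    + (k == i)%:R *: ((a - 1) *: e i + b *: e j)
    + (k == j)%:R *: (c *: e i + (d - 1) *: e j)
    + (k == neg i)%:R *: ((d - 1) *: e (neg i) - c *: e (neg j))
    + (k == neg j)%:R *: (- b *: e (neg i) + (a - 1) *: e (neg j)).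
  rewrite rowK.
  case: (eqVneq k i) => [->|ki].
    rewrite [i == j]eq_sym (negbTE ji) [i == neg i]eq_sym (negbTE (neg_neq i)).
    rewrite [i == neg j]eq_sym (negbTE nji).
    by rewrite scale1r !scale0r !addr0 scalerBl scale1r addrA addrCA subrr addr0 addrC addrC.
  case: (eqVneq k j) => [->|kj].
    rewrite (negbTE jni) [j == neg j]eq_sym (negbTE (neg_neq j)).
    by rewrite scale1r !scale0r !addr0 scalerBl scale1r addrCA [_ + (_ - _)]addrC subrK.
  case: (eqVneq k (neg i)) => [->|kni].
    by rewrite (negbTE ninj) scale1r !scale0r !addr0 scalerBl scale1r addrA [_ + (_ - _)]addrC subrK.
  case: (eqVneq k (neg j)) => [->|knj].
    by rewrite scale1r !scale0r !addr0 scalerBl scale1r addrCA [_ + (_ - _)]addrC subrK.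
  by rewrite !scale0r !addr0.
have pick l (u : 'rV[F]_N) : \sum_k v 0 k *: ((k == l)%:R *: u) = v 0 l *: u.
  rewrite (bigD1 l) //= eqxx scale1r big1 ?addr0 // => k /negbTE ->.
  by rewrite scale0r scaler0.
rewrite (eq_bigr _ (fun k _ => congr1 ( *:%R (v 0 k)) (rowE k))).
under eq_bigr do rewrite !scalerDr.
rewrite !big_split /= !pick -row_sum_delta; apply/rowP => k; rewrite !mxE; ring.
Qed.

Lemma mul_xmx i j t (v : 'rV[F]_N) : dis i j ->
  v *m phimx i j 1 t 0 1 = v + (v 0 i * t) *: e j - (v 0 (neg j) * t) *: e (neg i).
Proof.
by move=> dij; rewrite mul_phimx //; apply/rowP => k; rewrite !mxE; ring.
Qed.

Lemma mul_x i j t (v : 'rV[F]_N) : dis i j ->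
  v *m rho (x i j t) = v + (v 0 i * t) *: e j - (v 0 (neg j) * t) *: e (neg i).
Proof.
by move=> dij; rewrite rho_phi ?mul_xmx //; ring.
Qed.

Lemma ent_x i j t (v : 'rV[F]_N) k : dis i j ->
  (v *m rho (x i j t)) 0 k =
  v 0 k + (k == j)%:R * (v 0 i * t) - (k == neg i)%:R * (v 0 (neg j) * t).
Proof. by move=> dij; rewrite mul_x // !mxE /=; ring. Qed.

Lemma entM g g' m k : (rho (g * g')%g) m k = (row m (rho g) *m rho g') 0 k.
Proof. by rewrite rhoM -row_mul !mxE. Qed.

Section ParabolicRho.
Variables (B : pred 'I_N).
Hypothesis B_neg : forall i, B (neg i) = B i.

Lemma Lv_fix g k : Lv B g -> ~~ B k -> e k *m rho g = e k.
Proof.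
move=> Lg Bk; elim: Lg => [|g1 g2 _ IH [i [j [t [/andP[Bi Bj] dij ->]]]]].
  by rewrite rho1 mulmx1.
rewrite rhoM mulmxA IH mul_x // !mxE /=.
have -> : (i == k) = false by apply: contraNF Bk => /eqP <-.
have -> : (neg j == k) = false by apply: contraNF Bk => /eqP <-; rewrite B_neg.
by rewrite !mul0r !scale0r addr0 subr0.
Qed.

Lemma Qr_fix m g : Qr B m g -> ~~ B m -> e (neg m) *m rho g = e (neg m).
Proof.
move=> Qg Bm; elim: Qg => [|g1 g2 _ IH [i [j [t [/andP[/eqP-> Bj] dij ->]]]]].
  by rewrite rho1 mulmx1.
rewrite rhoM mulmxA IH mul_x // !mxE /=.
have -> : (m == neg m) = false by rewrite eq_sym (negbTE (neg_neq m)).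
have -> : (neg j == neg m) = false.
  by rewrite (can_eq negK); apply: contraNF Bm => /eqP <-.
by rewrite !mul0r !scale0r addr0 subr0.
Qed.

(** The element of the radical with given coordinates. *)
Definition Qprod m (c : 'I_N -> F) : G := (\prod_(k <- enum B) x m k (c k))%g.

Lemma QprodD m (c c' : 'I_N -> F) : ~~ B m -> (Qprod m c * Qprod m c')%g = Qprod m (fun k => c k + c' k).
Proof.
move=> Bm; rewrite /Qprod.
have sB : {subset enum B <= B} by move=> k; rewrite mem_enum.
have XQ k t : B k -> Qr B m (x m k t).
  by move=> Bk; apply: XG_x; rewrite ?eqxx // (dis_B B_neg).
elim: (enum B) sB => [|k s IH] sB; first by rewrite !big_nil mulg1.
have Bk : B k by apply: sB; rewrite mem_head.
have sB' : {subset s <= B} by move=> l ls; apply: sB; rewrite inE ls orbT.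
rewrite !big_cons -IH // -xD ?(dis_B B_neg) // -!mulgA; congr (_ * _)%g.
rewrite !mulgA; congr (_ * _)%g.
apply: (Qr_comm B_neg Bm) (XQ _ _ Bk).
elim: {IH} s sB' {sB} => [|l s IH] sB; first by rewrite big_nil; apply: spanned1.
rewrite big_cons; apply: XG_M; first by apply: XQ; apply: sB; rewrite mem_head.
by apply: IH => l' ls; apply: sB; rewrite inE ls orbT.
Qed.

Lemma Qprod1 m k t : B k -> dis m k -> ~~ B m ->
  x m k t = Qprod m (fun l => if l == k then t else 0).
Proof.
move=> Bk dmk Bm; rewrite /Qprod.
have : k \in enum B by rewrite mem_enum.
have : uniq (enum B) by rewrite enum_uniq.
have : {subset enum B <= B} by move=> l; rewrite mem_enum.
elim: (enum B) => // l s IH sB /= /andP[ls us].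
have sB' : {subset s <= B} by move=> l' ls'; apply: sB; rewrite inE ls' orbT.
rewrite inE big_cons => /predU1P[ekl|ks].
  subst l; rewrite eqxx big1_seq ?mulg1 // => l /= ks.
  rewrite ifF; last by apply: contraNF ls => /eqP <-.
  by rewrite x0 ?(dis_B B_neg) //; apply: sB'.
have Bl : B l by apply: sB; rewrite mem_head.
rewrite ifF; last by apply: contraNF ls => /eqP ->.
by rewrite x0 ?(dis_B B_neg) // mul1g; apply: IH.
Qed.

(** An element of the radical is determined by the coordinates in B of the image
  of the basis vector that it moves. *)
Lemma Qr_coord m g : ~~ B m -> Qr B m g ->
  rho g m m = 1 /\ exists c : 'I_N -> F, g = Qprod m c /\ forall k, B k -> rho g m k = c k.
Proof.
move=> Bm; elim=> [|g1 g2 _ [IH1 [c [eg IHc]]] [i [j [t [/andP[/eqP-> Bj] dij ->]]]]];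
  last subst g1.
  rewrite rho1 mxE eqxx; split=> //; exists (fun=> 0); split.
    rewrite /Qprod big1_seq // => k /=; rewrite mem_enum => Bk.
    by rewrite x0 // (dis_B B_neg).
  move=> k Bk; rewrite mxE (_ : (m == k) = false) //.
  by apply: contraNF Bm => /eqP->.
have ent k : k != neg m -> rho (Qprod m c * x m j t)%g m k =
    rho (Qprod m c) m k + (k == j)%:R * t.
  move=> km; rewrite entM ent_x // !mxE IH1 mul1r (negbTE km) mul0r subr0 //.
split.
  rewrite ent; last by rewrite eq_sym neg_neq.
  rewrite IH1.
  rewrite (_ : (m == j) = false) ?mul0r ?addr0 //.
  by apply: contraNF Bm => /eqP->.
exists (fun k => c k + if k == j then t else 0); split.
  by rewrite -QprodD // -Qprod1.
move=> k Bk; rewrite ent ?IHc //; first by case: eqP => _; rewrite ?mul1r ?mul0r.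
by apply: contraNneq Bm => ekm; rewrite -B_neg -ekm.
Qed.

Lemma Qr_eq1 m g : ~~ B m -> Qr B m g -> (forall k, B k -> rho g m k = 0) -> g = 1%g.
Proof.
move=> Bm Qg g0; have [_ [c [eg cE]]] := Qr_coord Bm Qg.
rewrite eg /Qprod big1_seq // => k /=; rewrite mem_enum => Bk.
by rewrite -cE // g0 // x0 // (dis_B B_neg).
Qed.

(** The stabiliser of a basis vector is the obvious one: on the cell, the vector
  determines the torus and the opposite-radical coordinates. *)
Lemma stab_LQ m j0 j1 g : ~~ B m -> B j0 -> B j1 -> dis j0 j1 ->
  cell B m j0 g -> e (neg m) *m rho g = e (neg m) -> LQ B m g.
Proof.
move=> Bm Bj0 Bj1 d01 [_ [z [q [[y [b [q0 [Ly b0 Qq0 ->]]]] Qz Qq ->]]]] fix_m.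
have Bm' : ~~ B (neg m) by rewrite B_neg.
have dmj0 : dis m j0 by apply: (dis_B B_neg).
have hfix : e (neg m) *m rho (h m j0 b) = b^-1 *: e (neg m).
  rewrite rho_phi ?det_h // mul_phimx // !mxE /=.
  have mnm : (m == neg m) = false by rewrite eq_sym (negbTE (neg_neq m)).
  have [jnm njnm] : (j0 == neg m) = false /\ (neg j0 == neg m) = false.
    case/andP: dmj0; rewrite (can_eq negK) => /negbTE -> /negbTE -> //.
  rewrite mnm jnm njnm eqxx !mul0r !mulr0 !mul1r !addr0 !subr0 !scale0r !addr0.
  by rewrite scalerBl scale1r addrCA subrr addr0.
have zE : b^-1 *: (e (neg m) *m rho z) = e (neg m).
  have : e (neg m) *m rho (q^-1)%g = e (neg m) by apply: Qr_fix => //; apply: XG_V.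
  rewrite -{1}fix_m !rhoM !mulmxA Lv_fix // hfix -!scalemxAl Qr_fix //.
  by rewrite -mulmxA -rhoM mulgV rho1 mulmx1.
have [zm _] := Qr_coord Bm' Qz.
have b1 : b = 1.
  move/rowP/(_ (neg m)): zE; rewrite mxE -rowE mxE zm !mxE !eqxx mulr1 => /eqP.
  by rewrite invr_eq1 => /eqP.
have z1 : z = 1%g.
  apply: (Qr_eq1 Bm' Qz) => k Bk; move/rowP/(_ k): zE.
  rewrite b1 invr1 scale1r -rowE !mxE => ->.
  by rewrite (_ : (k == neg m) = false) ?andbF //; apply: contraNF Bm' => /eqP<-.
rewrite b1 z1 h1 // !mulg1; apply: LQ_M => //; first apply: LQ_M => //.
- exact: LQ_L.
- exact: LQ_Q.
- exact: LQ_Q.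
Qed.

End ParabolicRho.

(** With two planes only, the root elements are those of the two copies of SL2 on
  (i, j) and (i, neg j), which commute. *)
Lemma plane_phi i j g : dis i j ->
  XG (fun k l => [|| k == i, k == neg i, k == j | k == neg j] &&
                 [|| l == i, l == neg i, l == j | l == neg j]) g ->
  exists a b c d a' b' c' d', [/\ a * d - b * c = 1, a' * d' - b' * c' = 1 &
    g = (phi i j a b c d * phi i (neg j) a' b' c' d')%g].
Proof.
move=> dij; have dji : dis j i by rewrite dis_sym.
have dinj : dis i (neg j) by rewrite dis_neg.
have det1 : 1 * 1 - 0 * 0 = 1 :> F by ring.
elim=> [|g1 _ _ [a [b [c [d [a' [b' [c' [d' [det det' ->]]]]]]]]] [k [l [t [/andP[Ak Al] dkl ->]]]]].
  exists 1, 0, 0, 1, 1, 0, 0, 1; split=> //.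
  by rewrite !phi1 // mulg1.
pose P y := exists a1 b1 c1 d1 a1' b1' c1' d1',
  [/\ a1 * d1 - b1 * c1 = 1, a1' * d1' - b1' * c1' = 1 &
  (phi i j a b c d * phi i (neg j) a' b' c' d' * y =
   phi i j a1 b1 c1 d1 * phi i (neg j) a1' b1' c1' d1')%g].
rewrite -/(P (x k l t)).
have Cx a1 b1 c1 d1 : a1 * d1 - b1 * c1 = 1 ->
    commute (phi i j a1 b1 c1 d1) (phi i (neg j) a' b' c' d').
  move=> det2; apply: phi_commute => // u; apply/commute_sym; apply: phi_commute => // v.
  - by apply: x_headC; rewrite // eq_sym neg_neq.
  - by rewrite (x_neg _ dji); apply: x_tailC; rewrite ?dis_neg.
  - rewrite x_neg ?dis_neg // negK; apply: x_tailC; rewrite ?dis_neg //.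
    by rewrite eq_sym neg_neq.
  - by apply: x_tailC; rewrite ?dis_neg // eq_sym neg_neq.
have P1 a1 b1 c1 d1 : a1 * d1 - b1 * c1 = 1 -> P (phi i j a1 b1 c1 d1).
  move=> det2; do 8!eexists; split; last first.
  - by rewrite -mulgA -Cx // mulgA (sfM phiP).
  - exact: det'.
  - by rewrite -[RHS]mulr1 -{1}det -det2; ring.
have P2 a1 b1 c1 d1 : a1 * d1 - b1 * c1 = 1 -> P (phi i (neg j) a1 b1 c1 d1).
  move=> det2; do 8!eexists; split; last first.
  - by rewrite -mulgA (sfM phiP).
  - by rewrite -[RHS]mulr1 -{1}det' -det2; ring.
  - exact: det.
have Px u : P (x i j u) by apply: P1; ring.
have Px' u : P (x j i u) by rewrite -x_low //; apply: P1; ring.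
have Pn u : P (x i (neg j) u) by apply: P2; ring.
have Pn' u : P (x (neg j) i u) by rewrite -x_low //; apply: P2; ring.
by case/or4P: Ak dkl Al => /eqP-> dkl /or4P[] /eqP el; move: dkl; rewrite el ?dis_neg ?dis_irr // => _;
   rewrite ?dis_neg // x_neg ?dis_neg ?negK.
Qed.

Lemma phimx_rows i j a b c d : dis i j ->
  [/\ e i *m phimx i j a b c d = a *: e i + b *: e j,
      e j *m phimx i j a b c d = c *: e i + d *: e j,
      e (neg i) *m phimx i j a b c d = d *: e (neg i) - c *: e (neg j) &
      e (neg j) *m phimx i j a b c d = - b *: e (neg i) + a *: e (neg j)].
Proof.
case/andP=> /negbTE ji /negbTE jni; rewrite -!rowE !rowK !eqxx.
have nji : (neg j == i) = false by rewrite neg_eq.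
by rewrite ?(can_eq negK) !(negbTE (neg_neq _)) ?[neg i == j]eq_sym ?ji ?jni ?nji.
Qed.

(** If the product acts as the identity then both factors are diagonal and
  scalar, with the same scalar a and a^2 = 1; for a = -1 they are the central
  elements, which agree and have square 1. *)
Lemma plane_faithful i j a b c d a' b' c' d' : dis i j ->
  a * d - b * c = 1 -> a' * d' - b' * c' = 1 ->
  rho (phi i j a b c d * phi i (neg j) a' b' c' d')%g = 1%:M ->
  (phi i j a b c d * phi i (neg j) a' b' c' d')%g = 1%g.
Proof.
move=> dij det det'; have dinj : dis i (neg j) by rewrite dis_neg.
rewrite rhoM !rho_phi // => E.
have ni k : (neg k == k) = false by apply/negbTE/neg_neq.
have [ji nji] : (j == i) = false /\ (neg j == i) = false.
  by rewrite neg_eq; case/andP: dij => /negbTE -> /negbTE ->.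
have ij : (i == j) = false by rewrite eq_sym.
have ijn : (i == neg j) = false by rewrite eq_sym.
have nn : (neg i == neg j) = false by rewrite (can_eq negK).
have ent k : e k *m phimx i j a b c d *m phimx i (neg j) a' b' c' d' = e k.
  by rewrite -mulmxA E mulmx1.
have [r1 r2 r3 r4] := phimx_rows a b c d dij.
have [s1 s2 s3 s4] := phimx_rows a' b' c' d' dinj.
rewrite !negK in s3 s4.
have inni : (i == neg i) = false by rewrite eq_sym ni.
have jnj : (j == neg j) = false by rewrite eq_sym ni.
have jni : (j == neg i) = false by rewrite -neg_eq.
have njni : (neg j == neg i) = false by rewrite eq_sym.
have eqs := (ij, ji, nji, ijn, nn, ni, inni, jnj, jni, njni, eqxx).
have e1 := ent i; rewrite r1 mulmxDl -!scalemxAl s1 s4 in e1.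
have e2 := ent j; rewrite r2 mulmxDl -!scalemxAl s1 s4 in e2.
have e3 := ent (neg j); rewrite r4 mulmxDl -!scalemxAl s2 s3 in e3.
have aa' : a * a' = 1.
  by move/rowP/(_ i): e1; rewrite !mxE /= !eqs /= => H; apply: etrans H; ring.
have a0 : a != 0 by apply: contra_eq_neq aa' => ->; rewrite mul0r eq_sym oner_neq0.
have a'0 : a' != 0 by apply: contra_eq_neq aa' => ->; rewrite mulr0 eq_sym oner_neq0.
have b'0 : b' = 0.
  by apply: (mulfI a0); rewrite mulr0; move/rowP/(_ (neg j)): e1; rewrite !mxE /= !eqs /= => H; apply: etrans H; ring.
have b0 : b = 0.
  by apply: (mulIf a'0); rewrite mul0r; move/rowP/(_ j): e1; rewrite !mxE /= !eqs /= => H; apply: etrans H; ring.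
have c0 : c = 0.
  by apply: (mulIf a'0); rewrite mul0r; move/rowP/(_ i): e2; rewrite !mxE /= !eqs /= => H; apply: etrans H; ring.
have da' : d * a' = 1.
  by move/rowP/(_ j): e2; rewrite !mxE /= !eqs /= => H; apply: etrans H; ring.
have c'0 : c' = 0.
  by apply: (mulfI a0); rewrite mulr0; move/rowP/(_ i): e3; rewrite !mxE /= !eqs /= => H; apply: etrans H; ring.
have da : d = a by apply: (mulIf a'0); rewrite da'.
have a'a : a' = a.
  by apply: (mulfI a0); rewrite aa' -det da b0 mul0r subr0.
have d'a : d' = a.
  by apply: (mulfI a0); rewrite -[in LHS]a'a -[LHS]subr0 -(mul0r c') -b'0 det' -aa' a'a.
have : a ^+ 2 == 1 by rewrite expr2 -{2}a'a aa'.
rewrite b0 c0 b'0 c'0 da a'a d'a sqrf_eq1 => /orP[]/eqP->.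
  by rewrite !phi1 // mulg1.
rewrite -(sf_center phiP) // (sfM phiP) // ?mulr0 ?mul0r ?addr0 ?add0r ?subr0 ?mulrNN ?mulr1 //.
exact: phi1.
Qed.

(** Induction on the number of hyperbolic planes: the stabiliser of a basis vector
  splits off one plane, and two planes are left to the central element condition
  on the pair of commuting special linear groups. *)
Lemma span_faithful (s : seq 'I_N) g : pairwise dis s -> (1 < size s)%N ->
  XG (fun k l => ((k \in s) || (neg k \in s)) && ((l \in s) || (neg l \in s))) g ->
  rho g = 1%:M -> g = 1%g.
Proof.
elim: s g => [|m [|j0 [|j1 s]] IH] // g ps _ Xg rg.
  have dmj : dis m j0 by case/andP: ps => /andP[].
  have XG_ext T T' y : T =2 T' -> XG T y -> XG T' y.
    move=> eT; elim=> [|y1 y2 _ IHy [k [l [t [Tkl dkl ->]]]]]; first exact: spanned1.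
    by apply: XG_M => //; apply: XG_x; rewrite // -eT.
  have := plane_phi dmj (XG_ext _ _ _ _ Xg).
  case=> [k l|a [b [c [d [a' [b' [c' [d' [det det' eg]]]]]]]]].
    by rewrite !inE !neg_eq -!orbA; congr (_ && _); do !bool_congr.
  by rewrite eg; apply: plane_faithful; rewrite -?eg.
set B := fun k => (k \in [:: j0, j1 & s]) || (neg k \in [:: j0, j1 & s]).
have B_neg k : B (neg k) = B k by rewrite /B negK orbC.
have Bj0 : B j0 by rewrite /B inE eqxx.
have Bj1 : B j1 by rewrite /B !inE eqxx orbT.
have d01 : dis j0 j1 by case/andP: ps => _ /= /and3P[/andP[]].
have Bm : ~~ B m.
  case/andP: ps => /allP dm _; apply/negP => /orP[/dm|/dm]; rewrite ?dis_neg dis_irr //.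
have {}Xg : XG (fun i j => [|| i == m, i == neg m | B i] && [|| j == m, j == neg m | B j]) g.
  elim: Xg {rg} => [|y1 y2 _ IHy [k [l [t [/andP[Ak Al] dkl ->]]]]]; first exact: spanned1.
  apply: XG_M => //; apply: XG_x => //.
  have H i : (i \in [:: m, j0, j1 & s]) || (neg i \in [:: m, j0, j1 & s]) ->
      [|| i == m, i == neg m | B i].
    by rewrite /B (in_cons m) (in_cons m _ (neg i)) neg_eq; do !case: (_ == _); rewrite ?orbT.
  by rewrite !H.
have cg := XG_cell B_neg Bm Bj0 Bj1 d01 Xg.
have [|y [q [Ly Qq eg]]] := stab_LQ B_neg Bm Bj0 Bj1 d01 cg.
  by rewrite rg mulmx1.
have eq : e m *m rho q = e m.
  by rewrite -{1}(Lv_fix B_neg Ly Bm) -mulmxA -rhoM -eg rg mulmx1.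
have q1 : q = 1%g.
  apply: (Qr_eq1 B_neg Bm Qq) => k Bk; move/rowP/(_ k): eq; rewrite -rowE !mxE => ->.
  by rewrite (_ : (k == m) = false) ?andbF //; apply: contraNF Bm => /eqP<-.
rewrite eg q1 mulg1 in rg *.
by apply: IH => //; case/andP: ps.
Qed.

End SteinbergFamily.


(** * Hyperbolic bases *)

Section SignedIndex.
Local Open Scope ring_scope.
Variables (n N : nat) (pr : 'I_N -> 'I_n) (od : 'I_N -> bool) (ef : 'I_n -> bool -> 'I_N).
Hypothesis pr_ef : forall a b, pr (ef a b) = a.
Hypothesis od_ef : forall a b, od (ef a b) = b.
Hypothesis efK : forall i, ef (pr i) (od i) = i.
Implicit Types (i j : 'I_N).

(** Basis vectors are described by a plane (pr) and a position in it (od); ef is the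
  inverse description. *)
Definition neg i : 'I_N := ef (pr i) (~~ od i).

Lemma idx_eq i j : (i == j) = (pr i == pr j) && (od i == od j).
Proof.
apply/eqP/andP => [->|[/eqP e1 /eqP e2]]; first by rewrite !eqxx.
by rewrite -[i]efK -[j]efK e1 e2.
Qed.

Lemma pr_neg i : pr (neg i) = pr i. Proof. exact: pr_ef. Qed.
Lemma od_neg i : od (neg i) = ~~ od i. Proof. exact: od_ef. Qed.

Lemma negK : involutive neg.
Proof. by move=> i; rewrite {1}/neg pr_neg od_neg negbK efK. Qed.

Lemma neg_neq i : neg i != i.
Proof. by rewrite idx_eq pr_neg eqxx od_neg; case: (od i). Qed.

Lemma neg_ef a b : neg (ef a b) = ef a (~~ b).
Proof. by rewrite /neg pr_ef od_ef. Qed.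

Lemma dis_pr i j : apart neg i j = (pr i != pr j).
Proof.
rewrite /apart !idx_eq pr_neg od_neg [pr j == _]eq_sym.
by case: eqP => // _; case: (od i) (od j) => [] [].
Qed.

End SignedIndex.

Section GramIndex.
Local Open Scope ring_scope.
Variable r : nat.
Local Notation n := r.+3.
Local Notation J := 'I_n.
Local Notation I := 'I_(n.*2.-1.+1).
Implicit Types (i j l m : I).

Definition gpr i : J := inord i./2.
Definition god i : bool := odd i.
Definition gef (a : J) (b : bool) : I := inord (a.*2 + b).

Lemma val_gpr i : gpr i = i./2 :> nat.
Proof. by rewrite inordK // ltn_half_double; exact: ltn_ord. Qed.

Lemma val_gef a b : gef a b = (a.*2 + b)%N :> nat.
Proof.
rewrite inordK //; have := ltn_ord a.
rewrite -[X in _ -> (_ < X)%N]/(n.*2) => h.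
have: (a.*2.+2 <= n.*2)%N by rewrite -doubleS leq_double.
by apply: leq_trans; case: b; rewrite ?addn1 ?addn0.
Qed.

Lemma gpr_gef a b : gpr (gef a b) = a.
Proof. by apply: ord_inj; rewrite val_gpr val_gef addnC half_bit_double. Qed.

Lemma god_gef a b : god (gef a b) = b.
Proof. by rewrite /god val_gef oddD odd_double; case: b. Qed.

Lemma gefK i : gef (gpr i) (god i) = i.
Proof. by apply: ord_inj; rewrite val_gef val_gpr addnC /god odd_double_half. Qed.

Definition gneg := neg gpr god gef.

Lemma gramE (F : finFieldType) i j : hyperbolic_gram F n i j = (j == gneg i)%:R.
Proof.
rewrite mxE [j == _](idx_eq gefK) /gneg (pr_neg _ gpr_gef) (od_neg _ god_gef).
congr (_%:R); have -> : (i./2 == j./2)%N = (gpr j == gpr i).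
  by rewrite -val_gpr -val_gpr eq_sym.
have -> : (i != j) = ~~ ((gpr j == gpr i) && (god j == god i)).
  by rewrite -(idx_eq gefK) eq_sym.
by case: eqP => //= _; case: (god i) (god j) => [] [].
Qed.

End GramIndex.

(** * The derived subgroup of the orthogonal group *)

Lemma commg_eq (G : groupType) (x y z : G) :
  (x * y = y * x * z)%g -> [~ x, y]%g = z.
Proof. by move=> E; rewrite commgEl conjgE E -!mulgA !mulKg. Qed.

Lemma conjg_eq (G : groupType) (x y z : G) : (x * y = y * z -> x ^ y = z)%g.
Proof. by move=> E; rewrite conjgE E mulKg. Qed.

Section MatrixGroup.
Local Open Scope ring_scope.
Variables (F : fieldType) (N : nat) (neg : 'I_N -> 'I_N).
Hypothesis nK : involutive neg.
Hypothesis nn : forall i, neg i != i.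
Hypothesis two_neq0 : 2%:R != 0 :> F.
Local Notation I := 'I_N.
Local Notation V := 'rV[F]_N.
Local Notation e i := (delta_mx (0 : 'I_1) i : V).
Local Notation dis := (apart neg).
Local Notation phimx := (@levi_mx F N neg).

Variables (gT : finGroupType) (gv : gT -> 'M[F]_N) (gphi : I -> I -> F -> F -> F -> F -> gT).
Hypothesis gv_inj : injective gv.
Hypothesis gv1 : gv 1%g = 1%:M.
Hypothesis gvM : forall g h, gv (g * h)%g = gv g *m gv h.
Hypothesis gphiE : forall i j (a b c d : F), dis i j -> a * d - b * c = 1 ->
  gv (gphi i j a b c d) = phimx i j a b c d.
Implicit Types (i j l m : I) (v u : V) (g h : gT) (s t : F).

Definition act v g : V := v *m gv g.
Local Notation "v @ g" := (act v g) (at level 40, left associativity, g at next level).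

Lemma actM v g h : v @ (g * h)%g = v @ g @ h.
Proof. by rewrite /act gvM mulmxA. Qed.

Lemma act1 v : v @ 1%g = v.
Proof. by rewrite /act gv1 mulmx1. Qed.

Lemma actK v g : v @ g @ g^-1%g = v.
Proof. by rewrite -actM mulgV act1. Qed.

Lemma actD v u g : (v + u) @ g = v @ g + u @ g.
Proof. exact: mulmxDl. Qed.

Lemma actZ t v g : (t *: v) @ g = t *: (v @ g).
Proof. by rewrite /act scalemxAl. Qed.

Lemma actN v g : (- v) @ g = - (v @ g).
Proof. exact: mulNmx. Qed.

Lemma act_ext g h : (forall i, e i @ g = e i @ h) -> g = h.
Proof.
move=> E; apply/gv_inj/row_matrixP => i; rewrite !rowE; exact: E.
Qed.

Lemma act_ext_v g h : (forall v, v @ g = v @ h) -> g = h.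
Proof. by move=> E; apply: act_ext => i; apply: E. Qed.

Lemma phimxM i j a b c d a' b' c' d' : dis i j ->
  phimx i j a b c d *m phimx i j a' b' c' d' =
  phimx i j (a * a' + b * c') (a * b' + b * d') (c * a' + d * c') (c * b' + d * d').
Proof.
move=> dij; apply/row_matrixP => l; rewrite row_mul.
have [r1 r2 r3 r4] := phimx_rows nK nn a' b' c' d' dij.
rewrite !rowK; case: ifP => h1; [|case: ifP => h2; [|case: ifP => h3; [|case: ifP => h4]]];
  rewrite ?mulmxDl ?mulNmx -?scalemxAl ?r1 ?r2 ?r3 ?r4;
  try by apply/rowP => q; rewrite !mxE; ring.
by rewrite -rowE rowK h1 h2 h3 h4.
Qed.


Lemma phimx11 i j : dis i j -> phimx i j 1 0 0 1 = 1%:M.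
Proof.
move=> dij; apply/row_matrixP => l; rewrite !rowE mul_phimx // mulmx1.
by apply/rowP => q; rewrite !mxE; ring.
Qed.

Lemma gphiM i j a b c d a' b' c' d' : dis i j ->
  a * d - b * c = 1 -> a' * d' - b' * c' = 1 ->
  (gphi i j a b c d * gphi i j a' b' c' d')%g =
  gphi i j (a * a' + b * c') (a * b' + b * d') (c * a' + d * c') (c * b' + d * d').
Proof.
move=> dij det det'; apply: gv_inj; rewrite gvM !gphiE //; first exact: phimxM.
by rewrite -[RHS]mulr1 -{1}det -det'; ring.
Qed.

Definition gx i j t : gT := gphi i j 1 t 0 1.

Lemma gxE i j t v : dis i j ->
  v @ gx i j t = v + (v 0 i * t) *: e j - (v 0 (neg j) * t) *: e (neg i).
Proof.
by move=> dij; rewrite /act gphiE ?mul_xmx //; ring.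
Qed.

Lemma gx_ent i j t v l : dis i j -> (v @ gx i j t) 0 l =
  v 0 l + (l == j)%:R * (v 0 i * t) - (l == neg i)%:R * (v 0 (neg j) * t).
Proof. by move=> dij; rewrite gxE // !mxE /=; ring. Qed.

Lemma gx_fix i j l t : dis i j -> (l == i) = false -> (l == neg j) = false ->
  e l @ gx i j t = e l.
Proof.
move=> dij li lj; rewrite gxE // !mxE /= [i == l]eq_sym [neg j == l]eq_sym li lj.
by rewrite !mul0r !scale0r addr0 subr0.
Qed.

Lemma gx_fixd i j l t : dis i j -> dis l i -> dis l j -> e l @ gx i j t = e l.
Proof.
move=> dij; rewrite [dis l i](dis_sym nK) [dis l j](dis_sym nK).
by move=> /andP[/negbTE li _] /andP[_ /negbTE lj]; apply: gx_fix.
Qed.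

Lemma gx_head i j t : dis i j -> e i @ gx i j t = e i + t *: e j.
Proof.
move=> dij; rewrite gxE // !mxE /= eqxx.
have -> : (neg j == i) = false.
  by rewrite (neg_eq nK); case/andP: dij => _ /negbTE.
by rewrite mul0r scale0r subr0 mul1r.
Qed.

Lemma gx_tail i j t : dis i j -> e (neg j) @ gx i j t = e (neg j) - t *: e (neg i).
Proof.
move=> dij; rewrite gxE // !mxE /= eqxx.
have -> : (i == neg j) = false.
  by rewrite eq_sym (neg_eq nK); case/andP: dij => _ /negbTE.
by rewrite mul0r scale0r addr0 mul1r.
Qed.

Lemma gxD i j s t : dis i j -> (gx i j s * gx i j t)%g = gx i j (s + t).
Proof.
move=> dij; rewrite /gx gphiM //; try by ring.
by congr (gphi _ _ _ _ _ _); ring.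
Qed.

Lemma gx0 i j : dis i j -> gx i j 0 = 1%g.
Proof. by move=> dij; apply: (mulgI (gx i j 0)); rewrite gxD // addr0 mulg1. Qed.

Lemma gx_neg i j t : dis i j -> gx i j t = gx (neg j) (neg i) (- t).
Proof.
move=> dij; apply: act_ext => l; rewrite !gxE ?dis_neg // 1?dis_sym //.
by rewrite !nK; apply/rowP => q; rewrite !mxE; ring.
Qed.

Lemma gx_comm i j l s t : dis i j -> dis i l -> dis j l ->
  [~ gx i j s, gx j l t] = gx i l (s * t).
Proof.
move=> dij dil djl.
have dji : dis j i by rewrite (dis_sym nK).
have dli : dis l i by rewrite (dis_sym nK).
have dlj : dis l j by rewrite (dis_sym nK).
suff E : (gx i j s * gx j l t = gx j l t * gx i j s * gx i l (s * t)%R)%g.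
  exact: commg_eq.
apply: act_ext_v => v; rewrite !actM [v @ gx i j s]gxE // [v @ gx j l t]gxE //.
have nli l1 l2 : dis l1 l2 -> (l1 == neg l2) = false /\ (l1 == l2) = false.
  by rewrite (dis_sym nK) => /andP[/negbTE -> /negbTE ->].
have nil w : e (neg i) @ gx i l w = e (neg i).
  by rewrite gx_fix ?(negbTE (nn _)) // (can_eq nK); have [] := nli i l.
have nll w : e l @ gx i l w = e l.
  by rewrite gx_fix //; [have [] := nli l i | rewrite eq_sym (negbTE (nn _))].
have [dnjl dnji] : dis (neg j) l /\ dis (neg j) i by rewrite !dis_neg.
have [dnil dnij] : dis (neg i) l /\ dis (neg i) j by rewrite !dis_neg.
rewrite !(actD, actN, actZ) (gx_head _ djl) (@gx_fixd j l (neg i)) //.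
rewrite (@gx_fixd i j l) // (gx_tail _ dij) !(actD, actN, actZ) nil nll (@gx_fixd i l (neg j)) //.
rewrite (gxE s v dij) !(actD, actN, actZ) nil (@gx_fixd i l j) // (gxE _ _ djl) (gxE _ _ dil).
by apply/rowP => q; rewrite !mxE; ring.
Qed.

Lemma gx_disjC i j k l s t : dis i j -> dis i k -> dis i l -> dis j k ->
  dis j l -> dis k l -> commute (gx i j s) (gx k l t).
Proof.
move=> dij dik dil djk djl dkl; apply: act_ext_v => v.
rewrite !actM (gxE s v dij) (gxE t v dkl) !(actD, actN, actZ).
rewrite !gx_fixd ?dis_neg //; try by rewrite ?dis_neg // (dis_sym nK).
by rewrite !gxE //; apply/rowP => q; rewrite !mxE; ring.
Qed.

Lemma gx_headC i j k s t : dis i j -> dis i k -> dis j k ->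
  commute (gx i j s) (gx i k t).
Proof.
move=> dij dik djk; apply: act_ext_v => v.
have [dji dki] : dis j i /\ dis k i by rewrite (dis_sym nK) dij (dis_sym nK).
have nin x : dis i x -> (neg i == neg x) = false /\ (neg i == i) = false.
  by case/andP=> /negbTE xi _; rewrite (can_eq nK) eq_sym xi (negbTE (nn _)).
have fn l w : dis i l -> e (neg i) @ gx i l w = e (neg i).
  by move=> d; rewrite gx_fix //; have [] := nin _ d.
rewrite !actM (gxE s v dij) (gxE t v dik) !(actD, actN, actZ) !fn //.
rewrite (@gx_fixd i k j) // (@gx_fixd i j k) //; last by rewrite (dis_sym nK).
by rewrite !gxE //; apply/rowP => q; rewrite !mxE; ring.
Qed.

Lemma gx_oppC i j s t : dis i j -> commute (gx i j s) (gx i (neg j) t).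
Proof.
move=> dij; apply: act_ext_v => v.
have din : dis i (neg j) by rewrite dis_neg.
have ni x w : dis i x -> e (neg i) @ gx i x w = e (neg i).
  move=> d; case/andP: (d) => /negbTE xi _; rewrite gx_fix ?(negbTE (nn _)) //.
  by rewrite (can_eq nK) eq_sym.
have T := gx_tail t din; rewrite nK in T.
rewrite !actM (gxE s v dij) (gxE t v din) !(actD, actN, actZ) !ni // T (gx_tail s dij).
by rewrite !gxE // nK; apply/rowP => q; rewrite !mxE; ring.
Qed.

(** The bilinear form for which i and neg i are paired. *)
Definition bf u v : F := \sum_l u 0 (neg l) * v 0 l.

Lemma bfDl u u' v : bf (u + u') v = bf u v + bf u' v.
Proof. by rewrite -big_split; apply: eq_bigr => l _; rewrite mxE mulrDl. Qed.

Lemma bfZl t u v : bf (t *: u) v = t * bf u v.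
Proof. by rewrite mulr_sumr; apply: eq_bigr => l _; rewrite mxE mulrA. Qed.

Lemma bfC u v : bf u v = bf v u.
Proof.
rewrite /bf (reindex_inj (inv_inj nK)) /=.
by apply: eq_bigr => l _; rewrite nK mulrC.
Qed.

Lemma bf_e i v : bf (e i) v = v 0 (neg i).
Proof.
rewrite /bf (bigD1 (neg i)) //= nK mxE !eqxx mul1r big1 ?addr0 // => l li.
by rewrite mxE eqxx /= (neg_eq nK) (negbTE li) mul0r.
Qed.

Lemma bfNl u v : bf (- u) v = - bf u v.
Proof. by rewrite -scaleN1r bfZl mulN1r. Qed.

Definition bf_isom g := forall u v, bf (u @ g) (v @ g) = bf u v.

Lemma gx_isom i j t : dis i j -> bf_isom (gx i j t).
Proof.
move=> dij u v; rewrite !gxE //.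
have [/negbTE ji /negbTE jni] := andP dij.
rewrite !(bfDl, bfZl, bfNl, bf_e) (bfC u) !(bfDl, bfZl, bfNl, bf_e) !mxE.
rewrite !nK !(bfC v) (can_eq nK) ji [i == j]eq_sym ji (negbTE (nn j)).
by rewrite [i == neg i]eq_sym (negbTE (nn i)) !andbF /=; ring.
Qed.

Section Derived.
Variable O : {group gT}.
Hypothesis inO : forall g, g \in O <-> bf_isom g.

Definition EA (A : pred I) : {group gT} :=
  <<[set g | `[< exists i j t, [/\ A i, A j, dis i j & g = gx i j t] >]]>>%G.

Lemma gx_EA (A : pred I) i j t : A i -> A j -> dis i j -> gx i j t \in EA A.
Proof. by move=> Ai Aj dij; apply/mem_gen; rewrite inE; apply/asboolP; exists i, j, t. Qed.

Lemma EA_sub (A : pred I) (H : {group gT}) :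
  (forall i j t, A i -> A j -> dis i j -> gx i j t \in H) -> EA A \subset H.
Proof.
move=> sH; rewrite gen_subG; apply/fintype.subsetP => g; rewrite inE => /asboolP.
by move=> [i [j [t [Ai Aj dij ->]]]]; apply: sH.
Qed.

Lemma EA_O A : EA A \subset O.
Proof. by apply: EA_sub => i j t _ _ dij; apply/inO/gx_isom. Qed.

Lemma EA_mono (A A' : pred I) : subpred A A' -> EA A \subset EA A'.
Proof. by move=> sA; apply: EA_sub => i j t Ai Aj dij; apply: gx_EA => //; apply: sA. Qed.

Lemma EA_fix (A : pred I) l y : (forall i, A (neg i) = A i) -> ~~ A l ->
  y \in EA A -> e l @ y = e l.
Proof.
move=> An Al /gen_prodgP[m [c cA ->]]; elim/big_ind: _ => [|g h eg eh|i _].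
- exact: act1.
- by rewrite actM eg eh.
have := cA i; rewrite inE => /asboolP[i' [j [t [Ai Aj dij ->]]]].
apply: gx_fix => //; apply: contraNF Al => /eqP -> //.
by rewrite An.
Qed.

(** Root elements with a fixed head index clear the coordinates of a vector one
  at a time. *)
Lemma clear (A : pred I) a (ks : seq I) v : (forall i, A (neg i) = A i) -> A a ->
  all A ks -> all (dis a) ks -> v 0 a = 1 ->
  exists2 y, y \in EA A & [/\ e (neg a) @ y = e (neg a), (v @ y) 0 a = 1,
    forall l, l \in ks -> (v @ y) 0 l = 0 &
    forall l, l \notin ks -> l != neg a -> (v @ y) 0 l = v 0 l].
Proof.
move=> An Aa + + va; elim: ks => [_ _|k ks IH /= /andP[Ak As] /andP[dak ds]].
  by exists 1%g; [exact: group1 | rewrite !act1; split].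
have [y Ey [fy y1 y0 yo]] := IH As ds.
have dka : dis k a by rewrite (dis_sym nK).
set t := - (v @ y) 0 k; exists (y * gx a k t)%g.
  by apply: groupM => //; apply: gx_EA.
have ent l : l != neg a -> (v @ (y * gx a k t)%g) 0 l = (v @ y) 0 l + (l == k)%:R * t.
  by move=> la; rewrite actM gx_ent // y1 mul1r (negbTE la) mul0r subr0.
have ka : (k == neg a) = false by case/andP: dak => _ /negbTE.
have ana : a != neg a by rewrite eq_sym.
split.
- rewrite actM fy gx_fix ?(negbTE (nn _)) // (can_eq nK) eq_sym.
  by case/andP: dak => /negbTE.
- rewrite ent // y1; case/andP: dka => /negbTE -> _.
  by rewrite mul0r addr0.
- move=> l; rewrite inE => /predU1P[->|ls].
    by rewrite ent ?ka // eqxx mul1r subrr.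
  have la : l != neg a by move/allP: ds => /(_ l ls) /andP[].
  rewrite ent //; case: (eqVneq l k) => [->|_]; first by rewrite mul1r subrr.
  by rewrite y0 // mul0r addr0.
- move=> l; rewrite inE negb_or => /andP[/negbTE lk ls] la.
  by rewrite ent // lk mul0r addr0 yo.
Qed.

(** The indices of the planes met by s. *)
Definition pm (s : seq I) : pred I := fun l => (l \in s) || (neg l \in s).

Lemma pm_neg (s : seq I) l : pm s (neg l) = pm s l.
Proof. by rewrite /pm nK orbC. Qed.

(** Make a coordinate outside the plane of m nonzero, use it to make the coordinate at
  neg m equal to 1, and clear the others with root elements of head neg m; being
  isotropic, the vector then has no coordinate at m. *)
Lemma reach m (s : seq I) j v : all (dis m) s -> j \in s -> v != 0 -> bf v v = 0 ->
  (forall l, ~~ pm (m :: s) l -> v 0 l = 0) ->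
  exists2 y, y \in EA (pm (m :: s)) & v @ y = e (neg m).
Proof.
move=> /allP ds js v0 vv vs; set A := pm (m :: s).
have An l : A (neg l) = A l by apply: pm_neg.
have Am : A m by rewrite /A /pm inE eqxx.
have Anm : A (neg m) by rewrite An.
have As l : pm s l -> A l by rewrite /A /pm !inE => /orP[]->; rewrite ?orbT.
have dm l : pm s l -> dis m l.
  by case/orP => /ds //; rewrite dis_neg.
have AE l : A l -> [|| l == m, l == neg m | pm s l].
  by rewrite /A /pm !inE (neg_eq nK); do !case: (_ == _); rewrite ?orbT.
have js' : pm s j by rewrite /pm js.
have out y l : y \in EA A -> ~~ A l -> (v @ y) 0 l = 0.
  move=> Ey Al; rewrite -[l]nK -bf_e.
  have <- : e (neg l) @ y = e (neg l) by apply: EA_fix Ey => //; rewrite An.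
  have /inO -> : y \in O by apply: fintype.subsetP Ey; apply: EA_O.
  by rewrite bf_e nK vs.
have [y1 [l [Ey1 sl vl]]] : exists y l, [/\ y \in EA A, pm s l & (v @ y) 0 l != 0].
  have [[l /andP[sl vl]]|] := pselect (exists l, pm s l && (v 0 l != 0)).
    by exists 1%g, l; rewrite act1 group1.
  move/forallNP => vs0.
  have vs0' l : pm s l -> v 0 l = 0.
    by move=> sl; apply/eqP/negPn/negP => vl; case: (vs0 l); rewrite sl vl.
  have mv a : A a -> dis a j -> v 0 a != 0 -> exists y l,
      [/\ y \in EA A, pm s l & (v @ y) 0 l != 0].
    move=> Aa daj va; exists (gx a j 1), j; split=> //; first by apply: gx_EA => //; apply: As.
    rewrite gx_ent // vs0' // add0r eqxx mul1r mulr1.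
    by case/andP: daj => _ /negbTE ->; rewrite mul0r subr0.
  have dmj := dm j js'.
  case: (eqVneq (v 0 m) 0) => [vm|]; last exact: mv.
  case: (eqVneq (v 0 (neg m)) 0) => [vnm|]; last by apply: mv; rewrite ?dis_neg.
  case/eqP: v0; apply/rowP => l; rewrite mxE.
  have [Al|Al] := boolP (A l); last exact: vs.
  by case/or3P: (AE l Al) => [/eqP->|/eqP->|/vs0'].
have dml := dm l sl; have dlm : dis l (neg m) by rewrite (dis_negr nK) (dis_sym nK).
set v1 := v @ y1 in vl.
set t := (1 - v1 0 (neg m)) / v1 0 l.
set v2 := v1 @ gx l (neg m) t.
have v2m : v2 0 (neg m) = 1.
  rewrite gx_ent // eqxx mul1r (can_eq nK) eq_sym.
  case/andP: dml => /negbTE lm _; rewrite lm mul0r subr0 mulrC divfK //.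
  by rewrite addrC subrK.
have Aks : all A [seq l <- enum I | pm s l].
  by apply/allP => i; rewrite mem_filter => /andP[/As].
have dks : all (dis (neg m)) [seq l <- enum I | pm s l].
  by apply/allP => i; rewrite mem_filter => /andP[/dm]; rewrite dis_neg.
have [y3 Ey3 [_ v3m v3s _]] := clear An Anm Aks dks v2m.
have Ey : (y1 * gx l (neg m) t * y3)%g \in EA A.
  by rewrite !groupM //; apply: gx_EA => //; apply: As.
exists (y1 * gx l (neg m) t * y3)%g => //.
set w := _ @ _; have wE : w = v2 @ y3 by rewrite /w !actM.
have ws i : i != neg m -> i != m -> w 0 i = 0.
  move=> i1 i2; have [Ai|Ai] := boolP (A i); last exact: out.
  case/or3P: (AE i Ai) i1 i2 => [->|->|si _ _] //.
  by rewrite wE v3s // mem_filter si mem_enum.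
have wm : w 0 m = 0.
  have : bf w w = 0.
    have /inO isoY : (y1 * gx l (neg m) t * y3)%g \in O.
      by apply: fintype.subsetP Ey; apply: EA_O.
    by rewrite /w isoY.
  rewrite /bf (bigD1 m) //= (bigD1 (neg m)) ?nn //= big1 ?addr0.
    rewrite nK wE v3m mul1r mulr1 => /eqP.
    by rewrite -mulr2n -mulr_natl mulf_eq0 (negbTE two_neq0) => /eqP.
  by move=> i /andP[im inm]; rewrite ws ?mul0r // ?(can_eq nK) ?(neg_eq nK).
apply/rowP => i; rewrite [RHS]mxE eqxx /=.
case: (eqVneq i (neg m)) => [->|inm]; first by rewrite wE v3m.
by case: (eqVneq i m) => [->|im] //; apply: ws.
Qed.

(** Monomial isometries permute the root subgroups. *)
Lemma gx_conj g (f : I -> I) (c : I -> F) i j t : injective f ->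
  (forall l, f (neg l) = neg (f l)) -> (forall l, c l * c (neg l) = 1) ->
  (forall l, e l @ g = c l *: e (f l)) -> dis i j ->
  (gx i j t ^ g)%g = gx (f i) (f j) (t * c j / c i).
Proof.
move=> fI fn cc fg dij.
have dfij : dis (f i) (f j) by rewrite /apart -fn !(inj_eq fI).
have c0 l : c l != 0.
  by apply: contra_eq_neq (cc l) => ->; rewrite mul0r eq_sym oner_neq0.
have cn l : c (neg l) = (c l)^-1 by apply: (mulfI (c0 l)); rewrite cc divff.
apply/conjg_eq; apply: act_ext => l; rewrite !actM gxE // !(actD, actN, actZ) !fg actZ gxE //.
rewrite !mxE /= -!fn !(inj_eq fI) !fn [i == l]eq_sym [neg j == l]eq_sym.
case: (eqVneq l i) => [->|li].
  have -> : (i == neg j) = false.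
    by rewrite eq_sym (neg_eq nK); case/andP: dij => _ /negbTE.
  by apply/rowP => q; rewrite !mxE /=; field.
case: (eqVneq l (neg j)) => [->|lj].
  rewrite !cn !fn; apply/rowP => q; rewrite !mxE /=; field.
  by rewrite !c0.
by apply/rowP => q; rewrite !mxE /=; ring.
Qed.

(** The orthogonal group of a single plane. *)
Definition D0 m : {set gT} :=
  [set g in O | `[< forall l, l != m -> l != neg m -> e l @ g = e l >]].

(** An isometry of a hyperbolic plane preserves its two isotropic lines or exchanges
  them. *)
Lemma D0P m d : d \in D0 m -> exists2 a : F, a != 0 &
  (e m @ d = a *: e m /\ e (neg m) @ d = a^-1 *: e (neg m)) \/
  (e m @ d = a *: e (neg m) /\ e (neg m) @ d = a^-1 *: e m).
Proof.
rewrite inE => /andP[/inO iso_d /asboolP fix_d].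
have mn : (m == neg m) = false by rewrite eq_sym (negbTE (nn m)).
have two x l : (l == m) || (l == neg m) ->
    (e l @ d) 0 x = (if x == m then (e l @ d) 0 m else
      if x == neg m then (e l @ d) 0 (neg m) else 0).
  move=> lm; case: (eqVneq x m) => [->//|xm]; case: (eqVneq x (neg m)) => [->//|xnm].
  rewrite -[x]nK -bf_e -fix_d ?(can_eq nK) // ?(neg_eq nK) // iso_d bf_e nK mxE eqxx /=.
  by case/orP: lm => /eqP->; rewrite ?(negbTE xm) ?(negbTE xnm).
have vec l : (l == m) || (l == neg m) ->
    e l @ d = (e l @ d) 0 m *: e m + (e l @ d) 0 (neg m) *: e (neg m).
  move=> lm; apply/rowP => x; rewrite two //.
  move: ((e l @ d) 0 m) ((e l @ d) 0 (neg m)) => p q; rewrite !mxE eqxx /=.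
  case: eqP => [->|_]; first by rewrite mn mulr1 mulr0 addr0.
  by case: eqP => _; rewrite ?mulr1 ?mulr0 ?add0r ?addr0.
have em : (m == m) || (m == neg m) by rewrite eqxx.
have en : (neg m == m) || (neg m == neg m) by rewrite eqxx orbT.
move: (vec m em) (vec (neg m) en).
set a := (e m @ d) 0 m; set b := (e m @ d) 0 (neg m).
set a' := (e (neg m) @ d) 0 m; set b' := (e (neg m) @ d) 0 (neg m).
move=> E E'.
have bfab (p q p' q' : F) : bf (p *: e m + q *: e (neg m)) (p' *: e m + q' *: e (neg m)) =
    p * q' + q * p'.
  rewrite bfDl !bfZl !bf_e nK !mxE /= !eqxx mn (negbTE (nn m)) /=; ring.
have h1 : a * b + b * a = 0 by rewrite -bfab -E iso_d bf_e mxE eqxx (negbTE (nn m)).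
have h2 : a' * b' + b' * a' = 0.
  by rewrite -bfab -E' iso_d bf_e nK mxE eqxx mn.
have h3 : a * b' + b * a' = 1 by rewrite -bfab -E -E' iso_d bf_e mxE !eqxx.
have z2 (p q : F) : p * q + q * p = 0 -> p * q = 0.
  rewrite [q * p]mulrC -mulr2n -mulr_natl => /eqP.
  by rewrite mulf_eq0 (negbTE two_neq0) => /eqP.
have /eqP := z2 _ _ h1; rewrite mulf_eq0 => /orP[]/eqP p0.
  move: h3; rewrite p0 mul0r add0r => h3.
  have b0 : b != 0 by apply: contra_eq_neq h3 => ->; rewrite mul0r eq_sym oner_neq0.
  have a'E : a' = b^-1 by apply: (mulfI b0); rewrite h3 divff.
  have /eqP := z2 _ _ h2; rewrite mulf_eq0 a'E invr_eq0 (negbTE b0) => /eqP b'0.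
  by exists b => //; right; rewrite E E' p0 b'0 a'E !scale0r add0r addr0.
move: h3; rewrite p0 mul0r addr0 => h3.
have a0 : a != 0 by apply: contra_eq_neq h3 => ->; rewrite mul0r eq_sym oner_neq0.
have b'E : b' = a^-1 by apply: (mulfI a0); rewrite h3 divff.
have /eqP := z2 _ _ h2; rewrite mulf_eq0 b'E invr_eq0 (negbTE a0) orbF => /eqP a'0.
by exists a => //; left; rewrite E E' p0 a'0 b'E !scale0r add0r addr0.
Qed.

Lemma gphi_EA (A : pred I) i j a b c d : A i -> A j -> dis i j ->
  a * d - b * c = 1 -> gphi i j a b c d \in EA A.
Proof.
move=> Ai Aj dij; move: a b c d; apply: sl2_ind => [t|t|].
- exact: gx_EA.
- have -> : gphi i j 1 0 t 1 = gx j i t.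
    have dji : dis j i by rewrite (dis_sym nK).
    apply: act_ext_v => v; rewrite gxE // /act gphiE //; last by ring.
    by rewrite mul_phimx //; apply/rowP => q; rewrite !mxE; ring.
  by apply: gx_EA; rewrite // (dis_sym nK).
- move=> a b c d a' b' c' d' det det' IH IH'.
  by rewrite -gphiM //; apply: groupM.
Qed.

(** The tori of (m, j) and (m, neg j) agree on the plane of m and are inverse to each
  other on that of j, so their product is a square on the first and trivial on the
  second. *)
Lemma torus_EA m j a : dis m j -> a != 0 -> exists2 z, z \in EA predT &
  [/\ e m @ z = a ^+ 2 *: e m, e (neg m) @ z = a ^- 2 *: e (neg m) &
      forall l, l != m -> l != neg m -> e l @ z = e l].
Proof.
move=> dmj a0; have dmnj : dis m (neg j) by rewrite (dis_negr nK).
have det : a * a^-1 - 0 * 0 = 1 by field.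
exists (gphi m j a 0 0 a^-1 * gphi m (neg j) a 0 0 a^-1)%g.
  by apply: groupM; apply: gphi_EA.
have [r1 r2 r3 r4] := phimx_rows nK nn a 0 0 a^-1 dmj.
have [s1 s2 s3 s4] := phimx_rows nK nn a 0 0 a^-1 dmnj.
rewrite !nK in s3 s4.
rewrite !(scale0r, addr0, add0r, subr0, oppr0) in r1 r2 r3 r4 s1 s2 s3 s4.
have E x y : e x @ (gphi m j a 0 0 a^-1 * gphi m (neg j) a 0 0 a^-1)%g = y <->
    e x *m phimx m j a 0 0 a^-1 *m phimx m (neg j) a 0 0 a^-1 = y.
  by rewrite actM /act !gphiE.
split.
- by apply/E; rewrite r1 -scalemxAl s1 scalerA expr2.
- by apply/E; rewrite r3 -scalemxAl s3 scalerA -exprVn expr2.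
move=> l lm lnm; apply/E.
case: (eqVneq l j) => [->|lj]; first by rewrite r2 -scalemxAl s4 scalerA mulVf ?scale1r.
case: (eqVneq l (neg j)) => [->|lnj].
  by rewrite r4 -scalemxAl s2 scalerA mulfV ?scale1r.
have F1 : e l *m phimx m j a 0 0 a^-1 = e l.
  by rewrite -rowE rowK (negbTE lm) (negbTE lj) (negbTE lnm) (negbTE lnj).
by rewrite F1 -rowE rowK nK (negbTE lm) (negbTE lj) (negbTE lnm) (negbTE lnj).
Qed.

Lemma D0_fix m d l : d \in D0 m -> l != m -> l != neg m -> e l @ d = e l.
Proof. by rewrite inE => /andP[_ /asboolP]; apply. Qed.

Lemma D0_norm m : D0 m \subset 'N(EA predT).
Proof.
apply/fintype.subsetP => d Dd; rewrite inE /= -genJ gen_subG.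
apply/fintype.subsetP => _ /imsetP[x + ->]; rewrite inE => /asboolP[i [j [t [_ _ dij ->]]]].
have fixd l := D0_fix Dd (l := l).
have mn : (m == neg m) = false by rewrite eq_sym (negbTE (nn m)).
have [a a0 aE] := D0P Dd.
pose c l := if l == m then a else if l == neg m then a^-1 else 1.
have cc l : c l * c (neg l) = 1.
  rewrite /c (neg_eq nK) (can_eq nK); case: (eqVneq l m) => [->|_].
    by rewrite mn divff.
  by case: eqP => _; rewrite ?mulVf ?mulr1.
case: aE => [[em en]|[em en]].
  rewrite (gx_conj (f := id) (c := c) _ (@inj_id _) (fun=> erefl) cc) //.
    by apply: gx_EA.
  move=> l; rewrite /c; case: (eqVneq l m) => [->//|lm].
  by case: (eqVneq l (neg m)) => [->//|lnm]; rewrite fixd // scale1r.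
have tpn l : tperm m (neg m) (neg l) = neg (tperm m (neg m) l).
  case: (tpermP m (neg m) l) => [->|->|lm lnm]; rewrite ?tpermR ?nK ?tpermL //.
  by rewrite tpermD // 1?(can_eq nK) 1?eq_sym ?(neg_eq nK); apply/eqP.
rewrite (gx_conj (f := tperm m (neg m)) (c := c) _ (@perm_inj _ _) tpn cc) //.
  by apply: gx_EA => //; rewrite /apart -tpn !(inj_eq (@perm_inj _ _)).
move=> l; rewrite /c; case: (eqVneq l m) => [->//|lm]; first by rewrite tpermL.
case: (eqVneq l (neg m)) => [->//|lnm]; first by rewrite tpermR.
by rewrite tpermD 1?eq_sym // fixd // scale1r.
Qed.

(** The orthogonal group of a plane is generated by a torus and a reflection inverting
  it: commutators are squares in the torus. *)
Lemma D0_comm m j d d' : dis m j -> d \in D0 m -> d' \in D0 m ->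
  [~ d, d']%g \in EA predT.
Proof.
move=> dmj Dd Dd'.
have fixd l := D0_fix Dd (l := l); have fixd' l := D0_fix Dd' (l := l).
have ext z : z \in EA predT -> (forall l, l != m -> l != neg m -> e l @ z = e l) ->
    e m @ d @ d' = e m @ d' @ d @ z -> e (neg m) @ d @ d' = e (neg m) @ d' @ d @ z ->
    [~ d, d']%g \in EA predT.
  move=> Ez fz e1 e2; rewrite (@commg_eq _ d d' z) //.
  apply: act_ext => l; rewrite !actM.
  case: (eqVneq l m) => [->//|lm]; case: (eqVneq l (neg m)) => [->//|lnm].
  by rewrite fixd // !fixd' // fixd // fz.
have [a a0 aE] := D0P Dd; have [b b0 bE] := D0P Dd'.
case: aE bE => [[em en]|[em en]] [[em' en']|[em' en']].
- apply: (ext 1%g) => //; try by move=> *; rewrite act1.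
    by rewrite em em' act1 !actZ em em' !scalerA mulrC.
  by rewrite en en' act1 !actZ en en' !scalerA mulrC.
- have av0 : a^-1 != 0 by rewrite invr_eq0.
  have [z Ez [z1 z2 zf]] := torus_EA dmj av0.
  apply: (ext z) => //; rewrite ?em ?en ?em' ?en' !actZ ?em ?en ?em' ?en' !actZ ?z1 ?z2 !scalerA.
    by congr (_ *: _); field; rewrite ?a0 ?b0 ?oner_neq0.
  by congr (_ *: _); field; rewrite ?a0 ?b0 ?oner_neq0.
- have [z Ez [z1 z2 zf]] := torus_EA dmj b0.
  apply: (ext z) => //; rewrite ?em ?en ?em' ?en' !actZ ?em ?en ?em' ?en' !actZ ?z1 ?z2 !scalerA.
    by congr (_ *: _); field; rewrite ?a0 ?b0 ?oner_neq0.
  by congr (_ *: _); field; rewrite ?a0 ?b0 ?oner_neq0.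
- have ab0 : a / b != 0 by rewrite mulf_neq0 ?invr_eq0.
  have [z Ez [z1 z2 zf]] := torus_EA dmj ab0.
  apply: (ext z) => //; rewrite ?em ?en ?em' ?en' !actZ ?em ?en ?em' ?en' !actZ ?z1 ?z2 !scalerA.
    by congr (_ *: _); field; rewrite a0 b0.
  by congr (_ *: _); field; rewrite a0 b0.
Qed.

(** One plane after the other: an isometry is corrected by root elements so as to fix
  a hyperbolic pair, until it acts on the last plane only. *)
Lemma O_gen m0 (s : seq I) g : pairwise dis (rcons s m0) -> g \in O ->
  (forall l, ~~ pm (rcons s m0) l -> e l @ g = e l) ->
  g \in EA predT <*> <<D0 m0>>.
Proof.
set K := _ <*> _; elim: s g => [|m s IH] g ps Og fg.
  apply: (fintype.subsetP (joing_subr _ _)); apply/mem_gen; rewrite inE Og; apply/asboolP.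
  by move=> l lm lnm; apply: fg; rewrite /pm !inE (neg_eq nK) negb_or lm.
have EK y A : y \in EA A -> y \in K.
  move=> Ey; apply: (fintype.subsetP (joing_subl _ _)).
  by apply: fintype.subsetP Ey; apply: EA_mono.
move: ps; rewrite rcons_cons /= => /andP[ds ps].
set s1 := rcons s m0 in ds ps IH fg.
have [j js] : exists j, j \in s1 by exists m0; rewrite mem_rcons mem_head.
have mn : (m == neg m) = false by rewrite eq_sym (negbTE (nn m)).
set A := pm (m :: s1).
have An l : A (neg l) = A l by apply: pm_neg.
have fg' l : ~~ A l -> e l @ g = e l by move=> Al; apply: fg; rewrite rcons_cons.
have iso_g : bf_isom g by apply/inO.
have [y1 Ey1 v1] : exists2 y, y \in EA A & e (neg m) @ g @ y = e (neg m).
  apply: reach ds js _ _ _.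
  - apply/eqP => z.
    have : e (neg m) = 0 by rewrite -[LHS](actK _ g) z /act mul0mx.
    by move/rowP/(_ (neg m)); rewrite !mxE !eqxx /= => /eqP; rewrite oner_eq0.
  - by rewrite iso_g bf_e nK mxE eqxx mn.
  - move=> l Al; rewrite -[l]nK -bf_e -fg' ?An // iso_g bf_e nK mxE eqxx /=.
    rewrite (_ : (l == neg m) = false) //.
    by apply: contraNF Al => /eqP->; rewrite pm_neg /pm inE eqxx.
set g1 := (g * y1)%g.
have Og1 : g1 \in O by rewrite groupM // (fintype.subsetP (EA_O A)).
have iso1 : bf_isom g1 by apply/inO.
have fg1 l : ~~ A l -> e l @ g1 = e l.
  by move=> Al; rewrite actM fg' // (EA_fix An Al).
have v1' : e (neg m) @ g1 = e (neg m) by rewrite actM.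
have Am : A m by rewrite /A /pm inE eqxx.
have u1 : (e m @ g1) 0 m = 1.
  by rewrite -{2}[m]nK -bf_e -v1' bfC iso1 bf_e mxE !eqxx.
pose ks := [seq l <- enum I | pm s1 l].
have Aks : all A ks.
  apply/allP => l; rewrite mem_filter => /andP[sl _]; move: sl.
  by rewrite /A /pm !inE => /orP[]->; rewrite ?orbT.
have dks : all (dis m) ks.
  apply/allP => l; rewrite mem_filter => /andP[/orP[] /(allP ds) // + _].
  by rewrite (dis_negr nK).
have [y2 Ey2 [f2 w1 w0 _]] := clear An Am Aks dks u1.
set g2 := (g1 * y2)%g.
have Og2 : g2 \in O by rewrite groupM // (fintype.subsetP (EA_O A)).
have iso2 : bf_isom g2 by apply/inO.
have fg2 l : ~~ A l -> e l @ g2 = e l.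
  by move=> Al; rewrite actM fg1 // (EA_fix An Al).
have v2 : e (neg m) @ g2 = e (neg m) by rewrite actM v1'.
set w := e m @ g2; have wE : w = e m @ g1 @ y2 by rewrite /w actM.
have ws i : i != neg m -> i != m -> w 0 i = 0.
  move=> i1 i2; have [Ai|Ai] := boolP (A i); last first.
    rewrite -[i]nK -bf_e -fg2 ?An // iso2 bf_e nK mxE eqxx (negbTE i2) //.
  rewrite wE w0 // mem_filter mem_enum andbT.
  move: Ai; rewrite /A /pm !inE (neg_eq nK) (negbTE i1) (negbTE i2) //.
have wm : w 0 (neg m) = 0.
  have : bf w w = 0 by rewrite iso2 bf_e mxE eqxx (negbTE (nn m)).
  rewrite /bf (bigD1 m) //= (bigD1 (neg m)) ?nn //= big1 ?addr0.
    rewrite nK !wE w1 mul1r mulr1 => /eqP.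
    by rewrite -mulr2n -mulr_natl mulf_eq0 (negbTE two_neq0) => /eqP.
  by move=> i /andP[im inm]; rewrite ws ?mul0r // ?(can_eq nK) ?(neg_eq nK).
have u2 : e m @ g2 = e m.
  apply/rowP => i; rewrite [RHS]mxE eqxx /= -/w.
  case: (eqVneq i m) => [->|im]; first by rewrite wE w1.
  by case: (eqVneq i (neg m)) => [->//|inm]; apply: ws.
have Kg2 : g2 \in K.
  apply: IH => // l sl.
  case: (eqVneq l m) => [->//|lm]; case: (eqVneq l (neg m)) => [->//|lnm].
  apply: fg2; apply: contra sl; rewrite /A /pm !inE (neg_eq nK) (negbTE lm) (negbTE lnm) //.
by rewrite -(mulgK y1 g) groupM ?groupV ?(EK y1 A) // -(mulgK y2 (g * y1)%g) groupM ?groupV ?(EK y2 A).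
Qed.

(** The quotient of the isometry group by the root elements is abelian, because it is
  generated by the isometries of one plane.  Conversely a root element is a
  commutator, as there are three planes. *)
Theorem derived_EA (s : seq I) : pairwise dis s -> (2 < size s)%N -> (forall l, pm s l) ->
  (O^`(1))%g = EA predT :> {set gT}.
Proof.
case/lastP: s => [|s m0] // ps; rewrite size_rcons ltnS => ss full.
apply/eqP; rewrite finset.eqEsubset; apply/andP; split.
  pose K := EA predT <*> <<D0 m0>>.
  have OK : O \subset K.
    apply/fintype.subsetP => g Og; apply: O_gen ps Og _ => l.
    by rewrite full.
  have nK' : K \subset 'N(EA predT).
    by rewrite join_subG normG gen_subG D0_norm.
  apply: fintype.subset_trans (dergS 1 OK) _; apply: der1_min => //.
  rewrite /K quotientYidl ?gen_subG ?D0_norm // quotient_gen ?D0_norm // abelian_gen.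
  case: s ps ss {full K OK nK'} => // m s ps _.
  have dm : dis m0 m.
    by move: ps; rewrite rcons_cons /= all_rcons (dis_sym nK) => /andP[/andP[]].
  apply/centsP => _ /morphimP[d nd Dd ->] _ /morphimP[d' nd' Dd' ->].
  apply/commgP; rewrite -morphR //= coset_id //; exact: D0_comm dm Dd Dd'.
apply: EA_sub => i j t _ _ dij.
have nd q a b : dis a b -> ~~ dis q a -> ~~ dis q b -> False.
  move=> dab; rewrite /apart !negb_and !negbK => /orP[]/eqP ea /orP[]/eqP eb.
  - by rewrite ea eb (dis_irr neg) in dab.
  - by rewrite ea eb (dis_negr nK) (dis_irr neg) in dab.
  - by rewrite ea eb (dis_negl nK) (dis_irr neg) in dab.
  - by rewrite ea eb (dis_negl nK) (dis_negr nK) (dis_irr neg) in dab.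
have [k [dik dkj]] : exists k, dis i k /\ dis k j.
  apply: contrapT => /forallNP nk.
  have {}nk k : ~~ dis i k \/ ~~ dis j k.
    apply/orP; rewrite -negb_and; apply/negP => /andP[h1 h2]; case: (nk k).
    by rewrite h1 (dis_sym nK).
  case: (rcons s m0) (size_rcons s m0) ps => [|a [|b [|c s']]] //= sz; try by case: sz ss => <-.
  case/and3P=> /and3P[dab dac _] /andP[dbc _] _.
  have := nd _ _ _ dab; have := nd _ _ _ dac; have := nd _ _ _ dbc.
  case: (nk a) (nk b) (nk c) => na [] nb [] nc h1 h2 h3.
  - exact: (h1 i).
  - exact: (h3 i).
  - exact: (h2 i).
  - exact: (h1 j).
  - exact: (h1 i).
  - exact: (h2 j).
  - exact: (h3 j).
  - exact: (h1 j).
rewrite -[t]mulr1 -(gx_comm _ _ dik dij dkj); apply: mem_commg; apply: (fintype.subsetP (EA_O predT)); exact: gx_EA.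
Qed.

End Derived.


End MatrixGroup.

(** * Signed permutations *)

Section SignedPerm.
Variable r : nat.
Local Notation n := r.+3.
Local Notation J := 'I_n.
Implicit Types (i j k l : J).

(** A signed permutation (d, s) sends the basis vector i to the basis vector s i
  with sign (-1) ^ d i. *)
Definition sp := ({ffun J -> bool} * {perm J})%type.
Implicit Types (a b c : sp).

Definition spM a b : sp := ([ffun i => a.1 i (+) b.1 (a.2 i)], a.2 * b.2).
Definition sp1 : sp := ([ffun=> false], 1).
Definition spV a : sp := ([ffun i => a.1 ((a.2)^-1 i)], (a.2)^-1).
(** Determinant 1: the sign of the permutation is the product of the signs. *)
Definition even a := odd_perm a.2 == \big[addb/false]_i a.1 i.

Lemma spMA : associative spM.
Proof.
move=> a b c; congr (_, _); last by rewrite /= mulgA.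
by apply/ffunP => i; rewrite !ffunE /= permM addbA.
Qed.

Lemma spM1 : right_id sp1 spM.
Proof.
case=> d s; rewrite /spM /= mulg1; congr (_, _).
by apply/ffunP => i; rewrite !ffunE addbF.
Qed.

Lemma sp1M : left_id sp1 spM.
Proof.
case=> d s; rewrite /spM /= mul1g; congr (_, _).
by apply/ffunP => i; rewrite !ffunE perm1.
Qed.

Lemma spMV a : spM a (spV a) = sp1.
Proof.
rewrite /spM /= mulgV; congr (_, _); apply/ffunP => i.
by rewrite !ffunE permK addbb.
Qed.

Lemma spVM a : spM (spV a) a = sp1.
Proof.
rewrite /spM /= mulVg; congr (_, _); apply/ffunP => i.
by rewrite !ffunE addbb.
Qed.

Lemma even1 : even sp1.
Proof. by rewrite /even odd_perm1 big1 // => i _; rewrite ffunE. Qed.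

Lemma evenM a b : even a -> even b -> even (spM a b).
Proof.
rewrite /even /= odd_permM => /eqP -> /eqP ->.
under [X in _ == X]eq_bigr do rewrite ffunE.
by rewrite big_split /= [X in _ (+) X == _](reindex_inj (@perm_inj _ a.2)).
Qed.

Lemma evenV a : even a -> even (spV a).
Proof.
rewrite /even /= odd_permV => /eqP ->.
rewrite [X in X == _](reindex_inj (@perm_inj _ a.2^-1)) /=.
by apply/eqP/eq_bigr => i _; rewrite ffunE.
Qed.

(** The signed transposition k -> l -> -k. *)
Definition tr k l : sp := ([ffun i => i == l], tperm k l).

Lemma even_tr k l : k != l -> even (tr k l).
Proof.
move=> kl; rewrite /even odd_tperm kl (bigD1 l) //= ffunE eqxx big1 // => i il.
by rewrite ffunE (negbTE il).
Qed.

Lemma tr_conj a k l : k != l -> a.1 k = a.1 l -> spM a (tr (a.2 k) (a.2 l)) = spM (tr k l) a.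
Proof.
move=> kl akl; congr (_, _); last first.
  by rewrite /= -tpermJ conjgE mulVKg.
apply/ffunP => i; rewrite !ffunE /= (inj_eq perm_inj).
case: tpermP => [->|->|_ /eqP/negbTE ->]; rewrite ?addbF //.
  by rewrite (negbTE kl) addbF.
by rewrite eqxx addbC akl.
Qed.

Lemma trV k l : k != l -> spM (tr k l) (tr l k) = sp1.
Proof.
move=> kl; rewrite /spM /sp1 /= tpermC tperm2; congr (_, _).
apply/ffunP => i; rewrite !ffunE /=.
case: (tpermP l k i) => [->|->|/eqP/negbTE ik /eqP/negbTE il]; rewrite ?eqxx //.
- by rewrite [k == l]eq_sym addbb.
- by rewrite ik il.
Qed.

Lemma tr4 k l : k != l -> tr l k = spM (tr k l) (spM (tr k l) (tr k l)).
Proof.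
move=> kl; congr (_, _); last by rewrite /= tperm2 mulg1 tpermC.
apply/ffunP => i; rewrite !ffunE /=.
have lk : (l == k) = false by rewrite eq_sym (negbTE kl).
case: (eqVneq i k) => [->|ik]; first by rewrite !tpermL tpermR !eqxx (negbTE kl).
case: (eqVneq i l) => [->|il]; first by rewrite !tpermR tpermL !eqxx (negbTE kl).
by do 2!rewrite tpermD 1?eq_sym //; rewrite ?(negbTE il).
Qed.

(** The signed permutations of determinant 1 supported on a set are generated by
  the signed transpositions of that set: each one reduces the support. *)
Lemma sp_ind (D : pred J) (P : sp -> Prop) : P sp1 ->
  (forall k l a, D k -> D l -> k != l -> even a -> P a -> P (spM (tr k l) a)) ->
  forall a, even a -> (forall i, ~~ D i -> a.2 i = i /\ a.1 i = false) -> P a.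
Proof.
move=> P1 PM a; pose mv a := [pred i | (a.2 i != i) || a.1 i].
have [m] := ubnP #|mv a|; elim: m a => // m IH a; rewrite ltnS => le_m ea fa.
have inD i : mv a i -> D i.
  by rewrite /=; apply: contraLR => /fa[-> ->]; rewrite eqxx.
have unmv b : (forall i, ~~ mv b i) -> b = sp1.
  move=> h; case: b h => d s h; congr (_, _).
    by apply/ffunP => i; rewrite ffunE; have := h i; rewrite negb_or => /andP[_ /negbTE].
  by apply/permP => i; rewrite perm1; have := h i; rewrite negb_or negbK => /andP[/eqP].
have step k l b : k != l -> spM (tr k l) (spM (tr l k) b) = b.
  by move=> kl; rewrite spMA trV // sp1M.
have dec b k : mv a k -> ~~ mv b k -> {subset mv b <= mv a} -> even b -> P b.
  move=> ak bk ba eb; apply: IH => // [|i Di].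
    apply: leq_trans le_m; apply: proper_card; apply/fintype.properP.
    by split; [apply/fintype.subsetP | exists k].
  have := contraNN (ba i) (contraNN (inD i) Di).
  by rewrite negb_or negbK => /andP[/eqP-> /negbTE->].
have [[k ak]|no] := pselect (exists k, a.2 k != k); last first.
  have s1 : forall i, a.2 i = i.
    by move=> i; apply/eqP/negPn/negP => h; apply: no; exists i.
  have [[k ak]|no'] := pselect (exists k, a.1 k); last first.
    rewrite (unmv a) // => i; rewrite /= s1 eqxx /=.
    by apply/negP => h; apply: no'; exists i.
  have [l lk al] : exists2 l, l != k & a.1 l.
    apply: contrapT => no'; move: ea; rewrite /even.
    have -> : a.2 = 1 by apply/permP => i; rewrite perm1 s1.
    rewrite odd_perm1 (bigD1 k) //= ak big1 // => i ik; apply/negP => h.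
    by apply: no'; exists i.
  have kl : k != l by rewrite eq_sym.
  have [Dk Dl] : D k /\ D l by split; apply: inD; rewrite /= ?ak ?al orbT.
  have lk' : even (tr l k) by apply: even_tr.
  rewrite -(step k l a) //; apply: (PM) => //; first exact: evenM.
  rewrite -(step k l (spM (tr l k) a)) //; apply: (PM) => //; first by do 2!apply: evenM => //.
  set b := spM _ _.
  have b2 i : b.2 i = i by rewrite /= !permM s1 -permM tperm2 perm1.
  have bk i : i != k -> i != l -> b.1 i = a.1 i.
    move=> ik il; have t : tperm l k i = i by rewrite tpermD // eq_sym.
    by rewrite !ffunE /= !t (negbTE ik).
  have bk0 : b.1 k = false by rewrite !ffunE /= eqxx tpermR (negbTE lk) tpermL ak.
  have bl0 : b.1 l = false.
    by rewrite !ffunE /= eq_sym (negbTE kl) tpermL eqxx tpermR al.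
  apply: (dec b k); rewrite /= ?ak ?orbT //.
  + by rewrite b2 eqxx bk0.
  + move=> i; rewrite !inE b2 eqxx s1 eqxx /=.
    case: (eqVneq i k) => [->|ik]; first by rewrite bk0.
    by case: (eqVneq i l) => [->|il]; [rewrite bl0 | rewrite bk].
  + by do 2!apply: evenM => //.
set l := a.2 k.
have kl : k != l by rewrite eq_sym.
have ml : mv a l by rewrite /= (inj_eq perm_inj) ak.
have [Dk Dl] : D k /\ D l by split; apply: inD => //; rewrite /= ak.
(* both signed transpositions of k and l send l back to itself; one of them with
   the sign + *)
have red k' l' : k' != l' -> D k' -> D l' -> (k' == k) && (l' == l) || (k' == l) && (l' == k) ->
    (spM (tr l' k') a).1 l = false -> P a.
  move=> kl' Dk' Dl' e bl0; rewrite -(step k' l' a) //.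
  have et : even (tr l' k') by apply: even_tr; rewrite eq_sym.
  apply: (PM) => //; first exact: evenM.
  set b := spM _ _ in bl0 *.
  have t2 : (tr l' k').2 = tperm k l.
    by case/orP: e => /andP[/eqP-> /eqP->]; rewrite //= tpermC.
  have bo i : i != k -> i != l -> b.2 i = a.2 i /\ b.1 i = a.1 i.
    move=> ik il; rewrite /b /= ffunE permM -[tperm l' k']/((tr l' k').2) t2 tpermD 1?eq_sym //.
    split=> //; rewrite ffunE (_ : i == k' = false) //.
    by apply/negbTE; case/orP: e => /andP[/eqP-> _].
  apply: (dec b l) => //; last exact: evenM.
  + by rewrite /= bl0 permM -[tperm l' k']/((tr l' k').2) t2 tpermR eqxx.
  + move=> i; rewrite !inE; case: (eqVneq i k) => [->|ik]; first by rewrite ak.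
    case: (eqVneq i l) => [-> _|il]; first by have := ml; rewrite /=.
    by have [-> ->] := bo i ik il.
case: (boolP (a.1 k)) => ak1.
  apply: (red l k); rewrite ?eqxx ?orbT // 1?eq_sym //.
  by rewrite ffunE /= ffunE eqxx tpermR ak1.
apply: (red k l); rewrite ?eqxx //.
by rewrite ffunE /= ffunE eq_sym (negbTE kl) tpermL (negbTE ak1).
Qed.

Definition jj (k : nat) : J := inord k.

Lemma jjK i : jj i = i. Proof. exact: inord_val. Qed.

Lemma val_jj (k : nat) : k < n -> jj k = k :> nat.
Proof. exact: inordK. Qed.

Lemma jj_eq (k l : nat) : k < n -> l < n -> (jj k == jj l) = (k == l).
Proof. by move=> kn ln; rewrite -val_eqE /= !val_jj. Qed.

(** From the adjacent signed transpositions of an interval to all of them.  The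
  property is meant to be membership in a subgroup, hence the two closure
  conditions. *)
Lemma tr_all (P : sp -> Prop) (lo : nat) :
  (forall a b, even a -> even b -> P a -> P b -> P (spM a b)) ->
  (forall a b c, even a -> even b -> even c -> P a -> P b -> spM a c = spM b a -> P c) ->
  (lo.+1 < n -> P (tr (jj lo) (jj lo.+1))) ->
  (forall k : nat, lo <= k -> k.+2 < n -> exists a, [/\ even a, P a,
     a.2 (jj k) = jj k.+1, a.2 (jj k.+1) = jj k.+2 & a.1 (jj k) = a.1 (jj k.+1)]) ->
  forall i j, lo <= i -> lo <= j -> i != j -> P (tr i j).
Proof.
move=> PM PC P0 Ps.
have adj (k : nat) : lo <= k -> k.+1 < n -> P (tr (jj k) (jj k.+1)).
  elim: k => [|k IH]; first by rewrite leqn0 => /eqP <-.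
  rewrite leq_eqVlt => /predU1P[<- //|]; rewrite ltnS => lok kn.
  have kn' : k.+1 < n by apply: ltnW.
  have [a [ea Pa a0 a1 ad]] := Ps k lok kn.
  have ne : jj k != jj k.+1 by rewrite jj_eq ?neq_ltn ?ltnSn // ltnW.
  apply: (PC a (tr (jj k) (jj k.+1))) => //; try exact: even_tr.
  - by apply: even_tr; rewrite jj_eq // neq_ltn ltnSn.
  - exact: IH.
  - by have := tr_conj ne ad; rewrite a0 a1.
have up (k l : nat) : lo <= k -> k < l -> l < n -> P (tr (jj k) (jj l)).
  move=> lok; elim: l => // l IH; rewrite ltnS leq_eqVlt => /predU1P[<-|kl] ln.
    exact: adj.
  have ln' := ltnW ln; have kn := ltn_trans kl ln'.
  have ne : jj k != jj l by rewrite jj_eq // neq_ltn kl.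
  have nel : jj l != jj l.+1 by rewrite jj_eq // neq_ltn ltnSn.
  have nek : jj k != jj l.+1 by rewrite jj_eq // neq_ltn ltnS (ltnW kl).
  apply: (PC (tr (jj l) (jj l.+1)) (tr (jj k) (jj l))); rewrite ?even_tr //.
  - by apply: adj => //; apply: leq_trans lok (ltnW kl).
  - exact: IH.
  - have := @tr_conj (tr (jj l) (jj l.+1)) (jj k) (jj l) ne.
    rewrite /= tpermL tpermD 1?eq_sym // !ffunE => -> //.
    by rewrite (negbTE nek) (negbTE nel).
move=> i j loi loj ij; rewrite -(jjK i) -(jjK j).
have [lt|lt|/val_inj e] := ltngtP i j; first exact: up.
  have ne : jj j != jj i by rewrite !jjK eq_sym.
  rewrite (tr4 ne); have e := even_tr ne; have Pt := up j i loj lt (ltn_ord i).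
  by apply: (PM) => //; [apply: evenM | apply: PM].
by rewrite e eqxx in ij.
Qed.

(** Every injective partial assignment extends to a signed permutation of
  determinant 1 with signs only on the last basis vector. *)
Lemma sp_extend (t : seq J) : uniq t -> exists a, even a /\
  forall k : nat, k < size t -> a.2 (jj k) = nth ord0 t k /\ (k < n.-1 -> a.1 (jj k) = false).
Proof.
move=> ut; pose q := t ++ [seq i <- enum J | i \notin t].
have uq : uniq q.
  rewrite cat_uniq ut filter_uniq ?enum_uniq // andbT.
  by apply/hasPn => i; rewrite mem_filter => /andP[].
have sq : size q = n.
  rewrite -[RHS]card_ord -(card_uniqP uq); apply: eq_card => i.
  by rewrite mem_cat mem_filter mem_enum !inE andbT orbN.
have fI : injective (fun i : J => nth ord0 q i).
  by move=> i j /eqP; rewrite nth_uniq ?sq // => /eqP /val_inj.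
pose s := perm fI.
exists ([ffun i => odd_perm s && (i == ord_max)], s); split.
  rewrite /even /= (bigD1 ord_max) //= ffunE eqxx andbT big1 ?addbF // => i im.
  by rewrite ffunE (negbTE im) andbF.
move=> k kt; have kn : k < n.
  by rewrite -sq size_cat (leq_trans kt) // leq_addr.
split; first by rewrite /= permE val_jj // nth_cat kt.
move=> kn1; rewrite ffunE (_ : _ == _ = false) ?andbF //.
by apply/negbTE; rewrite -val_eqE /= val_jj // neq_ltn kn1.
Qed.

(** The signed permutations of U' and V'. *)
Definition spu : sp := tr (jj 0) (jj 1).
Definition spv : sp := ([ffun i : J => (i == n.-1 :> nat) && odd n.+1], perm (@ordS_inj n)).

Lemma even_spu : even spu.
Proof. by apply: even_tr; rewrite jj_eq. Qed.

Lemma spv_next (k : nat) : k.+1 < n -> spv.2 (jj k) = jj k.+1 /\ spv.1 (jj k) = false.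
Proof.
move=> kn; have kn' := ltnW kn; split.
  rewrite /= permE; apply: val_inj; rewrite /= !val_jj // modn_small //.
by rewrite ffunE val_jj // (ltn_eqF _) // -ltnS.
Qed.

(** The underlying permutation is a single cycle, so it has the sign (-1)^(n+1) that
  is put on the last basis vector. *)
Lemma even_spv : even spv.
Proof.
have full : porbit spv.2 ord0 = [set: J].
  apply/setP => i; rewrite inE; apply/porbitP; exists i.
  have : i < n by [].
  rewrite -{2}(jjK i); elim: (val i) => [|k IH] kn.
    by rewrite expg0 perm1; apply: val_inj; rewrite /= val_jj.
  by rewrite expgSr permM -IH ?(ltnW kn) //; have [] := spv_next kn.
have pv : porbits spv.2 = [set [set: J]].
  apply/setP => A; rewrite inE; apply/imsetP/eqP => [[i _ ->]|->]; last by exists ord0.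
  by rewrite -full; apply/eqP; rewrite eq_porbit_mem full inE.
rewrite /even; have -> : odd_perm spv.2 = odd n.+1 by rewrite /odd_perm pv cards1 card_ord addbT.
rewrite (bigD1 ord_max) //= ffunE eqxx /= big1 ?addbF // => i im.
rewrite ffunE (_ : (i == n.-1 :> nat) = false) //.
by apply: contraNF im => /eqP e; apply/eqP/val_inj.
Qed.

End SignedPerm.

(** * Presentations *)

Section Presentations.
Variables (H G : groupType) (k : nat) (x : k.-tuple H) (R : set (free_group 'I_k)).

Lemma free_lift1 (L : groupType) (f : 'I_k -> L) : free_lift f 1 = 1.
Proof. by apply: (mulgI (free_lift f 1)); rewrite -free_liftM !mulg1. Qed.

Lemma free_liftV (L : groupType) (f : 'I_k -> L) w : free_lift f w^-1 = (free_lift f w)^-1.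
Proof. by apply/esym/mulg1_eq; rewrite -free_liftM mulgV free_lift1. Qed.

Lemma kernel_normal (L : groupType) (f : 'I_k -> L) :
  normal_subgroup [set w | free_lift f w = 1]%classic.
Proof.
split=> [|u v|u|u v] /=; first exact: free_lift1.
- by rewrite free_liftM => -> ->; rewrite mulg1.
- by rewrite free_liftV => ->; rewrite invg1.
- by rewrite conjgE !free_liftM free_liftV => ->; rewrite mul1g mulVg.
Qed.

Lemma presents_kernel : presents x R -> forall w, R w -> free_lift (tnth x) w = 1.
Proof.
move=> pR w Rw; have := sub_normal_closure Rw.
by rewrite /presents in pR; rewrite pR.
Qed.

(** Elements satisfying the defining relators are the image of the presented
  generators under a map that is multiplicative on the group they generate. *)
Lemma presents_map (y : k.-tuple G) : presents x R ->
  (forall w, R w -> free_lift (tnth y) w = 1) ->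
  exists f : H -> G, forall w, f (free_lift (tnth x) w) = free_lift (tnth y) w.
Proof.
move=> pR Ry.
have ker w : free_lift (tnth x) w = 1 -> free_lift (tnth y) w = 1.
  move=> xw; have cw : normal_closure R w by rewrite /presents in pR; rewrite pR.
  by apply: (cw _ (kernel_normal (tnth y))) => u; apply: Ry.
pose P z u := forall w, free_lift (tnth x) w = z -> free_lift (tnth y) w = u.
have : forall z, exists u, P z u.
  move=> z; have [[w0 <-]|no] := pselect (exists w, free_lift (tnth x) w = z).
    exists (free_lift (tnth y) w0) => w e; apply/eqP; rewrite -divg_eq1 -free_liftV -free_liftM.
    by apply/eqP/ker; rewrite free_liftM free_liftV e mulgV.
  by exists 1 => w e; case: no; exists w.
by case/boolp.choice => f fP; exists f => w; rewrite (fP _ w erefl).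
Qed.

End Presentations.

Section SignedPermPresentation.
Variables (r : nat) (G H : groupType) (m : sp r -> H) (R : set (free_group 'I_2)).
Hypothesis m1 : m (sp1 r) = 1.
Hypothesis mM : forall a b, m (spM a b) = m a * m b.
Local Notation spu := (spu r).
Local Notation spv := (spv r).

(** The two generators and the signed transpositions that they conjugate into
  each other generate all the signed permutations of determinant 1. *)
Lemma sp_gen (P : sp r -> Prop) : P (sp1 r) ->
  (forall a b, even a -> even b -> P a -> P b -> P (spM a b)) ->
  (forall a b c, even a -> even b -> even c -> P a -> P b -> spM a c = spM b a -> P c) ->
  P spu -> P spv -> forall a, even a -> P a.
Proof.
move=> P1 PM PC Pu Pv a ea.
apply: (@sp_ind r xpredT) => // k l b _ _ kl eb Pb; apply: (PM) => //; first exact: even_tr.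
apply: (@tr_all r P 0) => // j _ jn; exists spv.
have [h1 h2] := spv_next (ltnW jn); have [h3 h4] := spv_next jn.
by rewrite h1 h2 h3 h4 even_spv.
Qed.

Lemma sp_map (U V : G) : presents [tuple m spu; m spv] R ->
  (forall w, R w -> free_lift (tnth [tuple U; V]) w = 1) ->
  exists T : sp r -> G, [/\ T spu = U, T spv = V &
    forall a b, even a -> even b -> T (spM a b) = T a * T b].
Proof.
move=> pR RUV; have [f fP] := presents_map pR RUV.
pose im a := exists w, free_lift (tnth [tuple m spu; m spv]) w = m a.
have imu : im spu by exists (gen ord0); rewrite free_lift_gen (tnth_nth 1).
have imv : im spv by exists (gen (lift ord0 ord0)); rewrite free_lift_gen (tnth_nth 1).
have imE a : even a -> im a.
  apply: sp_gen => //.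
  - by exists 1; rewrite free_lift1.
  - by move=> b c _ _ [w e] [w' e']; exists (w * w'); rewrite free_liftM e e' mM.
  - move=> b c d _ _ _ [w e] [w' e'] E; exists (w^-1 * w' * w).
    rewrite !free_liftM free_liftV e e'; apply: (mulgI (m b)).
    by rewrite -mM E mM !mulgA mulgV mul1g.
exists (f \o m); split=> /=.
- have := fP (gen ord0); rewrite !free_lift_gen !(tnth_nth 1) //.
- have := fP (gen (lift ord0 ord0)); rewrite !free_lift_gen !(tnth_nth 1) //.
move=> a b /imE[w e] /imE[w' e'].
by rewrite mM -e -e' -free_liftM !fP free_liftM.
Qed.

End SignedPermPresentation.

(** * Root elements in the presented group *)

Section Sat.
Variable r : nat.
Local Notation J := 'I_(r.+3).
Implicit Types (i j k : J) (a b : sp r).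

Definition sat a i j (s : bool) := a.2 i = j /\ a.1 i = s.

Lemma satM a b i j k s t : sat a i j s -> sat b j k t -> sat (spM a b) i k (s (+) t).
Proof. by move=> [<- <-] [<- <-]; split; rewrite /= ?permM // ffunE. Qed.

Lemma satV a i j s : sat a i j s -> sat (spV a) j i s.
Proof. by move=> [<- <-]; split; rewrite /= ?permK // ffunE permK. Qed.

Lemma sat_tr1 i j : i != j -> sat (tr i j) i j false.
Proof. by move=> ij; split; rewrite /= ?tpermL // ffunE (negbTE ij). Qed.

Lemma sat_tr2 i j : sat (tr i j) j i true.
Proof. by split; rewrite /= ?tpermR // ffunE eqxx. Qed.

Lemma sat_tr3 i j k : k != i -> k != j -> sat (tr i j) k k false.
Proof. by move=> ki kj; split; rewrite /= ?ffunE ?(negbTE kj) // tpermD // eq_sym. Qed.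

Lemma sat_v (k : nat) : k.+1 < r.+3 -> sat (spv r) (jj r k) (jj r k.+1) false.
Proof. exact: spv_next. Qed.

Lemma satE a i : sat a i (a.2 i) (a.1 i). Proof. by []. Qed.

End Sat.

(** The group G stands for the presented group: T for the signed permutations in it,
  psi for the copy of SL(2, p), and rho for the action on the natural module.  The
  planes j0, j1, ... are those of e_1, e_2, ... *)
Section Core.
Variable r : nat.
Local Notation n := r.+3.
Local Notation J := 'I_n.
Variables (N : nat) (pr : 'I_N -> J) (od : 'I_N -> bool) (ef : J -> bool -> 'I_N).
Hypothesis pr_ef : forall a b, pr (ef a b) = a.
Hypothesis od_ef : forall a b, od (ef a b) = b.
Hypothesis efK : forall i, ef (pr i) (od i) = i.
Local Notation I := 'I_N.
Local Notation neg := (neg pr od ef).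
Local Notation dis := (apart neg).

Variable F : fieldType.
Hypothesis two_neq0 : (2%:R != 0 :> F)%R.
Hypothesis prime_field : forall t : F, exists k : nat, t = (k%:R)%R.
Local Notation e i := (delta_mx (0 : 'I_1)%R i : 'rV[F]_N).
Local Notation phimx := (@levi_mx F N neg).

Variables (G : groupType) (S Z U V : G).
Variables (T : sp r -> G) (psi : F -> F -> F -> F -> G) (rho : G -> 'M[F]_N).
Implicit Types (i j k l : J) (x y z w : I) (a b c : sp r) (g h : G).

Local Notation j0 := (jj r 0).
Local Notation j1 := (jj r 1).
Local Notation j2 := (jj r 2).
Local Notation j3 := (jj r 3).
Local Notation spu := (spu r).
Local Notation spv := (spv r).
Local Notation x0 := (ef j0 false).
Local Notation x1 := (ef j1 false).
Local Notation x2 := (ef j2 false).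
Local Notation x3 := (ef j3 false).

Hypothesis T_u : T spu = U.
Hypothesis T_v : T spv = V.
Hypothesis TM : forall a b, even a -> even b -> T (spM a b) = T a * T b.
Hypothesis psiM : forall a b c d a' b' c' d' : F,
  (a * d - b * c = 1)%R -> (a' * d' - b' * c' = 1)%R ->
  psi a b c d * psi a' b' c' d' =
  psi (a * a' + b * c')%R (a * b' + b * d')%R (c * a' + d * c')%R (c * b' + d * d')%R.
Hypothesis psi_S : psi 1%R 1%R 0%R 1%R = S.
Hypothesis psi_U : psi 0%R 1%R (-1)%R 0%R = U.
Hypothesis rel_i : forall g, relator_i n Z U V g -> g = 1.
Hypothesis rel_ii : forall g, relator_ii n S Z U V g -> g = 1.
Hypothesis rel_iv : forall g, relator_iv n S Z U V g -> g = 1.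
Hypothesis rho1 : rho 1 = 1%:M%R.
Hypothesis rhoM : forall g h, rho (g * h) = (rho g *m rho h)%R.
Hypothesis rho_T : forall a i (b : bool), even a ->
  (e (ef i b) *m rho (T a) = (-1) ^+ (a.1 i) *: e (ef (a.2 i) b))%R.
Hypothesis rho_Z : forall i (b : bool),
  (e (ef i b) *m rho Z = e (ef i (b (+) ((i == j0) || (i == j1)))))%R.
Hypothesis rho_psi : forall a b c d : F, (a * d - b * c = 1)%R ->
  rho (psi a b c d) = phimx x0 x1 a b c d.

Let nK := negK pr_ef od_ef efK.
Let nn := neg_neq pr_ef od_ef efK.

Lemma commE g h : [~ g, h] = 1 -> commute g h.
Proof. by move/eqP/commgP. Qed.

Let ev_u : even spu := even_spu r.
Let ev_v : even spv := even_spv r.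

Lemma j01 : j0 != j1. Proof. by rewrite jj_eq. Qed.
Lemma j02 : j0 != j2. Proof. by rewrite jj_eq. Qed.
Lemma j12 : j1 != j2. Proof. by rewrite jj_eq. Qed.

Lemma ge2E i : (2 <= i) = (i != j0) && (i != j1).
Proof.
by rewrite -(jjK i) val_jj // !jj_eq //; case: (val i) => [|[|k]].
Qed.

Lemma T1 : T (sp1 r) = 1.
Proof. by apply: (mulgI (T (sp1 r))); rewrite -TM ?even1 // spM1 mulg1. Qed.

Lemma TV a : even a -> T (spV a) = (T a)^-1.
Proof. by move=> ea; apply/esym/mulg1_eq; rewrite -TM ?evenV // spMV T1. Qed.

(** ** Centralisers in the group of signed permutations *)

(** The relations state that an element X is centralised by two signed permutations
  fixing the first two basis vectors; they generate all of these that have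
  determinant 1. *)
Section Centraliser.
Variable X : G.
Hypothesis X23 : 3 < n -> commute X (T (tr j2 j3)).
Hypothesis Xcyc : 4 < n -> exists c, [/\ even c, commute X (T c) &
  forall k : nat, 2 <= k -> k.+1 < n -> sat c (jj r k) (jj r k.+1) false].

Lemma cent_tr i j : 2 <= i -> 2 <= j -> i != j -> commute X (T (tr i j)).
Proof.
apply: (@tr_all r (fun a => commute X (T a))).
- by move=> a b ea eb ca cb; rewrite TM //; apply: commuteM.
- move=> a b c ea eb ec ca cb E; rewrite (_ : T c = (T a)^-1 * T b * T a).
    by apply: commuteM => //; apply: commuteM => //; apply: commuteV.
  by rewrite -mulgA -TM // -E TM // mulKg.
- exact: X23.
- move=> k lk kn; have [|c [ec cc sc]] := Xcyc; first exact: leq_trans kn.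
  have [h1 h2] := sc k lk (ltnW kn); have [h3 h4] := sc k.+1 (leqW lk) kn.
  by exists c; rewrite h1 h2 h3 h4.
Qed.

Lemma cent_fix a : even a -> sat a j0 j0 false -> sat a j1 j1 false -> commute X (T a).
Proof.
move=> ea [p0 s0] [p1 s1].
apply: (@sp_ind r (fun i => 2 <= i) (fun a => commute X (T a))) => //.
- by rewrite T1; apply: commute1.
- move=> i j b Di Dj ij eb cb; rewrite TM ?even_tr //.
  by apply: commuteM => //; apply: cent_tr.
- by move=> i; rewrite ge2E negb_and !negbK => /orP[]/eqP->.
Qed.

End Centraliser.

Lemma sat_u (k : nat) : 2 <= k -> k < n -> sat spu (jj r k) (jj r k) false.
Proof. by move=> k2 kn; apply: sat_tr3; rewrite jj_eq //; case: k k2 kn => [|[]]. Qed.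

Lemma T_tr12 : T (tr j1 j2) = U ^ V.
Proof.
have [p0 s0] := @sat_v r 0 isT; have [p1 s1] := @sat_v r 1 isT.
apply: (mulgI V); rewrite conjgE mulVKg -T_u -T_v -!TM ?even_tr ?j01 ?j12 //.
by have := @tr_conj r spv j0 j1 j01; rewrite s0 s1 p0 p1 => ->.
Qed.

Lemma T_tr23 : 3 < n -> T (tr j2 j3) = U ^ (V ^+ 2).
Proof.
move=> n3; have n2 : 2 < n by [].
have [p1 s1] := @sat_v r 1 isT; have [p2 s2] := @sat_v r 2 n3.
rewrite expg2 conjgM -T_tr12.
have j23 : j2 != j3 by rewrite jj_eq.
apply: (mulgI V); rewrite conjgE mulVKg -T_v -!TM ?even_tr ?j12 //.
by have := @tr_conj r spv j1 j2 j12; rewrite s1 s2 p1 p2 => ->.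
Qed.

Lemma cyc_sat (f : sp r) (k : nat) : 2 <= k -> k.+1 < n ->
  (forall l : nat, 2 <= l -> l < n -> sat f (jj r l) (jj r l) false) ->
  sat (spM (spM spv f) (spM (spV spv) (spM f spv))) (jj r k) (jj r k.+1) false.
Proof.
move=> k2 kn ff; have sv := sat_v kn.
have := satM (satM sv (ff _ (leqW k2) kn))
  (satM (satV sv) (satM (ff _ k2 (ltnW kn)) sv)).
by [].
Qed.

Let S23 : 3 < n -> commute S (T (tr j2 j3)).
Proof. by move=> n3; rewrite T_tr23 //; apply/commE/rel_ii; apply: rel_ii_1. Qed.

Let Scyc : 4 < n -> exists c, [/\ even c, commute S (T c) &
  forall k : nat, 2 <= k -> k.+1 < n -> sat c (jj r k) (jj r k.+1) false].
Proof.
move=> n4; exists (spM (spM spv (spV spu)) (spM (spV spv) (spM (spV spu) spv))).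
have [eu ev] : even (spV spu) /\ even (spV spv) by rewrite !evenV.
split; first by rewrite !evenM.
- rewrite !TM ?TV ?evenM // T_u T_v; apply/commE/rel_ii; exact: rel_ii_2.
- move=> k k2 kn; apply: cyc_sat => // l l2 ln; exact: satV (sat_u l2 ln).
Qed.

Let Z23 : 3 < n -> commute Z (T (tr j2 j3)).
Proof. by move=> n3; rewrite T_tr23 //; apply/commE/rel_i; apply: rel_i_1. Qed.

Let Zcyc : 4 < n -> exists c, [/\ even c, commute Z (T c) &
  forall k : nat, 2 <= k -> k.+1 < n -> sat c (jj r k) (jj r k.+1) false].
Proof.
move=> n4; exists (spM (spM spv spu) (spM (spV spv) (spM spu spv))).
have ev := evenV ev_v.
split; first by rewrite !evenM.
- rewrite !TM ?TV ?evenM // T_u T_v; apply/commE/rel_i; exact: rel_i_2.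
- by move=> k k2 kn; apply: cyc_sat => // l l2 ln; apply: sat_u.
Qed.

(** The square of the first generator negates the first two basis vectors. *)
Definition uu : sp r := spM spu spu.
Definition ww : sp r := spM (tr j1 j2) (tr j1 j2).

Lemma even_uu : even uu. Proof. exact: evenM. Qed.
Lemma even_ww : even ww. Proof. by apply: evenM; apply: even_tr j12. Qed.

Lemma uu0 : sat uu j0 j0 true.
Proof. exact: satM (sat_tr1 j01) (sat_tr2 _ _). Qed.
Lemma uu1 : sat uu j1 j1 true.
Proof. exact: satM (sat_tr2 _ _) (sat_tr1 j01). Qed.
Lemma ww0 : sat ww j0 j0 false.
Proof. by have f := sat_tr3 j01 j02; exact: (satM f f). Qed.
Lemma ww1 : sat ww j1 j1 true.
Proof. exact: satM (sat_tr1 j12) (sat_tr2 _ _). Qed.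
Lemma T_uu : T uu = U ^+ 2.
Proof. by rewrite /uu TM // T_u. Qed.

Lemma psi_UU : psi (-1)%R 0%R 0%R (-1)%R = U ^+ 2.
Proof.
rewrite expg2 -psi_U psiM; try by ring.
by congr (psi _ _ _ _); ring.
Qed.

Lemma psi_central (a b c d : F) : (a * d - b * c = 1)%R -> commute (psi a b c d) (U ^+ 2).
Proof.
move=> det; rewrite -psi_UU /commute !psiM //; try by ring.
by congr (psi _ _ _ _); ring.
Qed.

Lemma S_UU : commute S (U ^+ 2).
Proof. by rewrite -psi_S; apply: psi_central; ring. Qed.

Lemma cancel_commute X g h : commute X g -> commute X (g * h) -> commute X h.
Proof. by move=> cg cgh; rewrite -(mulKg g h); apply: commuteM => //; apply: commuteV. Qed.

(** As U'^2 is the central element of SL2, it centralises S as well. *)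
Lemma CS a s : even a -> sat a j0 j0 s -> sat a j1 j1 s -> commute S (T a).
Proof.
case: s => ea s0 s1; last exact: (cent_fix S23 Scyc).
apply: (cancel_commute S_UU); rewrite -T_uu -TM ?even_uu //.
apply: (cent_fix S23 Scyc); first exact: evenM even_uu ea.
  exact: satM uu0 s0.
exact: satM uu1 s1.
Qed.

(** Z depends on the unordered pair of the first two planes only. *)
Lemma CZ a : even a -> (a.2 j0 == j0) && (a.2 j1 == j1) || (a.2 j0 == j1) && (a.2 j1 == j0) ->
  commute Z (T a).
Proof.
have cU : commute Z U by apply/commE/rel_i; apply: rel_i_6.
have cuu : commute Z (T uu) by rewrite T_uu; apply: commuteX.
have cww : commute Z (T ww).
  by rewrite TM ?even_tr ?j12 // T_tr12 -conjMg -expg2; apply/commE/rel_i; apply: rel_i_4.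
have fixed b s t : even b -> sat b j0 j0 s -> sat b j1 j1 t -> commute Z (T b).
  have euu := even_uu; have eww := even_ww.
  case: s t => [] [] eb s0 s1; last exact: (cent_fix Z23 Zcyc).
  - apply: (cancel_commute cuu); rewrite -TM //.
    apply: (cent_fix Z23 Zcyc); first exact: evenM.
      exact: satM uu0 s0.
    exact: satM uu1 s1.
  - apply: (cancel_commute cuu); apply: (cancel_commute cww); rewrite -!TM //; try exact: (evenM euu eb).
    apply: (cent_fix Z23 Zcyc); first exact: (evenM eww (evenM euu eb)).
      exact: satM ww0 (satM uu0 s0).
    exact: satM ww1 (satM uu1 s1).
  - apply: (cancel_commute cww); rewrite -!TM //.
    apply: (cent_fix Z23 Zcyc); first exact: (evenM eww eb).
      exact: satM ww0 s0.
    exact: satM ww1 s1.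
move=> ea /orP[/andP[/eqP p0 /eqP p1]|/andP[/eqP p0 /eqP p1]].
  exact: (fixed a (a.1 j0) (a.1 j1)).
apply: (cancel_commute cU); rewrite -T_u -TM //.
have [q0 t0] := satM (sat_tr1 j01) (satE a j1); have [q1 t1] := satM (sat_tr2 j0 j1) (satE a j0).
by apply: (fixed _ _ _ (evenM ev_u ea)); split; rewrite ?q0 ?q1.
Qed.

(** ** The conjugates of Z *)

Lemma lift2_ex i j : exists a, i != j -> [/\ even a, a.2 j0 = i & a.2 j1 = j].
Proof.
have [ij|] := boolP (i != j); last by exists (sp1 r).
have [|a [ea aP]] := @sp_extend r [:: i; j]; first by rewrite /= inE ij.
have [h0 _] := aP 0 isT; have [h1 _] := aP 1%N isT.
by exists a.
Qed.

Definition lift2 i j : sp r := projT1 (cid (lift2_ex i j)).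

Lemma lift2P i j : i != j ->
  [/\ even (lift2 i j), (lift2 i j).2 j0 = i & (lift2 i j).2 j1 = j].
Proof. by rewrite /lift2; case: cid. Qed.

(** The interchange of the basis vectors in each of the planes i and j. *)
Definition Zc i j : G := Z ^ T (lift2 i j).

Lemma Z_conj a b : even a -> even b ->
  (a.2 j0 == b.2 j0) && (a.2 j1 == b.2 j1) || (a.2 j0 == b.2 j1) && (a.2 j1 == b.2 j0) ->
  Z ^ T a = Z ^ T b.
Proof.
move=> ea eb ab; have eab : even (spM a (spV b)) by rewrite evenM ?evenV.
have : commute Z (T (spM a (spV b))).
  apply: CZ => //; rewrite /= !permM.
  by case/orP: ab => /andP[/eqP-> /eqP->]; rewrite !permK !eqxx ?orbT.
move/commgP/conjg_fixP; rewrite TM ?evenV // TV // conjgM => E.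
by rewrite -[in RHS]E conjgKV.
Qed.

Lemma Zc_T a : even a -> Z ^ T a = Zc (a.2 j0) (a.2 j1).
Proof.
move=> ea; have ne : a.2 j0 != a.2 j1 by rewrite (inj_eq perm_inj) j01.
by have [eb b0 b1] := lift2P ne; apply: Z_conj; rewrite // b0 b1 !eqxx.
Qed.

Lemma Zc_sym i j : i != j -> Zc i j = Zc j i.
Proof.
move=> ij; have [eb b0 b1] := lift2P ij; have [|ec c0 c1] := @lift2P j i; first by rewrite eq_sym.
by apply: Z_conj; rewrite // b0 b1 c0 c1 !eqxx orbT.
Qed.

Lemma Zc_conj a i j : even a -> i != j -> Zc i j ^ T a = Zc (a.2 i) (a.2 j).
Proof.
move=> ea ij; have [eb b0 b1] := lift2P ij.
by rewrite /Zc -conjgM -TM // Zc_T ?evenM //= !permM b0 b1.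
Qed.

Lemma Zc01 : Zc j0 j1 = Z.
Proof. by have := Zc_T (even1 r); rewrite T1 conjg1 /= !perm1. Qed.

Lemma lift3_ex i j k : uniq [:: i; j; k] -> exists a, [/\ even a,
  sat a j0 i false, sat a j1 j false & a.2 j2 = k].
Proof.
move=> /sp_extend [a [ea aP]]; exists a; split=> //.
- by have [h0 s0] := aP 0 isT; split=> //; apply: s0.
- by have [h1 s1] := aP 1%N isT; split=> //; apply: s1.
- by have [h2 s2] := aP 2 isT.
Qed.

Lemma lift4_ex i j k l : uniq [:: i; j; k; l] -> exists a, [/\ even a,
  sat a j0 i false, sat a j1 j false, sat a j2 k false & a.2 j3 = l].
Proof.
move=> u; have n3 : 3 < n.
  by have := max_card [in [:: i; j; k; l]]; rewrite card_ord; move/card_uniqP: u => ->.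
have [a [ea aP]] := sp_extend u; exists a; split=> //.
- by have [h0 s0] := aP 0 isT; split=> //; apply: s0.
- by have [h1 s1] := aP 1%N isT; split=> //; apply: s1.
- by have [h2 s2] := aP 2 isT; split=> //; apply: s2.
- by have [h2 s2] := aP 3 isT.
Qed.

Lemma v012 : [/\ spv.2 j0 = j1, spv.2 j1 = j2 & 3 < n -> spv.2 j2 = j3].
Proof.
have [p0 _] := @sat_v r 0 isT; have [p1 _] := @sat_v r 1 isT; split=> // n3.
by have [] := @sat_v r 2 n3.
Qed.

Lemma u012 : [/\ spu.2 j0 = j1, spu.2 j1 = j0 & spu.2 j2 = j2].
Proof. by rewrite /= tpermL tpermR tpermD ?j02 ?j12. Qed.

Lemma Zc12 : Zc j1 j2 = Z ^ V.
Proof. by have [v0 v1 _] := v012; rewrite -T_v Zc_T // v0 v1. Qed.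

Lemma Zc02 : Zc j0 j2 = Z ^ (V * U).
Proof.
have [v0 v1 _] := v012; have [u0 u1 u2] := u012.
by rewrite -T_v -T_u -TM // Zc_T ?evenM //= !permM v0 v1 u1 u2.
Qed.

Lemma Zc23 : 3 < n -> Zc j2 j3 = Z ^ (V ^+ 2).
Proof.
move=> n3; have [v0 v1 v2] := v012.
by rewrite expg2 -T_v -TM // Zc_T ?evenM //= !permM v0 v1 v2.
Qed.

(** By transitivity on triples this is the relation for the first three planes. *)
Lemma ZcM i j k : uniq [:: i; j; k] -> Zc i j * Zc j k = Zc i k.
Proof.
move=> u; have [a [ea [<- _] [<- _] <-]] := lift3_ex u.
rewrite -!Zc_conj ?j01 ?j02 ?j12 // -conjMg; congr (_ ^ _).
by rewrite Zc01 Zc12 Zc02; apply/divg1_eq/rel_i; apply: rel_i_5.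
Qed.

Lemma Zc_invol i j : i != j -> Zc i j * Zc i j = 1.
Proof.
move=> ij; have [ea a0 a1] := lift2P ij.
rewrite /Zc -conjMg -expg2 (_ : Z ^+ 2 = 1) ?conj1g //.
by apply: rel_i; apply: rel_i_3.
Qed.

Lemma ZcC i j k l : i != j -> k != l -> commute (Zc i j) (Zc k l).
Proof.
have chain i' j' k' : uniq [:: i'; j'; k'] -> commute (Zc i' j') (Zc j' k').
  move=> /lift3_ex [a [ea [<- _] [<- _] <-]].
  rewrite -!Zc_conj ?j01 ?j12 // /commute -!conjMg; congr (_ ^ _).
  by rewrite Zc01 Zc12; apply/commE/rel_i; apply: rel_i_7.
move=> ij kl; case: (eqVneq k j) kl => [->|kj] kl.
  case: (eqVneq l i) => [->|li]; first by rewrite Zc_sym // 1?eq_sym.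
  by apply: chain; rewrite /= !inE negb_or ij kl eq_sym li.
case: (eqVneq k i) kl => [->|ki] kl.
  case: (eqVneq l j) => [->|lj]; first by [].
  by rewrite Zc_sym //; apply: chain; rewrite /= !inE negb_or eq_sym ij kl eq_sym lj.
case: (eqVneq l j) kl => [->|lj] kl.
  by rewrite (Zc_sym kl); apply: chain; rewrite /= !inE negb_or ij eq_sym ki eq_sym kj.
case: (eqVneq l i) kl => [->|li] kl.
  rewrite (Zc_sym kl) (Zc_sym ij); apply: chain.
  by rewrite /= !inE negb_or eq_sym ij eq_sym kj eq_sym ki.
have u : uniq [:: i; j; k; l].
  by rewrite /= !inE !negb_or ij kl eq_sym ki eq_sym li eq_sym kj eq_sym lj.
have [a [ea [<- _] [<- _] [<- _] <-]] := lift4_ex u.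
have n3 : 3 < n by have := max_card [in [:: i; j; k; l]]; rewrite card_ord; move/card_uniqP: u => ->.
have j23 : j2 != j3 by rewrite jj_eq.
rewrite -!Zc_conj ?j01 // /commute -!conjMg; congr (_ ^ _).
by rewrite Zc01 Zc23 //; apply/commE/rel_i; apply: rel_i_8.
Qed.

Lemma rho_Zc i j k (b : bool) : i != j ->
  (e (ef k b) *m rho (Zc i j) = e (ef k (b (+) ((k == i) || (k == j)))))%R.
Proof.
move=> ij; have := lift2P ij; rewrite /Zc; move: (lift2 i j) => a [ea a0 a1].
rewrite conjgE -TV // !rhoM !mulmxA rho_T ?evenV //= ffunE -!scalemxAl rho_Z.
rewrite rho_T // permKV scalerA -signr_addb addbb scale1r; congr (e (ef _ (_ (+) (_ || _)))).
  by rewrite -a0 (can2_eq (permKV _) (permK _)).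
by rewrite -a1 (can2_eq (permKV _) (permK _)).
Qed.

Definition Zg := spanned (fun g => exists i j, i != j /\ g = Zc i j).

Lemma Zg_c i j : i != j -> Zg (Zc i j).
Proof. by move=> ij; apply: spanned_in; exists i, j. Qed.

Lemma Zg_comm g h : Zg g -> Zg h -> commute g h.
Proof.
elim=> [|g1 g2 _ IH [i [j [ij ->]]]] Zh; first exact/commute_sym/commute1.
apply/commute_sym/commuteM; first exact/commute_sym/IH.
elim: Zh => [|h1 h2 _ IH' [k [l [kl ->]]]]; first exact/commute_sym/commute1.
by apply/commute_sym/commuteM; [exact/commute_sym/IH' | apply: ZcC].
Qed.

Lemma ZgV g : Zg g -> Zg g^-1.
Proof.
apply: spannedV => _ [i [j [ij ->]]]; exists i, j; split=> //.
by apply: mulg1_eq; apply: Zc_invol.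
Qed.

Lemma Zg_conj a g : even a -> Zg g -> Zg (g ^ T a).
Proof.
move=> ea; apply: spanned_conj => [||_ [i [j [ij ->]]]].
- exact: spanned1.
- exact: spannedM.
- by rewrite Zc_conj //; apply: Zg_c; rewrite (inj_eq perm_inj).
Qed.

Definition fix01 g := forall b : bool,
  (e (ef j0 b) *m rho g = e (ef j0 b))%R /\ (e (ef j1 b) *m rho g = e (ef j1 b))%R.

(** By transitivity on quadruples this is the relation for the first four planes. *)
Lemma Zc_S i j : 2 <= i -> 2 <= j -> i != j -> commute S (Zc i j).
Proof.
rewrite !ge2E => /andP[i0 i1] /andP[jn0 jn1] ij.
have u : uniq [:: j0; j1; i; j].
  by rewrite /= !inE !negb_or ij j01 eq_sym i0 eq_sym jn0 eq_sym i1 eq_sym jn1.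
have n3 : 3 < n by have := max_card [in [:: j0; j1; i; j]]; rewrite card_ord; move/card_uniqP: u => ->.
have [a [ea s0 s1 [<- _] <-]] := lift4_ex u.
have j23 : j2 != j3 by rewrite jj_eq.
have cS : S ^ T a = S by apply/conjg_fixP/commgP; apply: CS s0 s1.
rewrite -Zc_conj // -cS /commute -!conjMg; congr (_ ^ _).
by rewrite Zc23 //; apply/commE/rel_ii; apply: rel_ii_3.
Qed.

(** Every product of conjugates of Z is, up to an element centralising S, one of
  the four products of Zc j0 j2 and Zc j1 j2: so it is the interchanges at the first
  two planes that decide how it acts on S. *)
Lemma Zg_nf g : Zg g -> exists (s t : bool) h, [/\ commute S h, fix01 h, Zg h &
  g = Zc j0 j2 ^+ s * Zc j1 j2 ^+ t * h].
Proof.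
have nf1 : fix01 1 by move=> b; rewrite rho1 !mulmx1.
have nfc i j : 2 <= i -> 2 <= j -> i != j -> fix01 (Zc i j).
  rewrite !ge2E => /andP[i0 i1] /andP[jn0 jn1] ij b; rewrite !rho_Zc //.
  by rewrite ![_ == i]eq_sym ![_ == j]eq_sym (negbTE i0) (negbTE i1) (negbTE jn0) (negbTE jn1) addbF.
have j2ge : 2 <= j2 by rewrite val_jj.
pose P g0 := exists (s t : bool) h, [/\ commute S h, fix01 h, Zg h &
  g0 = Zc j0 j2 ^+ s * Zc j1 j2 ^+ t * h].
have base i j : i != j -> P (Zc i j).
  have P0 j' : j' != j0 -> P (Zc j0 j').
    case: (eqVneq j' j1) => [->|jn1] jn0.
      exists true, true, 1; split=> //; [exact: commute1|exact: spanned1|].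
      by rewrite mulg1 (Zc_sym j12) ZcM //= !inE negb_or j02 j01 eq_sym j12.
    case: (eqVneq j' j2) => [->|jn2].
      by exists true, false, 1; split=> //; rewrite ?mulg1 //; [exact: commute1|exact: spanned1].
    have jj' : 2 <= j' by rewrite ge2E jn0.
    have ne : j2 != j' by rewrite eq_sym.
    exists true, false, (Zc j2 j'); split; [exact: Zc_S|exact: nfc|exact: Zg_c|].
    by rewrite mulg1 ZcM //= !inE negb_or j02 eq_sym jn0 eq_sym jn2.
  have P1 j' : j' != j1 -> P (Zc j1 j').
    case: (eqVneq j' j0) => [->|jn0] jn1.
      by rewrite Zc_sym // 1?eq_sym //; apply: P0; rewrite eq_sym.
    case: (eqVneq j' j2) => [->|jn2].
      by exists false, true, 1; split=> //; rewrite ?mulg1 ?mul1g //; [exact: commute1|exact: spanned1].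
    have jj' : 2 <= j' by rewrite ge2E jn0.
    have ne : j2 != j' by rewrite eq_sym.
    exists false, true, (Zc j2 j'); split; [exact: Zc_S|exact: nfc|exact: Zg_c|].
    by rewrite mul1g ZcM //= !inE negb_or j12 eq_sym jn1 eq_sym jn2.
  move=> ij; case: (eqVneq i j0) ij => [->|i0] ij; first by apply: P0; rewrite eq_sym.
  case: (eqVneq i j1) ij => [->|i1] ij; first by apply: P1; rewrite eq_sym.
  case: (eqVneq j j0) ij => [->|jn0] ij; first by rewrite Zc_sym //; apply: P0.
  case: (eqVneq j j1) ij => [->|jn1] ij; first by rewrite Zc_sym //; apply: P1.
  have [gi gj] : 2 <= i /\ 2 <= j by rewrite !ge2E i0 i1 jn0.
  exists false, false, (Zc i j); split; [exact: Zc_S|exact: nfc|exact: Zg_c|].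
  by rewrite !mul1g.
elim=> [|g1 g2 _ [s [t [h [Sh fh Zh ->]]]] [i [j [ij ->]]]].
  by exists false, false, 1; split; rewrite ?mulg1 //; [exact: commute1|exact: spanned1].
have [s' [t' [h' [Sh' fh' Zh' ->]]]] := base i j ij.
have fm : fix01 (h * h').
  by move=> b; have [f1 f2] := fh b; have [f1' f2'] := fh' b; rewrite rhoM !mulmxA f1 f2.
set A := Zc j0 j2; set B := Zc j1 j2.
have ZA : Zg A by apply: Zg_c j02.
have ZB : Zg B by apply: Zg_c j12.
have Zb (b : bool) (x : G) : Zg x -> Zg (x ^+ b) by case: b => // _; apply: spanned1.
have Xb (x : G) (b b' : bool) : x * x = 1 -> x ^+ b * x ^+ b' = x ^+ (b (+) b').
  by case: b b' => [] [] e; rewrite ?mulg1 ?mul1g.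
exists (s (+) s'), (t (+) t'), (h * h'); split=> //; first exact: commuteM.
  exact: spannedM.
rewrite -(Xb A) ?Zc_invol ?j02 // -(Xb B) ?Zc_invol ?j12 // -!mulgA; congr (_ * _).
have cA := Zg_comm Zh (Zb s' _ ZA); have cB := Zg_comm Zh (Zb t' _ ZB).
have cBA := Zg_comm (Zb t _ ZB) (Zb s' _ ZA).
by rewrite (mulgA h) cA -mulgA (mulgA h) cB -mulgA mulgA cBA -mulgA.
Qed.

(** ** The monomial group *)

Definition Ng g := exists h a, [/\ Zg h, even a & g = h * T a].

Lemma Ng_T a : even a -> Ng (T a).
Proof. by move=> ea; exists 1, a; rewrite mul1g; split=> //; apply: spanned1. Qed.

Lemma Ng_Zg g : Zg g -> Ng g.
Proof. by move=> Zg_g; exists g, (sp1 r); rewrite T1 mulg1 even1. Qed.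

Lemma NgM g h : Ng g -> Ng h -> Ng (g * h).
Proof.
move=> [z [a [Zz ea ->]]] [z' [a' [Zz' ea' ->]]].
exists (z * z' ^ T (spV a)), (spM a a'); split; last 1 first.
- by rewrite TV // TM // conjgE invgK !mulgA mulgVK.
- by apply: spannedM => //; apply: Zg_conj; rewrite ?evenV.
- exact: evenM.
Qed.

Lemma NgV g : Ng g -> Ng g^-1.
Proof.
move=> [z [a [Zz ea ->]]].
rewrite invgM -TV //; apply: NgM; first by apply: Ng_T; apply: evenV.
by apply: Ng_Zg; apply: ZgV.
Qed.

Definition maps g x y (s : bool) := (e x *m rho g = (-1) ^+ s *: e y)%R.

Lemma mapsM g h x y z s t : maps g x y s -> maps h y z t -> maps (g * h) x z (s (+) t).
Proof.
by rewrite /maps rhoM mulmxA => -> E; rewrite -scalemxAl E scalerA signr_addb.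
Qed.

Lemma mapsV g x y s : maps g x y s -> maps g^-1 y x s.
Proof.
rewrite /maps => E; have : (e x *m rho g *m rho g^-1 = e x)%R.
  by rewrite -mulmxA -rhoM mulgV rho1 mulmx1.
by rewrite E -scalemxAl => <-; rewrite scalerA -signr_addb addbb scale1r.
Qed.

Lemma maps_uniq g x y z s t : maps g x y s -> maps g x z t -> y = z /\ s = t.
Proof.
rewrite /maps => -> E.
have sN (b : bool) : ((-1) ^+ b != 0 :> F)%R by rewrite signr_eq0.
have yz : y = z.
  apply/eqP; apply: contraNT (sN s) => yz; apply/eqP.
  by move/rowP/(_ y): E; rewrite !mxE !eqxx /= (negbTE yz) mulr1 mulr0.
split=> //; move/rowP/(_ y): E; rewrite yz !mxE !eqxx !mulr1.
have h : (1 != -1 :> F)%R by rewrite -subr_eq0 opprK.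
case: (s) (t) => [] [] //; rewrite ?expr0 ?expr1 => E2; case/eqP: h; last exact: E2.
exact: esym E2.
Qed.

Lemma maps_T a i j (b : bool) s : even a -> sat a i j s -> maps (T a) (ef i b) (ef j b) s.
Proof. by move=> ea [<- <-]; apply: rho_T. Qed.

Lemma maps_Zc i j k (b : bool) : i != j ->
  maps (Zc i j) (ef k b) (ef k (b (+) ((k == i) || (k == j)))) false.
Proof. by move=> ij; rewrite /maps rho_Zc // expr0 scale1r. Qed.

Lemma Zg_flip g : Zg g -> exists E : J -> bool,
  forall i (b : bool), maps g (ef i b) (ef i (b (+) E i)) false.
Proof.
elim=> [|g1 g2 _ [E fE] [i [j [ij ->]]]].
  by exists (fun=> false) => i b; rewrite /maps rho1 mulmx1 addbF scale1r.
exists (fun k => E k (+) ((k == i) || (k == j))) => k b.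
by rewrite addbA; apply: mapsM (fE k b) (maps_Zc _ _ ij).
Qed.

(** A monomial element acts by a signed permutation of the planes and interchanges E. *)
Lemma Ng_form g : Ng g -> exists (E : J -> bool) a,
  forall i (b : bool), maps g (ef i b) (ef (a.2 i) (b (+) E i)) (a.1 i).
Proof.
move=> [z [a [/Zg_flip[E fE] ea ->]]]; exists E, a => i b.
by apply: mapsM (fE i b) (maps_T _ ea (satE a i)).
Qed.

Lemma Ng_maps g x : Ng g -> exists y s, maps g x y s.
Proof. by move=> /Ng_form[E [a H]]; rewrite -(efK x); do 2!eexists; apply: H. Qed.

Lemma Ng_neg g x y s : Ng g -> maps g x y s -> maps g (neg x) (neg y) s.
Proof.
move=> /Ng_form[E [a H]]; rewrite -(efK x) => m.
have [<- <-] := maps_uniq (H _ _) m.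
by rewrite !(neg_ef pr_ef od_ef) -addNb; apply: H.
Qed.

(** The action determines the first two interchanges of the normal form, and these are
  trivial when e_1 and e_2 are preserved; what remains is a signed permutation. *)
Lemma NS g s : Ng g -> maps g x0 x0 s -> maps g x1 x1 s -> commute S g.
Proof.
move=> [z [a [Zz ea ->]]] m0 m1.
have [al [be [h [Sh fh Zh ez]]]] := Zg_nf Zz.
have mh : maps h x0 x0 false /\ maps h x1 x1 false.
  by rewrite /maps expr0 !scale1r; apply: fh.
have mb (b c : bool) i j k (f : bool) : i != j -> ((k == i) || (k == j)) = f ->
    maps (Zc i j ^+ b) (ef k c) (ef k (c (+) (b && f))) false.
  case: b => ij <-; first exact: maps_Zc.
  by rewrite addbF /maps rho1 mulmx1 scale1r.
have [n0 n1] : (j0 == j1) = false /\ (j0 == j2) = false by split; apply/negbTE; rewrite ?j01 ?j02.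
have [n2 n3] : (j1 == j0) = false /\ (j1 == j2) = false.
  by split; apply/negbTE; [rewrite eq_sym j01 | rewrite j12].
have fl i al' be' : maps (Zc j0 j2 ^+ al * Zc j1 j2 ^+ be) (ef i false) (ef i (al' (+) be')) false ->
    maps h (ef i false) (ef i false) false -> maps (z * T a) (ef i false) (ef i false) s ->
    al' (+) be' = false /\ sat a i i s.
  move=> mz hh mm; have Zh' : Ng h by apply: Ng_Zg.
  have hh' (c : bool) : maps h (ef i c) (ef i c) false.
    case: c => //; have := Ng_neg Zh' hh; by rewrite (neg_ef pr_ef od_ef).
  have := mapsM (mapsM mz (hh' _)) (maps_T (al' (+) be') ea (satE a i)).
  rewrite -ez => /maps_uniq/(_ mm)[E1 E2]; split; last by split; [rewrite -[LHS](pr_ef _ (al' (+) be')) E1 pr_ef | rewrite -E2].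
  by rewrite -[LHS](od_ef (a.2 i)) E1 od_ef.
have [e0 s0] : al && true (+) be && false = false /\ sat a j0 j0 s.
  apply: fl => //; last by case: mh.
  by have := mapsM (mb al false j0 j2 j0 true j02 _) (mb be _ j1 j2 j0 false j12 _);
    rewrite n0 n1 eqxx; apply.
have [e1 s1] : al && false (+) be && true = false /\ sat a j1 j1 s.
  apply: fl => //; last by case: mh.
  by have := mapsM (mb al false j0 j2 j1 false j02 _) (mb be _ j1 j2 j1 true j12 _);
    rewrite n2 n3 eqxx; apply.
rewrite !andbT !andbF ?addbF ?addFb in e0 e1.
apply: commuteM; last exact: CS s0 s1.
by rewrite ez e0 e1 !mul1g.
Qed.

Lemma S_T_eq a b i j s s' t t' : even a -> even b -> sat a j0 i s -> sat a j1 j s' ->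
  sat b j0 i t -> sat b j1 j t' -> s (+) s' = t (+) t' -> S ^ T a = S ^ T b.
Proof.
move=> ea eb a0 a1 b0 b1 st.
have c0 := satM a0 (satV b0); have c1 := satM a1 (satV b1).
have E : s (+) t = s' (+) t' by move: st; case: s t s' t' {a0 a1 b0 b1 c0 c1} => [] [] [] [].
rewrite -E in c1; have := CS (evenM ea (evenV eb)) c0 c1.
move/commgP/conjg_fixP; rewrite TM ?evenV // TV // conjgM => E'.
by rewrite -[in RHS]E' conjgKV.
Qed.

Lemma S_U : S ^ U = psi 1%R 0%R (-1)%R 1%R.
Proof.
have UV : U^-1 = psi 0%R (-1)%R 1%R 0%R.
  apply: mulg1_eq; rewrite -psi_U psiM; try by ring.
  transitivity (psi 1%R 0%R 0%R 1%R); first by congr (psi _ _ _ _); ring.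
  apply: (mulgI (psi 1%R 0%R 0%R 1%R)); rewrite mulg1 psiM; try by ring.
  by congr (psi _ _ _ _); ring.
rewrite conjgE UV -psi_U -psi_S !psiM; try by ring.
by congr (psi _ _ _ _); ring.
Qed.

Lemma U_SSS : U = S * S ^ U * S.
Proof.
rewrite S_U -psi_S -psi_U !psiM; try by ring.
by congr (psi _ _ _ _); ring.
Qed.

Lemma T_ww : T ww = U ^ V * U ^ V.
Proof. by rewrite TM ?even_tr ?j12 // T_tr12. Qed.

Lemma W02 : U ^ (V * U^-1) = T (tr j0 j2).
Proof.
have e12 := even_tr j12; have e02 := even_tr j02.
rewrite conjgM -T_tr12 -T_u -TV //.
apply: (mulgI (T (spV spu))); rewrite conjgE mulVKg -!TM ?evenV //.
have [p1 q1] := satV (sat_tr1 j01); have [p2 q2] := satV (@sat_u 2 isT isT).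
by have := @tr_conj r (spV spu) j1 j2 j12; rewrite -/spu p1 q1 p2 q2 => ->.
Qed.

(** Negating the second basis vector inverts S.  Write a, b, c for the root elements at
  the positions 12, 23, 13, so that [a, b] = c, and s for the Weyl element of 23, so
  that s = b b^s b and a^s = c, and let d = s^2 and y = a^d = c^s.  Expanding c^s by
  s = b b^s b gives y = c y c^d, as [c, b^s] = [a, b]^s = y and b commutes with c and
  d; since c^d commutes with y, it is the inverse of c.  Conjugation by s gives the
  claim for a. *)
Lemma S_inv : S ^ T ww = S^-1.
Proof.
set a := S; set b := S ^ V; set c := S ^ (V * U^-1); set s := U ^ V.
have sT : s = T (tr j1 j2) by rewrite T_tr12.
have ab : [~ a, b] = c by apply/divg1_eq/rel_iv; apply: rel_iv_a.
have ac : commute a c by apply/commE/rel_iv; apply: rel_iv_b.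
have e12 := even_tr j12; have e02 := even_tr j02.
have as_ : a ^ s = c.
  rewrite sT /c -T_u -T_v -TV // -TM ?evenV //.
  have [v0 v1] := (@sat_v r 0 isT, @sat_v r 1 isT).
  apply: (S_T_eq _ _ (sat_tr3 j01 j02) (sat_tr1 j12) (satM v0 (satV (sat_tr1 j01)))
    (satM v1 (satV (sat_u _ _)))); rewrite ?evenM ?evenV //.
have cb : commute c b.
  pose w := spM (tr j1 j2) (spM (tr j0 j2) (tr j0 j2)).
  have ew : even w by rewrite /w !evenM.
  have w0 : sat w j0 j0 true.
    exact: satM (sat_tr3 j01 j02) (satM (sat_tr1 j02) (sat_tr2 _ _)).
  have n20 : j2 != j0 by rewrite eq_sym j02.
  have n10 : j1 != j0 by rewrite eq_sym j01.
  have w1 : sat w j1 j2 true.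
    exact: satM (sat_tr1 j12) (satM (sat_tr2 j0 j2) (sat_tr1 j02)).
  have w2 : sat w j2 j1 true.
    exact: satM (sat_tr2 j1 j2) (satM (sat_tr3 n10 j12) (sat_tr3 n10 j12)).
  have H : commute S (S ^ (U ^ (V * U^-1))) by apply/commE/rel_iv; apply: rel_iv_c.
  have cw : c = S ^ T w.
    rewrite -as_ sT; apply: (S_T_eq _ _ (sat_tr3 j01 j02) (sat_tr1 j12) w0 w1) => //.
  have bw : b = (S ^ (U ^ (V * U^-1))) ^ T w.
    rewrite W02 -conjgM -TM // /b -T_v.
    have [v0 v1] := (@sat_v r 0 isT, @sat_v r 1 isT).
    by apply: (S_T_eq _ _ v0 v1 (satM (sat_tr1 j02) w2) (satM (sat_tr3 n10 j12) w1)); rewrite ?evenM.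
  by rewrite cw bw /commute -!conjMg H.
set y := c ^ s; set d := T ww.
have ds : d = s * s by rewrite /d T_ww.
have yd : y = a ^ d by rewrite ds conjgM as_.
have sb : s = b * b ^ s * b.
  by have := congr1 (fun g => g ^ V) U_SSS; rewrite /= 2!conjMg (conjJg S U V).
have cbs : [~ c, b ^ s] = y by rewrite -{1}as_ -conjRg ab.
have cB : c ^ b = c by apply/conjg_fixP/commgP.
have bd : b ^ d = b.
  rewrite ds /s -conjMg -expg2 /b -conjJg; congr (_ ^ _).
  by apply/conjg_fixP/commgP; apply: S_UU.
have yb : y ^ b = y * c ^ d.
  by rewrite yd -{1}bd -conjJg (conjg_commg a) ab conjMg.
have ysum : y = c * (y * c ^ d).
  by rewrite -yb {1}/y sb (conjgM c (b * b ^ s)) (conjgM c b) cB (conjg_commg c) cbs conjMg cB.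
have ycd : commute y (c ^ d) by rewrite yd /commute -!conjMg ac.
have cd : c ^ d = c^-1.
  apply/esym/mulg1_eq/(mulIg y); rewrite mul1g -mulgA -ycd -ysum //.
have sd : s ^ d = s by apply/conjg_fixP/commgP; rewrite ds; apply: commuteM.
by apply: (@conjg_inj _ s); rewrite conjVg as_ -cd -as_ (conjJg a s d) sd.
Qed.

(** ** The root elements *)

(** The conjugate of S depends on the images of e_1 and e_2 alone, up to inversion. *)
Lemma S_eq g h x y s s' t t' : Ng g -> Ng h -> maps g x0 x s -> maps g x1 y s' ->
  maps h x0 x t -> maps h x1 y t' ->
  S ^ g = (if s (+) s' == t (+) t' then S ^ h else (S ^ h)^-1).
Proof.
move=> Ngg Ngh g0 g1 h0 h1.
have eqS g' t0 t1 : Ng g' -> maps g' x0 x t0 -> maps g' x1 y t1 ->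
    t0 (+) t1 = t (+) t' -> S ^ g' = S ^ h.
  move=> Ngg' g0' g1' e.
  have c0 := mapsM g0' (mapsV h0); have c1 := mapsM g1' (mapsV h1).
  have E : t0 (+) t = t1 (+) t'.
    by move: e; case: (t0) (t) (t1) (t') => [] [] [] [].
  rewrite -E in c1; have := NS (NgM Ngg' (NgV Ngh)) c0 c1.
  move/commgP/conjg_fixP; rewrite conjgM => E'.
  by rewrite -[in RHS]E' conjgKV.
case: eqP => [|ne]; first exact: eqS.
have Nw : Ng (T ww) by apply: Ng_T even_ww.
have w0 := mapsM (maps_T false even_ww ww0) g0.
have w1 := mapsM (maps_T false even_ww ww1) g1.
rewrite -(eqS _ _ _ (NgM Nw Ngg) w0 w1); first by rewrite conjgM S_inv conjVg invgK.
by move: ne; case: (s) (s') (t) (t') => [] [] [] [].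
Qed.

Lemma maps_Zcb (b : bool) i j k (c : bool) : i != j ->
  maps (Zc i j ^+ b) (ef k c) (ef k (c (+) (b && ((k == i) || (k == j))))) false.
Proof.
move=> ij; case: b; first exact: maps_Zc.
by rewrite addbF /maps rho1 mulmx1 scale1r.
Qed.

Lemma Ng_Zcb (b : bool) i j : i != j -> Ng (Zc i j ^+ b).
Proof.
by move=> ij; apply: Ng_Zg; case: b; [apply: Zg_c | apply: spanned1].
Qed.

(** The monomial group is transitive on triples, and on quadruples, of basis
  vectors of different planes with an even number of second vectors, up to the
  sign of the last one. *)
Lemma lift3 x y z : uniq [:: pr x; pr y; pr z] -> od x (+) od y (+) od z = false ->
  exists g s, [/\ Ng g, maps g x0 x false, maps g x1 y false & maps g x2 z s].
Proof.
move=> u par; have [a [ea a0 a1 a2]] := lift3_ex u.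
have [[nxy nxz] nyz] : (pr x != pr y /\ pr x != pr z) /\ pr y != pr z.
  by move: u => /= /and3P[]; rewrite !inE negb_or => /andP[].
set g := T a * Zc (pr x) (pr z) ^+ od x * Zc (pr y) (pr z) ^+ od y.
have mg i j s : sat a i j s -> maps g (ef i false) (ef j
    ((od x && ((j == pr x) || (j == pr z))) (+) (od y && ((j == pr y) || (j == pr z))))) s.
  move=> sa; have := mapsM (mapsM (maps_T false ea sa) (maps_Zcb (od x) _ _ nxz))
    (maps_Zcb (od y) _ _ nyz).
  by rewrite !addbF.
exists g, (a.1 j2); split.
- by apply: NgM; [apply: NgM; [apply: Ng_T | apply: Ng_Zcb] | apply: Ng_Zcb].
- have := mg _ _ _ a0.
  by rewrite eqxx (negbTE nxy) (negbTE nxz) andbT andbF addbF efK.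
- have := mg _ _ _ a1.
  by rewrite [pr y == pr x]eq_sym (negbTE nxy) (negbTE nyz) eqxx andbT andbF addFb efK.
- have := mg _ _ _ (satE a j2); rewrite a2 eqxx !orbT !andbT.
  suff -> : od x (+) od y = od z by rewrite efK.
  by move: par; case: (od x) (od y) (od z) => [] [] [].
Qed.

Lemma lift4 x y z w : uniq [:: pr x; pr y; pr z; pr w] ->
  od x (+) od y (+) od z (+) od w = false ->
  exists g s, [/\ Ng g, maps g x0 x false, maps g x1 y false, maps g x2 z false &
    maps g x3 w s].
Proof.
move=> u par; have [a [ea a0 a1 a2 a3]] := lift4_ex u.
have [[nxy nxz nxw] [nyz nyw] nzw] : [/\ [/\ pr x != pr y, pr x != pr z & pr x != pr w],
    (pr y != pr z) /\ (pr y != pr w) & pr z != pr w].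
  by move: u => /= /and4P[]; rewrite !inE !negb_or => /and3P[-> -> ->] /andP[-> ->] ->.
set g := T a * Zc (pr x) (pr w) ^+ od x * Zc (pr y) (pr w) ^+ od y * Zc (pr z) (pr w) ^+ od z.
have mg i j s : sat a i j s -> maps g (ef i false) (ef j
    ((od x && ((j == pr x) || (j == pr w))) (+) (od y && ((j == pr y) || (j == pr w)))
     (+) (od z && ((j == pr z) || (j == pr w))))) s.
  move=> sa; have := mapsM (mapsM (mapsM (maps_T false ea sa) (maps_Zcb (od x) _ _ nxw))
    (maps_Zcb (od y) _ _ nyw)) (maps_Zcb (od z) _ _ nzw).
  by rewrite !addbF.
exists g, (a.1 j3); split.
- by apply: NgM; [apply: NgM; [apply: NgM; [apply: Ng_T | apply: Ng_Zcb] | apply: Ng_Zcb]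
    | apply: Ng_Zcb].
- have := mg _ _ _ a0.
  by rewrite eqxx (negbTE nxy) (negbTE nxz) (negbTE nxw) !andbT !andbF !addbF efK.
- have := mg _ _ _ a1.
  rewrite [pr y == pr x]eq_sym (negbTE nxy) (negbTE nyz) (negbTE nyw) eqxx.
  by rewrite andbT !andbF addbF addFb efK.
- have := mg _ _ _ a2.
  rewrite [pr z == pr x]eq_sym [pr z == pr y]eq_sym (negbTE nxz) (negbTE nyz) (negbTE nzw) eqxx.
  by rewrite andbT !andbF addFb efK.
- have := mg _ _ _ (satE a j3); rewrite a3 eqxx !orbT !andbT.
  suff -> : od x (+) od y (+) od z = od w by rewrite efK.
  by move: par; case: (od x) (od y) (od z) (od w) => [] [] [] [].
Qed.

Let disE := dis_pr pr_ef od_ef efK.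

Lemma third i j : exists k, k != i /\ k != j.
Proof.
apply: contrapT => /forallNP no.
have H k : (k == i) || (k == j).
  by apply/negPn/negP; rewrite negb_or => /andP[h1 h2]; apply: (no k).
case/orP: (H j0) (H j1) (H j2) j01 j02 j12 => /eqP-> /orP[]/eqP-> /orP[]/eqP->;
  by rewrite ?eqxx.
Qed.

(** Parity is no obstacle to transitivity on pairs: a third plane is free to correct
  it. *)
Lemma reach2 x y : exists g, dis x y ->
  [/\ Ng g, maps g x0 x false & maps g x1 y false].
Proof.
have [|] := boolP (dis x y); last by exists 1.
rewrite disE => xy; have [k [kx ky]] := third (pr x) (pr y).
have [||g [s [Ngg g0 g1 _]]] := @lift3 x y (ef k (od x (+) od y)).
- by rewrite /= !inE negb_or pr_ef xy eq_sym kx eq_sym ky.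
- by rewrite od_ef addbb.
by exists g.
Qed.

Definition gxy x y : G := projT1 (cid (reach2 x y)).

Lemma gxyP x y : dis x y ->
  [/\ Ng (gxy x y), maps (gxy x y) x0 x false & maps (gxy x y) x1 y false].
Proof. by rewrite /gxy; case: cid. Qed.

(** The root elements, and with them the copies of SL2, as conjugates. *)
Definition fam x y (a b c d : F) : G := psi a b c d ^ gxy x y.

Definition X x y := S ^ gxy x y.

Lemma X_maps g x y s t : dis x y -> Ng g -> maps g x0 x s -> maps g x1 y t ->
  S ^ g = if s (+) t then (X x y)^-1 else X x y.
Proof.
move=> /gxyP[Nh h0 h1] Ngg g0 g1; rewrite (S_eq Ngg Nh g0 g1 h0 h1).
by case: (s (+) t).
Qed.

Lemma dis01 : dis x0 x1. Proof. by rewrite disE !pr_ef j01. Qed.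

Lemma X01 : X x0 x1 = S.
Proof.
have m x : maps 1 x x false by rewrite /maps rho1 mulmx1 scale1r.
have N1 : Ng 1 by apply: Ng_Zg; apply: spanned1.
by have := X_maps dis01 N1 (m _) (m _); rewrite conjg1.
Qed.

Lemma maps_dis g x y x' y' s t : Ng g -> maps g x x' s -> maps g y y' t -> dis x y -> dis x' y'.
Proof.
move=> /NgV Nv /mapsV mx /mapsV my; rewrite /apart => /andP[h1 h2].
apply/andP; split; [apply: contraNneq h1 => e | apply: contraNneq h2 => e].
  by rewrite e in my; have [-> _] := maps_uniq mx my.
by rewrite e in my; have [-> _] := maps_uniq (Ng_neg Nv mx) my.
Qed.

Lemma X_conj g x y x' y' s t : dis x y -> Ng g -> maps g x x' s -> maps g y y' t ->
  X x y ^ g = if s (+) t then (X x' y')^-1 else X x' y'.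
Proof.
move=> dxy Ngg mx my; have [Nh h0 h1] := gxyP dxy.
have dxy' := maps_dis Ngg mx my dxy.
rewrite /X -conjgM; exact: X_maps dxy' (NgM Nh Ngg) (mapsM h0 mx) (mapsM h1 my).
Qed.

Lemma maps_u : [/\ forall b : bool, maps U (ef j0 b) (ef j1 b) false,
  forall b : bool, maps U (ef j1 b) (ef j0 b) true & Ng U].
Proof.
rewrite -T_u; split; last exact: Ng_T.
- by move=> b; apply: maps_T => //; apply: sat_tr1 j01.
- by move=> b; apply: maps_T => //; apply: sat_tr2.
Qed.

Lemma maps_z : [/\ forall b : bool, maps Z (ef j0 b) (ef j0 (~~ b)) false,
  forall b : bool, maps Z (ef j1 b) (ef j1 (~~ b)) false & Ng Z].
Proof.
rewrite -Zc01; split; last by apply: Ng_Zg; apply: Zg_c j01.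
- by move=> b; have := maps_Zc j0 b j01; rewrite eqxx addbT.
- by move=> b; have := maps_Zc j1 b j01; rewrite eqxx orbT addbT.
Qed.

(** The Weyl element of the pair carries the root element to the inverse of the
  opposite one. *)
Lemma X_low x y : dis x y -> (S ^ U) ^ gxy x y = (X y x)^-1.
Proof.
move=> dxy; have [Nh h0 h1] := gxyP dxy; have [u0 u1 Nu] := maps_u.
rewrite -conjgM (X_maps _ (NgM Nu Nh) (mapsM (u0 _) h1) (mapsM (u1 _) h0)) //.
by rewrite (dis_sym nK).
Qed.

(** Z U carries (e_1, e_2) to (f_2, -f_1) and centralises S, so the root elements at
  (e_1, e_2) and (f_2, f_1) are inverse to each other. *)
Lemma X_neg x y : dis x y -> X x y = (X (neg y) (neg x))^-1.
Proof.
move=> dxy; have [Nh h0 h1] := gxyP dxy; have [u0 u1 Nu] := maps_u.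
have [z0 z1 Nz] := maps_z.
have SZU : S ^ (Z * U) = S.
  by apply/conjg_fixP/eqP/rel_ii; apply: rel_ii_4.
have n0 := Ng_neg Nh h0; have n1 := Ng_neg Nh h1.
rewrite !(neg_ef pr_ef od_ef) in n0 n1.
have m0 := mapsM (mapsM (z0 false) (u0 _)) n1.
have m1 := mapsM (mapsM (z1 false) (u1 _)) n0.
rewrite /X -{1}SZU -conjgM (X_maps _ (NgM (NgM Nz Nu) Nh) m0 m1) //.
by rewrite !(dis_neg nK) (dis_sym nK).
Qed.

Lemma commute_conj g h (k : G) : commute g h -> commute (g ^ k) (h ^ k).
Proof. by move=> c; rewrite /commute -(conjMg g h k) -(conjMg h g k) c. Qed.

Lemma commute_if (b : bool) g h : commute g (if b then h^-1 else h) -> commute g h.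
Proof. by case: b => // /commuteV; rewrite invgK. Qed.

Lemma X12 : S ^ V = X x1 x2.
Proof.
have m0 := maps_T false ev_v (@sat_v r 0 isT); have m1 := maps_T false ev_v (@sat_v r 1 isT).
have Nv : Ng V by rewrite -T_v; apply: Ng_T.
by rewrite T_v in m0 m1; rewrite (X_maps _ Nv m0 m1) // disE !pr_ef j12.
Qed.

Lemma X02 : S ^ (V * U^-1) = X x0 x2.
Proof.
have ev := evenV ev_u; have e := evenM ev_v ev.
have m0 := maps_T false e (satM (@sat_v r 0 isT) (satV (sat_tr1 j01))).
have m1 := maps_T false e (satM (@sat_v r 1 isT) (satV (@sat_u 2 isT isT))).
rewrite -T_u -T_v -TV // -TM //.
by rewrite (X_maps _ (Ng_T e) m0 m1) // disE !pr_ef j02.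
Qed.

Lemma X21 : commute S (X x2 x1).
Proof.
have e := even_tr j02.
have m0 := maps_T false e (sat_tr1 j02).
have [n1 n2] : j1 != j0 /\ j1 != j2 by rewrite eq_sym j01 j12.
have m1 := maps_T false e (sat_tr3 n1 n2).
have := X_maps _ (Ng_T e) m0 m1; rewrite disE !pr_ef eq_sym j12 => /(_ isT) /= <-.
by rewrite -W02; apply/commE/rel_iv; apply: rel_iv_c.
Qed.

Lemma maps_Zc_flip i j (b : bool) : i != j -> maps (Zc i j) (ef i b) (neg (ef i b)) false.
Proof. by move=> ij; have := maps_Zc i b ij; rewrite eqxx addbT (neg_ef pr_ef od_ef). Qed.

Lemma maps_Zc_fix i j k (b : bool) : i != j -> k != i -> k != j ->
  maps (Zc i j) (ef k b) (ef k b) false.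
Proof.
by move=> ij /negbTE ki /negbTE kj; have := maps_Zc k b ij; rewrite ki kj addbF.
Qed.

(** Z^V interchanges the basis vectors in the planes 2 and 3. *)
Lemma X0n1 : commute S (X x0 (neg x1)).
Proof.
have m0 := maps_Zc_fix false j12 j01 j02; have m1 := maps_Zc_flip false j12.
have := X_maps _ (Ng_Zg (Zg_c j12)) m0 m1.
rewrite disE (pr_neg _ pr_ef) !pr_ef j01 => /(_ isT) /= <-.
by rewrite Zc12; apply/commE/rel_iv; apply: rel_iv_e.
Qed.

Lemma maps_vv : 3 < n -> [/\ forall b : bool, maps (V ^+ 2) (ef j0 b) (ef j2 b) false,
  forall b : bool, maps (V ^+ 2) (ef j1 b) (ef j3 b) false & Ng (V ^+ 2)].
Proof.
move=> n3; have e := evenM ev_v ev_v.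
rewrite expg2 -T_v -TM //; split; last exact: Ng_T.
- by move=> b; apply: maps_T => //; apply: satM (@sat_v r 0 isT) (@sat_v r 1 isT).
- by move=> b; apply: maps_T => //; apply: satM (@sat_v r 1 isT) (@sat_v r 2 n3).
Qed.

Lemma X23 : 3 < n -> commute S (X x2 x3).
Proof.
move=> n3; have [m0 m1 Nv] := maps_vv n3.
have j23 : j2 != j3 by rewrite jj_eq.
have := X_maps _ Nv (m0 false) (m1 false); rewrite disE !pr_ef j23 => /(_ isT) /= <-.
by apply/commE/rel_iv; apply: rel_iv_d.
Qed.

(** An interchange at the planes 4 and 5 reduces this to the position (e_3, e_4); for
  n = 4 it is a relation of its own. *)
Lemma X2n3 : 3 < n -> commute S (X x2 (neg x3)).
Proof.
move=> n3; have j23 : j2 != j3 by rewrite jj_eq.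
have d : dis x2 (neg x3) by rewrite disE (pr_neg _ pr_ef) !pr_ef.
have [r1|n4] := eqVneq n 4.
  have [m0 m1 Nv] := maps_vv n3.
  have z0 := maps_Zc_fix false j12 j01 j02; have z1 := maps_Zc_flip false j12.
  have Nz := Ng_Zg (Zg_c j12).
  have m1' := mapsM z1 (Ng_neg Nv (m1 false)).
  have := X_maps d (NgM Nz Nv) (mapsM z0 (m0 _)) m1'; rewrite /= => <-.
  by rewrite Zc12; apply/commE/rel_iv; apply: rel_iv_f.
have n4' : 4 < n by rewrite ltn_neqAle eq_sym n4.
pose j4 := jj r 4.
have j34 : j3 != j4 by rewrite jj_eq.
have Nz := Ng_Zg (Zg_c j34).
have z (k : nat) : k < 3 -> maps (Zc j3 j4) (ef (jj r k) false) (ef (jj r k) false) false.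
  move=> k3; have kn : k < n by apply: ltn_trans n4'; apply: ltnW.
  by apply: maps_Zc_fix => //; rewrite jj_eq //; case: k k3 kn => [|[|[|]]].
have z3 := maps_Zc_flip false j34.
have d23 : dis x2 x3 by rewrite disE !pr_ef.
have := X_conj d23 Nz (z 2 isT) z3; rewrite /= => <-.
have := X_conj dis01 Nz (z 0%N isT) (z 1%N isT); rewrite X01 /= => {1}<-.
by apply: commute_conj; apply: X23.
Qed.

Lemma dis_u x y z : dis x y -> dis x z -> dis y z -> uniq [:: pr x; pr y; pr z].
Proof. by rewrite !disE /= !inE negb_or => -> -> ->. Qed.

Lemma dis02 : dis x0 x2. Proof. by rewrite disE !pr_ef j02. Qed.
Lemma dis12 : dis x1 x2. Proof. by rewrite disE !pr_ef j12. Qed.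

(** An odd triple is turned into an even one by X_neg, at the cost of turning a common
  head into a common tail. *)
Lemma X_head x y z : dis x y -> dis x z -> dis y z -> commute (X x y) (X x z).
Proof.
move=> dxy dxz dyz; case E: (od x (+) od y (+) od z); last first.
  have [g [s [Ngg m0 m1 m2]]] := lift3 (dis_u dxy dxz dyz) E.
  have := X_conj dis01 Ngg m0 m1; rewrite X01 /= => <-.
  apply: (@commute_if s); have := X_conj dis02 Ngg m0 m2; rewrite addFb => <-.
  by apply: commute_conj; rewrite -X02; apply/commE/rel_iv; apply: rel_iv_b.
have [||g [s [Ngg m0 m1 m2]]] := @lift3 (neg y) (neg x) (neg z).
- by rewrite !(pr_neg _ pr_ef); apply: dis_u => //; rewrite (dis_sym nK).
- by rewrite !(od_neg _ od_ef); move: E; case: (od x) (od y) (od z) => [] [] [].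
rewrite (X_neg dxy) (X_neg dxz); apply: commuteV; apply/commute_sym/commuteV/commute_sym.
have := X_conj dis01 Ngg m0 m1; rewrite X01 /= => <-.
have d21 : dis x2 x1 by rewrite (dis_sym nK) dis12.
apply: (@commute_if s); have := X_conj d21 Ngg m2 m1; rewrite addbF => <-.
by apply: commute_conj; apply: X21.
Qed.

Lemma X_tail x y z : dis x y -> dis x z -> dis y z -> commute (X x z) (X y z).
Proof.
move=> dxy dxz dyz; rewrite (X_neg dxz) (X_neg dyz).
apply: commuteV; apply/commute_sym/commuteV/commute_sym.
by apply: X_head; rewrite !(dis_negl nK, dis_negr nK) // (dis_sym nK).
Qed.

Lemma commg_mul (g h k : G) : [~ g, h] = k <-> g * h = h * g * k.
Proof.
split=> [<-|E]; first by rewrite commgEl conjgE !mulgA mulgK mulgV mul1g.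
by rewrite commgEl conjgE E -!mulgA !mulKg.
Qed.

(** The last sign in lift3 is not under control: these lemmas remove the inverses
  that it produces. *)
Lemma commg_signr (u v w : G) : commute w v -> [~ u, v^-1] = w^-1 -> [~ u, v] = w.
Proof.
move=> cb /commg_mul H; apply/commg_mul.
have H2 : v * u = u * w^-1 * v.
  by apply: (mulIg v^-1); rewrite mulgK -mulgA H -!mulgA mulVKg.
by rewrite H2 -!mulgA -cb mulKg.
Qed.

Lemma commg_invr (u v w : G) : commute u w -> commute w v ->
  [~ v^-1, u^-1] = w^-1 -> [~ u, v] = w.
Proof.
move=> ca cb /commg_mul H; apply/commg_mul.
have := congr1 (fun g => g^-1) H; rewrite /= !invgM !invgK => ->.
by rewrite mulgA cb -mulgA -ca mulgA.
Qed.

Lemma X_comm x y z : dis x y -> dis x z -> dis y z -> [~ X x y, X y z] = X x z.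
Proof.
have even_case x' y' z' : dis x' y' -> dis x' z' -> dis y' z' ->
    od x' (+) od y' (+) od z' = false -> [~ X x' y', X y' z'] = X x' z'.
  move=> dxy dxz dyz E; have [g [s [Ngg m0 m1 m2]]] := lift3 (dis_u dxy dxz dyz) E.
  have R : [~ X x0 x1, X x1 x2] = X x0 x2.
    by rewrite X01 -X12 -X02; apply/divg1_eq/rel_iv; apply: rel_iv_a.
  have := congr1 (fun h => h ^ g) R; rewrite /= conjRg.
  rewrite (X_conj dis01 Ngg m0 m1) (X_conj dis12 Ngg m1 m2) (X_conj dis02 Ngg m0 m2).
  rewrite !addFb /=; case: s {m2} => //.
  exact: commg_signr (X_tail dxy dxz dyz).
move=> dxy dxz dyz; case E: (od x (+) od y (+) od z); last exact: even_case.
have := @even_case (neg z) (neg y) (neg x).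
rewrite !(dis_negl nK, dis_negr nK) ![dis z _](dis_sym nK) [dis y x](dis_sym nK).
move=> /(_ dyz dxz dxy); rewrite !(od_neg _ od_ef).
have -> : ~~ od z (+) ~~ od y (+) ~~ od x = false.
  by move: E; case: (od x) (od y) (od z) => [] [] [].
move=> /(_ erefl).
have eN x' y' : dis x' y' -> X (neg y') (neg x') = (X x' y')^-1.
  by move/X_neg ->; rewrite invgK.
rewrite !eN //.
exact: commg_invr (X_head dxy dxz dyz) (X_tail dxy dxz dyz).
Qed.

Lemma X_opp x y : dis x y -> commute (X x y) (X x (neg y)).
Proof.
move=> dxy; have [Ngg m0 m1] := gxyP dxy.
have d : dis x0 (neg x1) by rewrite (dis_negr nK) dis01.
have := X_conj dis01 Ngg m0 m1; rewrite X01 /= => <-.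
have := X_conj d Ngg m0 (Ng_neg Ngg m1); rewrite /= => <-.
by apply: commute_conj; apply: X0n1.
Qed.

Lemma X_disj x y z w : dis x y -> dis x z -> dis x w -> dis y z -> dis y w -> dis z w ->
  commute (X x y) (X z w).
Proof.
move=> dxy dxz dxw dyz dyw dzw.
have u : uniq [:: pr x; pr y; pr z; pr w].
  by move: dxy dxz dxw dyz dyw dzw; rewrite !disE /= !inE !negb_or => -> -> -> -> -> ->.
have n3 : 3 < n.
  by have := max_card [in [:: pr x; pr y; pr z; pr w]]; rewrite card_ord; move/card_uniqP: u => ->.
have d23 : dis x2 x3 by rewrite disE !pr_ef jj_eq.
case E: (od x (+) od y (+) od z (+) od w); last first.
  have [g [s [Ngg m0 m1 m2 m3]]] := lift4 u E.
  have := X_conj dis01 Ngg m0 m1; rewrite X01 /= => <-.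
  apply: (@commute_if s); have := X_conj d23 Ngg m2 m3; rewrite addFb => <-.
  by apply: commute_conj; apply: X23.
have [||g [s [Ngg m0 m1 m2 m3]]] := @lift4 x y z (neg w).
- by rewrite (pr_neg _ pr_ef).
- by rewrite (od_neg _ od_ef) addbN E.
have := X_conj dis01 Ngg m0 m1; rewrite X01 /= => <-.
have m3' := Ng_neg Ngg m3; rewrite nK in m3'.
have d : dis x2 (neg x3) by rewrite (dis_negr nK).
apply: (@commute_if s); have := X_conj d Ngg m2 m3'; rewrite addFb => <-.
by apply: commute_conj; apply: X2n3.
Qed.

Lemma psi1 : psi 1%R 0%R 0%R 1%R = 1.
Proof.
apply: (mulgI (psi 1%R 0%R 0%R 1%R)); rewrite mulg1 psiM; try by ring.
by congr (psi _ _ _ _); ring.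
Qed.

Lemma psi_up (k : nat) : psi 1%R (k%:R)%R 0%R 1%R = S ^+ k.
Proof.
elim: k => [|k IH]; first by rewrite psi1.
rewrite expgS -IH -psi_S psiM; try by ring.
by congr (psi _ _ _ _); ring.
Qed.

Lemma psi_low (k : nat) : psi 1%R 0%R (- k%:R)%R 1%R = (S ^ U) ^+ k.
Proof.
elim: k => [|k IH]; first by rewrite oppr0 psi1.
rewrite expgS -IH S_U psiM; try by ring.
by congr (psi _ _ _ _); ring.
Qed.

Lemma fam_up x y (k : nat) : fam x y 1%R (k%:R)%R 0%R 1%R = X x y ^+ k.
Proof. by rewrite /fam psi_up conjXg. Qed.

Lemma fam_upN x y (k : nat) : fam x y 1%R (- k%:R)%R 0%R 1%R = X x y ^- k.
Proof.
apply/esym/mulg1_eq; rewrite -fam_up /fam -(conjMg (psi _ _ _ _)) psiM; try by ring.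
by apply/eqP; rewrite conjg_eq1 -psi1; apply/eqP; congr (psi _ _ _ _); ring.
Qed.

Lemma fam_low x y (k : nat) : dis x y -> fam x y 1%R 0%R (- k%:R)%R 1%R = X y x ^- k.
Proof. by move=> dxy; rewrite /fam psi_low conjXg X_low // expVgn. Qed.

(** From the generators of the root subgroups to their powers, which are all of the
  root subgroups as F is a prime field. *)
Lemma commg_exp (g h k : G) (i j : nat) : commute g k -> commute h k -> [~ g, h] = k ->
  [~ g ^+ i, h ^+ j] = k ^+ (i * j).
Proof.
move=> cg ch /commg_mul E; apply/commg_mul.
have E1 : g ^+ i * h = h * g ^+ i * k ^+ i.
  elim: i => [|i IH]; first by rewrite !mul1g !mulg1.
  rewrite expgSr -mulgA E mulgA (mulgA _ h) IH -!mulgA; congr (h * (g ^+ i * _)).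
  by rewrite expgSr !mulgA (commute_sym (commuteX i cg)).
elim: j => [|j IH]; first by rewrite muln0 !mulg1 mul1g.
rewrite expgSr mulgA IH mulnS expgnDr -!mulgA; congr (h ^+ j * _).
by rewrite -(commuteX _ ch) (mulgA _ h) E1 -!mulgA -expgnDr addnC expgnDr.
Qed.

(** A monomial element carries the whole copy of the special linear group of one
  pair to that of another. *)
Lemma psi_fam g x y (a b c d : F) : dis x y -> Ng g -> maps g x0 x false ->
  maps g x1 y false -> (a * d - b * c = 1)%R -> psi a b c d ^ g = fam x y a b c d.
Proof.
move=> dxy Ngg m0 m1; have [Nh h0 h1] := gxyP dxy; have [u0 u1 Nu] := maps_u.
have dyx : dis y x by rewrite (dis_sym nK).
have eS : S ^ g = S ^ gxy x y by rewrite (X_maps dxy Ngg m0 m1).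
have eL : (S ^ U) ^ g = (S ^ U) ^ gxy x y.
  rewrite X_low // -conjgM.
  by rewrite (X_maps dyx (NgM Nu Ngg) (mapsM (u0 _) m1) (mapsM (u1 _) m0)).
move: a b c d; apply: sl2_ind => [t|t|].
- by have [k ->] := prime_field t; rewrite /fam psi_up !conjXg eS.
- have [k ek] := prime_field (- t)%R.
  have -> : t = (- k%:R)%R by rewrite -ek opprK.
  by rewrite /fam psi_low !conjXg eL.
move=> a b c d a' b' c' d' det det'; rewrite /fam -psiM // => E E'.
by rewrite (conjMg (psi _ _ _ _)) E E' -conjMg.
Qed.

(** The interchange at the planes 2 and 3 carries (e_1, e_2) to (e_1, f_2) and commutes
  with the central element U'^2 of the copy of SL2 of (e_1, e_2). *)
Lemma fam_center x y : dis x y ->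
  fam x y (-1)%R 0%R 0%R (-1)%R = fam x (neg y) (-1)%R 0%R 0%R (-1)%R.
Proof.
move=> dxy; have [Nh h0 h1] := gxyP dxy.
have m0 := mapsM (maps_Zc_fix false j12 j01 j02) h0.
have m1 := mapsM (maps_Zc_flip false j12) (Ng_neg Nh h1).
rewrite -(psi_fam _ (NgM (Ng_Zg (Zg_c j12)) Nh) m0 m1); last 2 first.
- by rewrite (dis_negr nK).
- by ring.
rewrite conjgM /fam psi_UU; congr (_ ^ _); apply/esym/conjg_fixP/commgP.
have [p1 _] := uu1; have p2 : uu.2 j2 = j2.
  by rewrite /= permM !tpermD ?j02 ?j12.
have := Zc_conj even_uu j12; rewrite p1 p2 T_uu => E.
have c : commute (Zc j1 j2) (U ^+ 2) by apply/commgP/conjg_fixP.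
exact: commute_sym.
Qed.

Lemma fam_steinberg : steinberg_family neg fam.
Proof.
have pf t : exists k : nat, t = (k%:R)%R := prime_field t.
split.
- by move=> x y a b c d a' b' c' d' dxy det det'; rewrite /fam -(conjMg (psi _ _ _ _)) psiM.
- move=> x y t dxy; have [k ek] := pf (- t)%R.
  have -> : t = (- k%:R)%R by rewrite -ek opprK.
  by rewrite fam_low // fam_upN.
- move=> x y t dxy; have [k ->] := pf t.
  by rewrite fam_up fam_upN X_neg // expVgn.
- move=> x y z s t dxy dxz dyz; have [k ->] := pf s; have [l ->] := pf t.
  rewrite -natrM !fam_up; apply: commg_exp.
  + exact: X_head.
  + by apply/commute_sym; apply: X_tail.
  + exact: X_comm.
- move=> x y z s t dxy dxz dyz; have [k ->] := pf s; have [l ->] := pf t.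
  by rewrite !fam_up; apply: commuteX2; apply: X_head.
- move=> x y s t dxy; have [k ->] := pf s; have [l ->] := pf t.
  by rewrite !fam_up; apply: commuteX2; apply: X_opp.
- move=> x y z w s t d1 d2 d3 d4 d5 d6; have [k ->] := pf s; have [l ->] := pf t.
  by rewrite !fam_up; apply: commuteX2; apply: X_disj.
- exact: fam_center.
Qed.

(** ** Matrices of the family *)

Lemma phimx_fix x y z (a b c d : F) : z != x -> z != y -> z != neg x -> z != neg y ->
  (e z *m phimx x y a b c d = e z)%R.
Proof.
by rewrite -rowE rowK => /negbTE-> /negbTE-> /negbTE-> /negbTE->.
Qed.

Lemma phimx_conj g x y (a b c d : F) : dis x y -> Ng g -> maps g x0 x false ->
  maps g x1 y false ->
  (phimx x0 x1 a b c d *m rho g = rho g *m phimx x y a b c d)%R.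
Proof.
move=> dxy Ngg m0 m1; have n0 := Ng_neg Ngg m0; have n1 := Ng_neg Ngg m1.
have [r1 r2 r3 r4] := phimx_rows nK nn a b c d dxy.
have [s1 s2 s3 s4] := phimx_rows nK nn a b c d dis01.
have pre z w t : maps g z w t -> forall z' t', maps g z' w t' -> z = z'.
  by move=> /mapsV m z' t' /mapsV m'; have [] := maps_uniq m m'.
move: (m0) (m1) (n0) (n1); rewrite /maps expr0 !scale1r => e0 e1 f0 f1.
apply/row_matrixP => z; rewrite !rowE !mulmxA.
have [w [s mz]] := Ng_maps z Ngg.
case: (eqVneq z x0) => [->|z0]; first by rewrite s1 e0 r1 mulmxDl -!scalemxAl e0 e1.
case: (eqVneq z x1) => [->|z1]; first by rewrite s2 e1 r2 mulmxDl -!scalemxAl e0 e1.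
case: (eqVneq z (neg x0)) => [->|zn0].
  by rewrite s3 f0 r3 mulmxBl -!scalemxAl f0 f1.
case: (eqVneq z (neg x1)) => [->|zn1].
  by rewrite s4 f1 r4 mulmxDl -!scalemxAl f0 f1.
rewrite phimx_fix // mz -scalemxAl phimx_fix //.
- by apply: contraNneq z0 => E; rewrite E in mz; rewrite (pre _ _ _ mz _ _ m0).
- by apply: contraNneq z1 => E; rewrite E in mz; rewrite (pre _ _ _ mz _ _ m1).
- by apply: contraNneq zn0 => E; rewrite E in mz; rewrite (pre _ _ _ mz _ _ n0).
- by apply: contraNneq zn1 => E; rewrite E in mz; rewrite (pre _ _ _ mz _ _ n1).
Qed.

Lemma rho_fam x y (a b c d : F) : dis x y -> (a * d - b * c = 1)%R ->
  rho (fam x y a b c d) = phimx x y a b c d.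
Proof.
move=> dxy det; have [Nh h0 h1] := gxyP dxy.
rewrite /fam conjgE !rhoM rho_psi // (phimx_conj _ _ _ _ dxy Nh h0 h1) mulmxA -rhoM.
by rewrite mulVg rho1 mul1mx.
Qed.

(** ** Generation by root elements *)

Local Notation XA := (XG neg fam (fun _ _ => true)).

Lemma XA_fam x y (a b c d : F) : dis x y -> (a * d - b * c = 1)%R -> XA (fam x y a b c d).
Proof. by move=> dxy det; apply: (XG_phi nK fam_steinberg). Qed.

Lemma det_U : (0 * 0 - 1 * -1 = 1 :> F)%R. Proof. by ring. Qed.

Lemma XA_Uconj g x y : dis x y -> Ng g -> maps g x0 x false -> maps g x1 y false ->
  XA (U ^ g).
Proof.
move=> dxy Ngg m0 m1; rewrite -psi_U (psi_fam dxy Ngg m0 m1 det_U).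
exact: XA_fam det_U.
Qed.

Lemma XA_S : XA S.
Proof.
have -> : S = fam x0 x1 1%R 1%R 0%R 1%R by rewrite /fam psi_S; apply: esym X01.
by apply: XA_fam dis01 _; ring.
Qed.

Lemma XA_U : XA U.
Proof.
have m x : maps 1 x x false by rewrite /maps rho1 mulmx1 scale1r.
have N1 : Ng 1 by apply: Ng_Zg; apply: spanned1.
by rewrite -[U]conjg1; apply: XA_Uconj dis01 N1 (m _) (m _).
Qed.

Lemma XA_tr i j : i != j -> XA (T (tr i j)).
Proof.
move=> ij; have [k [ki kj]] := third i j.
have [|a [ea a0 a1 _]] := @lift3_ex i j k.
  by rewrite /= !inE negb_or ij eq_sym ki eq_sym kj.
have -> : T (tr i j) = U ^ T a.
  have [<- s0] := a0; have [<- s1] := a1.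
  apply: (mulgI (T a)); rewrite conjgE mulVKg -T_u -!TM ?even_tr ?(inj_eq perm_inj) ?j01 //.
  by have := @tr_conj r a j0 j1 j01; rewrite s0 s1 => ->.
apply: (@XA_Uconj _ (ef i false) (ef j false)); rewrite ?disE ?pr_ef //.
- exact: Ng_T.
- exact: maps_T.
- exact: maps_T.
Qed.

Lemma XA_T a : even a -> XA (T a).
Proof.
move=> ea; apply: (@sp_ind r predT (fun b => XA (T b))) => //.
- by rewrite T1; apply: spanned1.
- move=> i j b _ _ ij eb Xb; rewrite TM ?even_tr //.
  by apply: XG_M => //; apply: XA_tr.
Qed.

(** The interchanges at the planes 13 and 23 are conjugate by U, and their product is Z;
  so Z is the product of U^-1 and a conjugate of U. *)
Lemma XA_Z : XA Z.
Proof.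
have [u0 u1 u2] := u012.
have E : Zc j1 j2 ^ U = Zc j0 j2.
  by rewrite -T_u Zc_conj ?j12 // u1 u2.
have -> : Z = U^-1 * U ^ Zc j1 j2.
  rewrite conjgE -Zc01 -(@ZcM j0 j2 j1); last first.
    by rewrite /= !inE negb_or j02 j01 eq_sym j12.
  rewrite -E (Zc_sym (i := j2)) 1?eq_sym ?j12 // conjgE.
  have -> : (Zc j1 j2)^-1 = Zc j1 j2 by apply: mulg1_eq; apply: Zc_invol j12.
  by rewrite -(mulgA U^-1) -(mulgA (Zc j1 j2)).
apply: XG_M; first by apply: XG_V; [exact: fam_steinberg | exact: XA_U].
have Nz := Ng_Zg (Zg_c j12).
apply: (XA_Uconj (x := x0) (y := neg x1) _ Nz).
- by rewrite (dis_negr nK) dis01.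
- exact: maps_Zc_fix j12 j01 j02.
- exact: maps_Zc_flip j12.
Qed.

Hypothesis gen4 : forall P : G -> Prop, P 1 -> (forall g h, P g -> P h -> P (g * h)) ->
  (forall g, P g -> P g^-1) -> P S -> P Z -> P U -> P V -> forall g, P g.

Lemma XA_all g : XA g.
Proof.
apply: gen4 g; [exact: spanned1|exact: XG_M|..].
- by move=> g; apply: XG_V; exact: fam_steinberg.
- exact: XA_S.
- exact: XA_Z.
- exact: XA_U.
- by rewrite -T_v; apply: XA_T.
Qed.

Theorem core_faithful g : rho g = 1%:M%R -> g = 1.
Proof.
have Xg := XA_all g; pose s := [seq ef i false | i <- enum J].
have inS x : (x \in s) || (neg x \in s).
  rewrite -(efK x) (neg_ef pr_ef od_ef).
  have h i : ef i false \in s by apply/mapP; exists i; rewrite ?mem_enum.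
  by case: (od x); rewrite h ?orbT.
apply: (span_faithful nK nn fam_steinberg rho1 rhoM rho_fam (s := s)).
- rewrite pairwise_map; have := enum_uniq J; rewrite uniq_pairwise.
  by apply: sub_pairwise => i j; rewrite /= disE !pr_ef.
- by rewrite size_map size_enum_ord.
- by elim: Xg => [|g1 h _ IH [i [j [t [_ dij ->]]]]]; [exact: spanned1 |
    apply: XG_M => //; apply: XG_x => //; rewrite !inS].
Qed.

Lemma rho_ind (P : 'M[F]_N -> Prop) g : P (1%:M)%R ->
  (forall x y (t : F) A, dis x y -> P A -> P (A *m phimx x y 1 t 0 1)%R) -> P (rho g).
Proof.
move=> P1 PM; elim: (XA_all g) => [|g1 h _ IH [x [y [t [_ dxy ->]]]]]; first by rewrite rho1.
rewrite rhoM rho_fam //; last by ring.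
exact: PM.
Qed.

Lemma rho_root x y (t : F) : dis x y -> exists g, rho g = phimx x y 1%R t 0%R 1%R.
Proof. by move=> dxy; exists (fam x y 1%R t 0%R 1%R); apply: rho_fam => //; ring. Qed.
End Core.

(** * Morphisms and presented groups *)

Section Transport.
Variables (H G : groupType) (k : nat).

(** Words evaluated in two groups stay related by any relation compatible with the
  operations: this transfers relations between groups without naming a
  homomorphism. *)
Lemma free_lift_rel (P : H -> G -> Prop) (x : 'I_k -> H) (y : 'I_k -> G) w :
  P 1 1 -> (forall h h' g g', P h g -> P h' g' -> P (h * h') (g * g')) ->
  (forall h g, P h g -> P h^-1 g^-1) -> (forall i, P (x i) (y i)) ->
  P (free_lift x w) (free_lift y w).
Proof.
move=> P1 PM PV Pxy; rewrite /free_lift; elim/big_rec2: _ => // a h g _ IH.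
by apply: (PM) => //; case: a.2 => //; apply: (PV).
Qed.

Lemma free_lift_comp (f : H -> G) (x : 'I_k -> H) w : {morph f : g h / g * h} ->
  f (free_lift x w) = free_lift (fun i => f (x i)) w.
Proof.
move=> fM; have f1 : f 1 = 1 by apply: (mulgI (f 1)); rewrite -fM !mulg1.
apply: (free_lift_rel (P := fun h g => f h = g)) => //.
- by move=> h h' g g' <- <-; rewrite fM.
- by move=> h g <-; apply/esym/mulg1_eq; rewrite -fM mulgV f1.
Qed.

End Transport.

Lemma eq_free_lift (G : groupType) k (x y : 'I_k -> G) w : x =1 y -> free_lift x w = free_lift y w.
Proof. by move=> E; apply: eq_bigr => a _; rewrite E. Qed.

Lemma tnth2_map (H G : groupType) (f : H -> G) (x y : H) (i : 'I_2) :
  f (tnth [tuple x; y] i) = tnth [tuple f x; f y] i.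
Proof. by case: i => [[|[|]]] //= i; rewrite !(tnth_nth 1). Qed.

Section RelatorMorphism.
Variables (H G : groupType) (n : nat) (f : H -> G) (R R' : set (free_group 'I_2)).
Hypothesis fM : {morph f : g h / g * h}.

Lemma hom1 : f 1 = 1.
Proof. by apply: (mulgI (f 1)); rewrite -fM !mulg1. Qed.

Lemma homV g : f g^-1 = (f g)^-1.
Proof. by apply/esym/mulg1_eq; rewrite -fM mulgV hom1. Qed.

Lemma homJ g h : f (g ^ h) = f g ^ f h.
Proof. by rewrite /conjg !fM homV. Qed.

Lemma homX g (k : nat) : f (g ^+ k) = f g ^+ k.
Proof. by elim: k => [|k IH]; rewrite ?hom1 // !expgS fM IH. Qed.

Lemma homR g h : f [~ g, h] = [~ f g, f h].
Proof. by rewrite !commgEl fM homV homJ. Qed.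

Lemma relators_map S Z U V g : relators n S Z U V R R' g ->
  relators n (f S) (f Z) (f U) (f V) R R' (f g).
Proof.
have E := (fM, homV, homJ, homX, homR).
move=> [[[[|]|]|]|].
- move=> [w Rw <-]; do 4![left]; exists w => //.
  by rewrite free_lift_comp //; apply: eq_free_lift => i; rewrite tnth2_map.
- by move=> [n3|n4| | | | | |n3]; do 3![left]; right; rewrite !E; constructor.
- by move=> [n3|n4|n3|]; do 2![left]; right; rewrite !E; constructor.
- move=> [w Rw <-]; left; right; exists w => //.
  by rewrite free_lift_comp //; apply: eq_free_lift => i; rewrite tnth2_map.
- by move=> [| | |n3| |n4]; right; rewrite !E; constructor.
Qed.

(** Relators are words in the generators, so those in f S, f Z, f U, f V are the images
  of those in S, Z, U, V. *)
Lemma relators_lift S Z U V g : relators n (f S) (f Z) (f U) (f V) R R' g ->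
  exists2 h, relators n S Z U V R R' h & f h = g.
Proof.
have E := (fM, homV, homJ, homX, homR).
move=> [[[[|]|]|]|].
- move=> [w Rw <-]; exists (free_lift (tnth [tuple U; V]) w).
    by do 4![left]; exists w.
  by rewrite free_lift_comp //; apply: eq_free_lift => i; rewrite tnth2_map.
- case=> [n3|n4| | | | | |n3].
  + by exists [~ Z, U ^ (V ^+ 2)]; rewrite ?E //; do 3![left]; right; constructor.
  + by exists [~ Z, V * U * U ^ V]; rewrite ?E //; do 3![left]; right; constructor.
  + by exists (Z ^+ 2); rewrite ?E //; do 3![left]; right; constructor.
  + by exists [~ Z, (U ^+ 2) ^ V]; rewrite ?E //; do 3![left]; right; constructor.
  + by exists (Z * Z ^ V * (Z ^ (V * U))^-1); rewrite ?E //; do 3![left]; right; constructor.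
  + by exists [~ Z, U]; rewrite ?E //; do 3![left]; right; constructor.
  + by exists [~ Z, Z ^ V]; rewrite ?E //; do 3![left]; right; constructor.
  + by exists [~ Z, Z ^ (V ^+ 2)]; rewrite ?E //; do 3![left]; right; constructor.
- case=> [n3|n4|n3|].
  + by exists [~ S, U ^ (V ^+ 2)]; rewrite ?E //; do 2![left]; right; constructor.
  + by exists [~ S, V * U^-1 * (U^-1) ^ V]; rewrite ?E //; do 2![left]; right; constructor.
  + by exists [~ S, Z ^ (V ^+ 2)]; rewrite ?E //; do 2![left]; right; constructor.
  + by exists [~ S, Z * U]; rewrite ?E //; do 2![left]; right; constructor.
- move=> [w Rw <-]; exists (free_lift (tnth [tuple S; U]) w).
    by left; right; exists w.
  by rewrite free_lift_comp //; apply: eq_free_lift => i; rewrite tnth2_map.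
- case=> [| | |n3| |n4].
  + by exists ([~ S, S ^ V] * (S ^ (V * U^-1))^-1); rewrite ?E //; right; constructor.
  + by exists [~ S, S ^ (V * U^-1)]; rewrite ?E //; right; constructor.
  + by exists [~ S, S ^ (U ^ (V * U^-1))]; rewrite ?E //; right; constructor.
  + by exists [~ S, S ^ (V ^+ 2)]; rewrite ?E //; right; constructor.
  + by exists [~ S, S ^ (Z ^ V)]; rewrite ?E //; right; constructor.
  + by exists [~ S, S ^ (Z ^ V * V ^+ 2)]; rewrite ?E //; right; constructor.
Qed.

End RelatorMorphism.

Section PresentedGroup.
Variables (k : nat) (R : set (free_group 'I_k)).

Lemma free_ind (P : free_group 'I_k -> Prop) : P 1 -> (forall u v, P u -> P v -> P (u * v)) ->
  (forall u, P u -> P u^-1) -> (forall i, P (gen i)) -> forall w, P w.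
Proof.
move=> P1 PM PV Pg w.
suff -> : w = free_lift (@gen _) w.
  by apply: (free_lift_rel (G := free_group 'I_k) (P := fun u _ => P u) (y := fun=> 1)) => //;
    move=> *; [apply: (PM) | apply: (PV)].
have -> : w = of_word (word_of w) by apply: val_inj; rewrite /= reduce_id ?word_of_reduced.
rewrite free_lift_of_word; elim: (word_of w) => [|a s IH]; first by rewrite big_nil.
rewrite big_cons -IH; apply: val_inj; rewrite /= reduce_cat (reduce_id (reduced_reduce s)).
by case: a => i [].
Qed.

Lemma presented_ind (P : presented R -> Prop) : P 1 -> (forall u v, P u -> P v -> P (u * v)) ->
  (forall u, P u -> P u^-1) -> (forall i, P (quot_pi R (gen i))) -> forall q, P q.
Proof.
move=> P1 PM PV Pg q; rewrite -(quot_reprK q); move: (quot_repr q) => w.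
elim/free_ind: w => //.
- by move=> u v Pu Pv; rewrite quot_piM; apply: (PM).
- by move=> u Pu; rewrite -quot_inv_pi; apply: (PV).
Qed.

Lemma presented_map (L : groupType) (y : 'I_k -> L) :
  (forall w, R w -> free_lift y w = 1) ->
  exists f : presented R -> L, {morph f : q q' / q * q'} /\
    forall w, f (quot_pi R w) = free_lift y w.
Proof.
move=> Ry; pose f (q : presented R) := free_lift y (quot_repr q).
have fE w : f (quot_pi R w) = free_lift y w.
  have /quot_eqP c := quot_reprK (quot_pi R w).
  have := c _ (kernel_normal y) Ry; rewrite /= free_liftM free_liftV.
  by move/mulg1_eq; rewrite invgK.
exists f; split=> // q q'.
by rewrite -(quot_reprK q) -(quot_reprK q') -quot_piM !fE free_liftM.
Qed.

End PresentedGroup.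

(** ** Maps from SL2 *)

Section SL2Presentation.
Variables (F : fieldType) (G H : groupType).
Hypothesis prime_field : forall t : F, exists k : nat, t = (k%:R)%R.

(** A homomorphism from SL2 in terms of the matrix entries. *)
Definition sl2_mul (L : groupType) (psi : F -> F -> F -> F -> L) :=
  forall a b c d a' b' c' d' : F,
  (a * d - b * c = 1)%R -> (a' * d' - b' * c' = 1)%R ->
  psi a b c d * psi a' b' c' d' =
  psi (a * a' + b * c')%R (a * b' + b * d')%R (c * a' + d * c')%R (c * b' + d * d')%R.

Lemma sl2_gen (psi : F -> F -> F -> F -> H) (X : H -> Prop) :
  sl2_mul psi -> X 1 -> (forall g h, X g -> X h -> X (g * h)) -> (forall g, X g -> X g^-1) ->
  X (psi 1 1 0 1)%R -> X (psi 0 1 (-1) 0)%R ->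
  forall a b c d, (a * d - b * c = 1)%R -> X (psi a b c d).
Proof.
move=> psiM X1 XM XV XS XU.
have XX g (k : nat) : X g -> X (g ^+ k).
  by move=> Xg; elim: k => [|k IH] //; rewrite expgS; apply: (XM).
apply: sl2_ind => [t|t|a b c d a' b' c' d' det det' IH IH'].
- by have [k ->] := prime_field t; rewrite (psi_up psiM erefl); apply: XX.
- have [k ek] := prime_field (- t)%R.
  have -> : t = (- k%:R)%R by rewrite -ek opprK.
  by rewrite (psi_low psiM erefl erefl); apply: XX; rewrite conjgE; do 2?apply: (XM) => //; apply: (XV).
- by rewrite -psiM //; apply: (XM).
Qed.

Lemma sl2_unique (psi psi' : F -> F -> F -> F -> G) : sl2_mul psi -> sl2_mul psi' ->
  (psi 1 1 0 1 = psi' 1 1 0 1)%R -> (psi 0 1 (-1) 0 = psi' 0 1 (-1) 0)%R ->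
  forall a b c d : F, (a * d - b * c = 1)%R -> psi a b c d = psi' a b c d.
Proof.
move=> psiM psiM' ES EU; apply: sl2_ind => [t|t|a b c d a' b' c' d' det det' IH IH'].
- by have [k ->] := prime_field t; rewrite (psi_up psiM erefl) (psi_up psiM' erefl) ES.
- have [k ek] := prime_field (- t)%R.
  have -> : t = (- k%:R)%R by rewrite -ek opprK.
  by rewrite (psi_low psiM erefl erefl) (psi_low psiM' erefl erefl) ES EU.
- by rewrite -psiM // -psiM' // IH IH'.
Qed.

Variables (m : F -> F -> F -> F -> H) (R : set (free_group 'I_2)).
Hypothesis mM : sl2_mul m.

Lemma sl2_map (S U : G) : presents [tuple m 1 1 0 1; m 0 1 (-1) 0]%R R ->
  (forall w, R w -> free_lift (tnth [tuple S; U]) w = 1) ->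
  exists psi : F -> F -> F -> F -> G, [/\ sl2_mul psi, psi 1%R 1%R 0%R 1%R = S &
    psi 0%R 1%R (-1)%R 0%R = U].
Proof.
move=> pR RSU; have [f fP] := presents_map pR RSU.
pose im h := exists w, free_lift (tnth [tuple m 1 1 0 1; m 0 1 (-1) 0]%R) w = h.
have imE a b c d : (a * d - b * c = 1)%R -> im (m a b c d).
  move: a b c d; apply: (sl2_gen (X := im) mM).
  - by exists 1; rewrite free_lift1.
  - by move=> _ _ [w <-] [w' <-]; exists (w * w'); rewrite free_liftM.
  - by move=> _ [w <-]; exists w^-1; rewrite free_liftV.
  - by exists (gen ord0); rewrite free_lift_gen (tnth_nth 1).
  - by exists (gen (lift ord0 ord0)); rewrite free_lift_gen (tnth_nth 1).
exists (fun a b c d => f (m a b c d)); split.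
- move=> a b c d a' b' c' d' det det'; have [w e] := imE _ _ _ _ det.
  have [w' e'] := imE _ _ _ _ det'.
  by rewrite -mM // -e -e' -free_liftM !fP free_liftM.
- by have := fP (gen ord0); rewrite !free_lift_gen !(tnth_nth 1).
- by have := fP (gen (lift ord0 ord0)); rewrite !free_lift_gen !(tnth_nth 1).
Qed.

End SL2Presentation.

(** * The relations hold for the matrices *)

Section Model.
Variable r : nat.
Local Notation n := r.+3.
Local Notation J := 'I_n.
Variables (N : nat) (pr : 'I_N -> J) (od : 'I_N -> bool) (ef : J -> bool -> 'I_N).
Hypothesis pr_ef : forall a b, pr (ef a b) = a.
Hypothesis od_ef : forall a b, od (ef a b) = b.
Hypothesis efK : forall i, ef (pr i) (od i) = i.
Local Notation I := 'I_N.
Local Notation neg := (neg pr od ef).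
Local Notation dis := (apart neg).
Variable F : fieldType.
Local Notation e i := (delta_mx (0 : 'I_1)%R i : 'rV[F]_N).
Local Notation phimx := (@levi_mx F N neg).
Variables (gT : finGroupType) (gv : gT -> 'M[F]_N) (mk : 'M[F]_N -> gT).
Hypothesis gv_inj : injective gv.
Hypothesis gv1 : gv 1%g = (1%:M)%R.
Hypothesis gvM : forall g h, gv (g * h)%g = (gv g *m gv h)%R.
Hypothesis mkK : forall A B : 'M[F]_N, (A *m B = 1%:M)%R -> gv (mk A) = A.
Implicit Types (i j k l : J) (x y z w : I) (a b c : sp r) (g h : gT).

Let nK := negK pr_ef od_ef efK.
Let nn := neg_neq pr_ef od_ef efK.

Local Notation j0 := (jj r 0).
Local Notation j1 := (jj r 1).
Local Notation j2 := (jj r 2).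
Local Notation j3 := (jj r 3).
Local Notation spu := (spu r).
Local Notation spv := (spv r).
Local Notation x0 := (ef j0 false).
Local Notation x1 := (ef j1 false).

Definition levi_elt x y (t1 t2 t3 t4 : F) : gT := mk (phimx x y t1 t2 t3 t4).

Local Notation gphi := levi_elt.

Lemma levi_eltE x y (t1 t2 t3 t4 : F) : dis x y -> (t1 * t4 - t2 * t3 = 1)%R ->
  gv (gphi x y t1 t2 t3 t4) = phimx x y t1 t2 t3 t4.
Proof.
move=> dxy det; apply: (mkK (B := phimx x y t4 (- t2) (- t3) t1)%R).
rewrite (phimxM nK nn) // -(phimx11 _ nK nn dxy).
by congr (levi_mx _ _ _ _ _ _ _); rewrite -?det; ring.
Qed.

(** A monomial matrix: the plane i goes to the plane a.2 i with sign a.1 i, and its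
  two basis vectors are interchanged when E i holds. *)
Definition mono g (E : J -> bool) a := forall i (b : bool),
  (e (ef i b) *m gv g = (-1) ^+ (a.1 i) *: e (ef (a.2 i) (b (+) E i)))%R.

Lemma mono_eq g h E E' a : mono g E a -> mono h E' a -> E =1 E' -> g = h.
Proof.
move=> mg mh EE; apply/gv_inj/row_matrixP => x.
by rewrite !rowE -(efK x) mg mh EE.
Qed.

Lemma monoM g h E E' a a' : mono g E a -> mono h E' a' ->
  mono (g * h) (fun i => E i (+) E' (a.2 i)) (spM a a').
Proof.
move=> mg mh i b; rewrite gvM mulmxA mg -scalemxAl mh scalerA -signr_addb addbA.
by rewrite /= ffunE permM.
Qed.

Lemma mono1 : mono 1 (fun=> false) (sp1 r).
Proof. by move=> i b; rewrite gv1 mulmx1 /= ffunE perm1 addbF scale1r. Qed.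

Lemma monoV g E a : mono g E a -> mono g^-1 (fun i => E (a.2^-1 i)) (spV a).
Proof.
move=> mg i b; have := mg (a.2^-1 i) (b (+) E (a.2^-1 i)); rewrite permKV -addbA addbb addbF.
move/(congr1 (fun u => u *m gv g^-1)%R); rewrite -mulmxA -gvM mulgV gv1 mulmx1 -scalemxAl => ->.
rewrite scalerA /= ffunE -signr_addb addbb scale1r //.
Qed.

Definition monomx (E : J -> bool) a : 'M[F]_N :=
  (\matrix_x ((-1) ^+ (a.1 (pr x)) *: e (ef (a.2 (pr x)) (od x (+) E (pr x)))))%R.

Lemma mono_mk E a : mono (mk (monomx E a)) E a.
Proof.
have row1 E' a' i (b : bool) : (e (ef i b) *m monomx E' a' = (-1) ^+ (a'.1 i) *: e (ef (a'.2 i) (b (+) E' i)))%R.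
  by rewrite -rowE rowK pr_ef od_ef.
move=> i b; rewrite (mkK (B := monomx (fun i => E (a.2^-1 i)) (spV a))); first exact: row1.
apply/row_matrixP => x; rewrite !rowE mulmxA mulmx1 -(efK x) !row1 -scalemxAl row1 scalerA.
by rewrite /= ffunE permK -signr_addb addbb scale1r -addbA addbb addbF.
Qed.

(** The matrices of a signed permutation and of Z. *)
Definition gt a : gT := mk (monomx (fun=> false) a).
Definition pair01 i : bool := (i == j0) || (i == j1).
Definition gz : gT := mk (monomx pair01 (sp1 r)).

Lemma mono_gt a : mono (gt a) (fun=> false) a.
Proof. exact: mono_mk. Qed.

Lemma mono_gz : mono gz pair01 (sp1 r).
Proof. exact: mono_mk. Qed.

Lemma gt1 : gt (sp1 r) = 1.
Proof. exact: mono_eq (mono_gt _) mono1 _. Qed.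

Lemma gtM a b : gt (spM a b) = gt a * gt b.
Proof. exact: mono_eq (mono_gt _) (monoM (mono_gt a) (mono_gt b)) _. Qed.

Let gtMe a b : even a -> even b -> gt (spM a b) = gt a * gt b.
Proof. by rewrite gtM. Qed.

Lemma gtV a : gt (spV a) = (gt a)^-1.
Proof. by apply/esym/mulg1_eq; rewrite -gtM spMV gt1. Qed.

Lemma gz_conj a : mono (gz ^ gt a) (fun i => (i == a.2 j0) || (i == a.2 j1)) (sp1 r).
Proof.
have := monoM (monoV (mono_gt a)) (monoM mono_gz (mono_gt a)).
rewrite conjgE sp1M spVM => m i b; rewrite m /= addbF.
by rewrite /pair01 -!(inj_eq (@perm_inj _ a.2) (a.2^-1 i)) !permKV.
Qed.

Lemma gz_C a : (a.2 j0 == j0) && (a.2 j1 == j1) || (a.2 j0 == j1) && (a.2 j1 == j0) ->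
  commute gz (gt a).
Proof.
move=> H; have m1 := monoM mono_gz (mono_gt a); have m2 := monoM (mono_gt a) mono_gz.
rewrite sp1M in m1; rewrite spM1 in m2; apply: mono_eq m1 m2 _ => i /=.
rewrite addbF /pair01 -!(inj_eq (@perm_inj _ a.2) i).
by case/orP: H => /andP[/eqP-> /eqP->] //; rewrite orbC.
Qed.

Lemma flip_C g h E E' : mono g E (sp1 r) -> mono h E' (sp1 r) -> commute g h.
Proof.
move=> mg mh; have m1 := monoM mg mh; have m2 := monoM mh mg.
by apply: mono_eq m1 m2 _ => i /=; rewrite !perm1 addbC.
Qed.

(** ** The relations among the matrices *)

Local Notation S := (gphi x0 x1 1%R 1%R 0%R 1%R).
Local Notation U := (gt spu).
Local Notation V := (gt spv).
Local Notation gx := (gx gphi).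

Let disE := dis_pr pr_ef od_ef efK.

Lemma gx_mono g E a x y (t : F) : mono g E a -> dis x y ->
  gx x y t ^ g = gx (ef (a.2 (pr x)) (od x (+) E (pr x))) (ef (a.2 (pr y)) (od y (+) E (pr y)))
    (t * (-1) ^+ (a.1 (pr y)) / (-1) ^+ (a.1 (pr x)))%R.
Proof.
move=> mg dxy; pose f z := ef (a.2 (pr z)) (od z (+) E (pr z)).
apply: (gx_conj nK nn gv_inj gvM levi_eltE (f := f) (c := fun z => ((-1) ^+ (a.1 (pr z)))%R)) => //.
- move=> z w /(congr1 (fun u => (pr u, od u))); rewrite !pr_ef !od_ef => -[/perm_inj e1 e2].
  by rewrite -(efK z) -(efK w) e1; congr (ef _ _); move: e2; rewrite e1 => /addIb.
- by move=> z; rewrite /f (neg_ef pr_ef od_ef) (pr_neg _ pr_ef) (od_neg _ od_ef) addNb.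
- by move=> z; rewrite (pr_neg _ pr_ef) -signr_addb addbb.
- by move=> z; rewrite -{1}(efK z); apply: mg.
Qed.

Lemma S_mono g E a i j (s s' : bool) : mono g E a -> sat a j0 i s -> sat a j1 j s' ->
  S ^ g = gx (ef i (E j0)) (ef j (E j1)) ((-1) ^+ (s' (+) s))%R.
Proof.
move=> mg [<- <-] [<- <-]; have := gx_mono 1%R mg (x := x0) (y := x1).
rewrite disE !pr_ef !od_ef jj_eq // => -> //.
by rewrite mul1r signr_addb; case: (a.1 j0); rewrite ?expr0 ?expr1 ?invrN invr1.
Qed.

Lemma S_gt a i j (s s' : bool) : sat a j0 i s -> sat a j1 j s' ->
  S ^ gt a = gx (ef i false) (ef j false) ((-1) ^+ (s' (+) s))%R.
Proof. exact: S_mono (mono_gt a). Qed.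

Lemma commg1 g h : commute g h -> [~ g, h] = 1.
Proof. by move=> c; apply/eqP/commgP. Qed.


Let T12 : gt (tr j1 j2) = U ^ V := T_tr12 erefl erefl gtMe.
Let T23 : 3 < n -> gt (tr j2 j3) = U ^ (V ^+ 2) := T_tr23 erefl erefl gtMe.

Lemma model_rel_i g : relator_i n gz U V g -> g = 1.
Proof.
have [v0 v1 v2] := v012 r; have [u0 u1 u2] := u012 r.
have [n01 n02 n12] : [/\ j0 != j1, j0 != j2 & j1 != j2] by rewrite !jj_eq.
have fix23 : 3 < n -> (tr j2 j3).2 j0 = j0 /\ (tr j2 j3).2 j1 = j1.
  by move=> n3; rewrite /= !tpermD ?jj_eq.
case=> [n3|n4| | | | | |n3].
- by apply: commg1; rewrite -T23 //; apply: gz_C; have [-> ->] := fix23 n3; rewrite !eqxx.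
- apply: commg1; rewrite -T12 -!gtM; apply: gz_C; rewrite /= !permM.
  by rewrite v0 v1 u1 u2 (tpermD) ?tpermR 1?eq_sym // !eqxx.
- have := monoM mono_gz mono_gz; rewrite sp1M => m; apply: mono_eq m mono1 _ => i /=.
  by rewrite perm1 addbb.
- apply: commg1; rewrite expg2 conjMg -T12 -gtM; apply: gz_C; rewrite /= !permM.
  by rewrite tpermL tpermR !tpermD 1?eq_sym // !eqxx.
- apply/eqP; rewrite divg_eq1; apply/eqP.
  have := monoM mono_gz (gz_conj spv); rewrite sp1M => m1.
  rewrite -gtM; apply: mono_eq m1 (gz_conj _) _ => i /=; rewrite perm1 !permM v0 v1 u1 u2 /pair01.
  case: (eqVneq i j0) => [->|i0]; first by rewrite (negbTE n01) (negbTE n02).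
  by case: (eqVneq i j1) => [->|i1]; [rewrite (negbTE n12) | ].
- by apply: commg1; apply: gz_C; rewrite u0 u1 !eqxx orbT.
- exact/commg1/(flip_C mono_gz (gz_conj _)).
- by rewrite expg2 -gtM; exact/commg1/(flip_C mono_gz (gz_conj _)).
Qed.

Lemma model_rel_ii g : relator_ii n S gz U V g -> g = 1.
Proof.
have d01 : dis x0 x1 by rewrite disE !pr_ef jj_eq.
have [n01 n02 n12] : [/\ j0 != j1, j0 != j2 & j1 != j2] by rewrite !jj_eq.
have fixS a : sat a j0 j0 false -> sat a j1 j1 false -> commute S (gt a).
  by move=> s0 s1; apply/commgP/conjg_fixP; rewrite (S_gt s0 s1).
have [sv0 sv1] := (@sat_v r 0 isT, @sat_v r 1 isT).
case=> [n3|n4|n3|]; apply: commg1.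
- by rewrite -T23 //; apply: fixS; apply: sat_tr3; rewrite jj_eq.
- have -> : (U^-1) ^ V = gt (spV (tr j1 j2)) by rewrite gtV T12 conjVg.
  rewrite -gtV -!gtM; apply: fixS.
    apply: (satM (satM sv0 (satV (sat_tr1 n01))) (satV _)).
    by apply: sat_tr3; rewrite jj_eq.
  exact: (satM (satM sv1 (satV (@sat_u r 2 isT isT))) (satV (sat_tr1 n12))).
- rewrite expg2 -gtM; have := gz_conj (spM spv spv).
  have [v0 v1 v2] := v012 r.
  rewrite /= !permM v0 v1 v2 // => m.
  apply/commgP/conjg_fixP; rewrite (S_mono m (satE _ _) (satE _ _)) /= !perm1 !ffunE.
  by rewrite !jj_eq.
- have := monoM mono_gz (mono_gt spu); rewrite sp1M => m.
  apply/commgP/conjg_fixP; rewrite (S_mono m (sat_tr1 n01) (sat_tr2 _ _)) /=.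
  rewrite /pair01 !eqxx orbT /= expr1.
  rewrite [RHS](gx_neg nK nn gv_inj levi_eltE) // !(neg_ef pr_ef od_ef) //.
Qed.

(** Each relation is an instance of a Steinberg relation: the conjugates of S involved
  are root elements at positions that are read off the monomial matrices. *)
Lemma model_rel_iv g : relator_iv n S gz U V g -> g = 1.
Proof.
have [n01 n02 n12] : [/\ j0 != j1, j0 != j2 & j1 != j2] by rewrite !jj_eq.
have dE i j (b b' : bool) : dis (ef i b) (ef j b') = (i != j) by rewrite disE !pr_ef.
have [d01 d02 d12] : [/\ dis x0 x1, dis x0 (ef j2 false) & dis x1 (ef j2 false)].
  by rewrite !dE n01 n02 n12.
have [sv0 sv1] := (@sat_v r 0 isT, @sat_v r 1 isT).
have SV : S ^ V = gx x1 (ef j2 false) 1%R by rewrite (S_gt sv0 sv1).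
have SVU : S ^ (V * U^-1) = gx x0 (ef j2 false) 1%R.
  by rewrite -gtV -gtM (S_gt (satM sv0 (satV (sat_tr1 n01))) (satM sv1 (satV (@sat_u r 2 isT isT)))).
have SV2 : 3 < n -> S ^ (V ^+ 2) = gx (ef j2 false) (ef j3 false) 1%R.
  by move=> n3; rewrite expg2 -gtM (S_gt (satM sv0 sv1) (satM sv1 (@sat_v r 2 n3))).
have mZV := gz_conj spv; have [v0 v1 v2] := v012 r; rewrite v0 v1 in mZV.
case=> [| | |n3| |n4].
- by rewrite SV SVU (gx_comm nK nn gv_inj gvM levi_eltE) // mulr1 mulgV.
- by rewrite SVU; apply/commg1/(gx_headC nK nn gv_inj gvM levi_eltE).
- rewrite (W02 (T := gt) erefl erefl gtMe).
  rewrite (S_gt (sat_tr1 n02) (@sat_tr3 r j0 j2 j1 _ _)) ?jj_eq // expr0; apply: commg1.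
  rewrite -/(gx _ _ _) (gx_neg nK nn gv_inj levi_eltE) // (gx_neg nK nn gv_inj levi_eltE (i := ef j2 _)).
    by apply: (gx_headC nK nn gv_inj gvM levi_eltE); rewrite !(neg_ef pr_ef od_ef) dE // eq_sym.
  by rewrite dE eq_sym.
- rewrite SV2 //; apply/commg1/(gx_disjC nK nn gv_inj gvM levi_eltE); rewrite dE ?jj_eq //.
- rewrite (S_mono mZV (satE _ _) (satE _ _)) /= !perm1 !ffunE !jj_eq //=.
  have := gx_oppC nK nn gv_inj gvM levi_eltE 1%R 1%R d01; rewrite (neg_ef pr_ef od_ef).
  by move/commg1.
- have n3 : 3 < n by rewrite n4.
  rewrite conjgM (S_mono mZV (satE _ _) (satE _ _)) /= !perm1 !ffunE !jj_eq //=.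
  rewrite expg2 -gtM (gx_mono _ (mono_gt _)) ?dE // !pr_ef !od_ef /= !permM v0 v1 v2 // !ffunE.
  rewrite v0 v1.
  apply/commg1/(gx_disjC nK nn gv_inj gvM levi_eltE); rewrite dE ?jj_eq //.
Qed.

End Model.

(** * The isomorphism *)

(** The matrix groups in the two presentations enter by their multiplication only: HU
  for the signed permutations, HS for SL2, and gT for the linear group. *)
Section Assembly.
Variable r : nat.
Local Notation n := r.+3.
Local Notation J := 'I_n.
Variables (N : nat) (pr : 'I_N -> J) (od : 'I_N -> bool) (ef : J -> bool -> 'I_N).
Hypothesis pr_ef : forall a b, pr (ef a b) = a.
Hypothesis od_ef : forall a b, od (ef a b) = b.
Hypothesis efK : forall i, ef (pr i) (od i) = i.
Local Notation I := 'I_N.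
Local Notation neg := (neg pr od ef).
Local Notation dis := (apart neg).
Variable F : fieldType.
Hypothesis two_neq0 : (2%:R != 0 :> F)%R.
Hypothesis prime_field : forall t : F, exists k : nat, t = (k%:R)%R.
Variables (gT : finGroupType) (gv : gT -> 'M[F]_N) (mk : 'M[F]_N -> gT).
Hypothesis gv_inj : injective gv.
Hypothesis gv1 : gv 1%g = (1%:M)%R.
Hypothesis gvM : forall g h, gv (g * h)%g = (gv g *m gv h)%R.
Hypothesis mkK : forall A B : 'M[F]_N, (A *m B = 1%:M)%R -> gv (mk A) = A.
Variables (HU HS : groupType) (m : sp r -> HU) (m2 : F -> F -> F -> F -> HS).
Variables (R_UV R_SU : set (free_group 'I_2)).
Hypothesis m1 : m (sp1 r) = 1.
Hypothesis mM : forall a b, m (spM a b) = m a * m b.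
Hypothesis m_inj : injective m.
Hypothesis m2M : sl2_mul m2.
Hypothesis m2_inj : forall a b c d, (a * d - b * c = 1)%R -> m2 a b c d = m2 1%R 0%R 0%R 1%R ->
  [/\ a = 1, b = 0, c = 0 & d = 1]%R.
Hypothesis presUV : presents [tuple m (spu r); m (spv r)] R_UV.
Hypothesis presSU : presents [tuple m2 1%R 1%R 0%R 1%R; m2 0%R 1%R (-1)%R 0%R] R_SU.

Local Notation x0 := (ef (jj r 0) false).
Local Notation x1 := (ef (jj r 1) false).
Local Notation gphi := (levi_elt pr od ef mk).
Local Notation gS := (gphi x0 x1 1%R 1%R 0%R 1%R).
Local Notation gU := (gt pr od ef mk (spu r)).
Local Notation gV := (gt pr od ef mk (spv r)).
Local Notation gz := (gz pr od ef mk).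
Local Notation gt := (gt pr od ef mk).
Local Notation Q := (presented (omega_plus_relators n R_UV R_SU)).

Let nK := negK pr_ef od_ef efK.
Let nn := neg_neq pr_ef od_ef efK.
Let gphiE := levi_eltE pr_ef od_ef efK mkK.

Lemma dis01' : dis x0 x1.
Proof. by rewrite (dis_pr pr_ef od_ef efK) !pr_ef jj_eq. Qed.

Lemma gphi01M : sl2_mul (gphi x0 x1).
Proof. by move=> *; apply: (gphiM nK nn gv_inj gvM gphiE dis01'). Qed.

(** U' is both a signed permutation and an element of SL2; the two descriptions have the
  same matrix. *)
Lemma gU_gphi : gU = gphi x0 x1 0%R 1%R (-1)%R 0%R.
Proof.
apply: gv_inj; rewrite gphiE ?dis01' //; last by ring.
have [r1 r2 r3 r4] := phimx_rows (F := F) nK nn 0%R 1%R (-1)%R 0%R dis01'.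
rewrite !(neg_ef pr_ef od_ef) /= in r3 r4.
have n01 : jj r 0 != jj r 1 by rewrite jj_eq.
apply/row_matrixP => z; rewrite !rowE -(efK z) (mono_gt pr_ef od_ef efK mkK) addbF ffunE /=.
case: (eqVneq (pr z) (jj r 0)) => [->|z0].
  rewrite tpermL (negbTE n01); case: (od z); rewrite ?r1 ?r3;
    by apply/rowP => l; rewrite !mxE; ring.
case: (eqVneq (pr z) (jj r 1)) => [->|z1].
  rewrite tpermR; case: (od z); rewrite ?r2 ?r4;
    by apply/rowP => l; rewrite !mxE; ring.
have ne i b : pr z != i -> ef (pr z) (od z) != ef i b.
  by move=> h; apply: contraNneq h => /(congr1 pr); rewrite !pr_ef => ->.
rewrite tpermD 1?eq_sym // scale1r phimx_fix ?(neg_ef pr_ef od_ef) //; exact: ne.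
Qed.

Lemma m2_1 : m2 1%R 0%R 0%R 1%R = 1.
Proof.
apply: (mulgI (m2 1%R 0%R 0%R 1%R)); rewrite mulg1 m2M; try by ring.
by congr (m2 _ _ _ _); ring.
Qed.

(** The defining relators of the two subgroups hold in the linear group because the
  signed permutations and SL2 embed in it. *)
Lemma model_relators g : relators n gS gz gU gV R_UV R_SU g -> g = 1.
Proof.
move=> [[[[|]|]|]|].
- move=> [w Rw <-].
  have [a [ma ->]] : exists a, free_lift (tnth [tuple m (spu r); m (spv r)]) w = m a /\
      free_lift (tnth [tuple gU; gV]) w = gt a.
    apply: (free_lift_rel (P := fun h g => exists a, h = m a /\ g = gt a)).
    + by exists (sp1 r); rewrite m1 (gt1 pr_ef od_ef efK gv_inj gv1 mkK).
    + move=> h h' g1 g2 [a [-> ->]] [b [-> ->]]; exists (spM a b).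
      by rewrite mM (gtM pr_ef od_ef efK gv_inj gvM mkK).
    + move=> h g1 [a [-> ->]]; exists (spV a).
      rewrite (gtV pr_ef od_ef efK gv_inj gv1 gvM mkK); split=> //.
      by apply: mulg1_eq; rewrite -mM spMV m1.
    + by case=> [[|[|//]] i]; [exists (spu r) | exists (spv r)]; rewrite !(tnth_nth 1).
  move: ma; rewrite (presents_kernel presUV Rw) -m1 => /m_inj <-.
  by rewrite (gt1 pr_ef od_ef efK gv_inj gv1 mkK).
- exact: (model_rel_i pr_ef od_ef efK gv_inj gv1 gvM mkK).
- exact: (model_rel_ii pr_ef od_ef efK gv_inj gv1 gvM mkK).
- move=> [w Rw <-].
  have [a [b [c [d [det ma ->]]]]] : exists a b c d, [/\ (a * d - b * c = 1)%R,
      free_lift (tnth [tuple m2 1%R 1%R 0%R 1%R; m2 0%R 1%R (-1)%R 0%R]) w = m2 a b c d &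
      free_lift (tnth [tuple gS; gU]) w = gphi x0 x1 a b c d].
    apply: (free_lift_rel (P := fun h g => exists a b c d, [/\ (a * d - b * c = 1)%R,
      h = m2 a b c d & g = gphi x0 x1 a b c d])).
    + exists 1%R, 0%R, 0%R, 1%R; split; [by ring|by rewrite m2_1|].
      by rewrite -/(gx gphi x0 x1 0%R) (gx0 nK nn gv_inj gvM gphiE dis01').
    + move=> h h' g1 g2 [a [b [c [d [det -> ->]]]]] [a' [b' [c' [d' [det' -> ->]]]]].
      rewrite m2M // gphi01M //; do 4!eexists; split; last by [].
        by rewrite -[RHS]mulr1 -{1}det -det'; ring.
      by [].
    + move=> h g1 [a [b [c [d [det -> ->]]]]]; exists d, (- b)%R, (- c)%R, a.
      have det' : (d * a - - b * - c = 1)%R by rewrite -det; ring.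
      split=> //.
        apply: mulg1_eq; rewrite m2M // -m2_1; congr (m2 _ _ _ _); rewrite -?det; ring.
      apply: mulg1_eq; rewrite gphi01M //.
      rewrite -(gx0 nK nn gv_inj gvM gphiE dis01') /gx.
      by congr (levi_elt _ _ _ _ _ _ _ _ _ _); rewrite -?det; ring.
    + case=> [[|[|//]] i]; [exists 1%R, 1%R, 0%R, 1%R | exists 0%R, 1%R, (-1)%R, 0%R];
        rewrite !(tnth_nth 1) /= -?gU_gphi; split=> //; ring.
  move: ma; rewrite (presents_kernel presSU Rw) -m2_1 => /esym/(m2_inj det)[-> -> -> ->].
  by rewrite -/(gx gphi x0 x1 0%R) (gx0 nK nn gv_inj gvM gphiE dis01').
- exact: (model_rel_iv pr_ef od_ef efK gv_inj gv1 gvM mkK).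
Qed.

Let q (k : nat) : Q := quot_pi _ (gen (inord k)).

Lemma quot_relators g : relators n (q 0) (q 1) (q 2) (q 3) R_UV R_SU g -> g = 1.
Proof.
move=> /(relators_lift (@quot_piM _ _)) [h Rh <-].
apply/quot_pi1; exact: (sub_normal_closure Rh).
Qed.

Lemma model_map : exists f : Q -> gT, {morph f : u v / u * v} /\
  [/\ f (q 0) = gS, f (q 1) = gz, f (q 2) = gU & f (q 3) = gV].
Proof.
pose y := tnth [tuple gS; gz; gU; gV].
have ye k (kn : k < 4) : free_lift y (gen (inord k)) = nth 1 [:: gS; gz; gU; gV] k.
  by rewrite free_lift_gen /y (tnth_nth 1) inordK.
have [w Rw|f [fM fE]] := @presented_map _ (omega_plus_relators n R_UV R_SU) _ y.
  have := relators_map (@free_liftM _ _ y) Rw; rewrite !ye //.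
  exact: model_relators.
by exists f; split=> //; rewrite !fE !ye.
Qed.

Lemma presented_gen4 (P : Q -> Prop) : P 1 -> (forall u v, P u -> P v -> P (u * v)) ->
  (forall u, P u -> P u^-1) -> P (q 0) -> P (q 1) -> P (q 2) -> P (q 3) -> forall u, P u.
Proof.
move=> P1 PM PV P0 Pq1 Pq2 Pq3; apply: presented_ind => // i.
by rewrite -[i]inord_val; case: i => [[|[|[|[|]]]]].
Qed.

Theorem presented_derived (O : {group gT}) : (forall g, g \in O <-> bf_isom neg gv g) ->
  exists f : Q -> gT, [/\ {morph f : u v / u * v}, injective f &
    forall g, g \in (O^`(1))%g <-> exists u, f u = g].
Proof.
move=> inO; have [f [fM [f0 f1 f2 f3]]] := model_map.
have fone := hom1 fM; have fV := homV fM.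
have [w Rw|T [Tu Tv TM]] := @sp_map _ _ _ _ _ m1 mM (q 2) (q 3) presUV.
  by apply: quot_relators; do 4!left; exists w.
have [w Rw|psi [psiM psiS psiU]] := @sl2_map _ Q _ prime_field _ _ m2M (q 0) (q 2) presSU.
  by apply: quot_relators; left; right; exists w.
have T1 : T (sp1 r) = 1 by apply: (mulgI (T (sp1 r))); rewrite -TM ?even1 // spM1 mulg1.
have fT a : even a -> f (T a) = gt a.
  have gM := gtM pr_ef od_ef efK gv_inj gvM mkK.
  apply: (@sp_gen r (fun a => f (T a) = gt a)).
  - by rewrite T1 fone (gt1 pr_ef od_ef efK gv_inj gv1 mkK).
  - by move=> b c eb ec E E'; rewrite TM // fM E E' gM.
  - move=> b c d eb ec ed E E' bc; apply: (mulgI (gt b)).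
    by rewrite -gM bc gM -E -E' -!fM -!TM // bc.
  - by rewrite Tu f2.
  - by rewrite Tv f3.
have fpsi a b c d : (a * d - b * c = 1)%R -> f (psi a b c d) = gphi x0 x1 a b c d.
  apply: (sl2_unique prime_field (psi := fun a b c d => f (psi a b c d))).
  - by move=> *; rewrite -fM psiM.
  - exact: gphi01M.
  - by rewrite psiS f0.
  - by rewrite psiU f2 gU_gphi.
pose rho u := gv (f u).
have rho1 : rho 1 = (1%:M)%R by rewrite /rho fone gv1.
have rhoM u v : rho (u * v) = (rho u *m rho v)%R by rewrite /rho fM gvM.
have rho_T a i (b : bool) : even a ->
    (delta_mx 0 (ef i b) *m rho (T a) = (-1) ^+ (a.1 i) *: (delta_mx 0 (ef (a.2 i) b) : 'rV[F]_N))%R.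
  by move=> ea; rewrite /rho fT // (mono_gt pr_ef od_ef efK mkK) addbF.
have rho_Z i (b : bool) : (delta_mx 0 (ef i b) *m rho (q 1) =
    (delta_mx 0 (ef i (b (+) ((i == jj r 0) || (i == jj r 1)))) : 'rV[F]_N))%R.
  by rewrite /rho f1 (mono_gz pr_ef od_ef efK mkK) /= perm1 ffunE expr0 scale1r.
have rho_psi a b c d : (a * d - b * c = 1)%R -> rho (psi a b c d) = levi_mx neg x0 x1 a b c d.
  by move=> det; rewrite /rho fpsi // gphiE // dis01'.
have rel_i g : relator_i n (q 1) (q 2) (q 3) g -> g = 1.
  by move=> H; apply: quot_relators; do 3!left; right.
have rel_ii g : relator_ii n (q 0) (q 1) (q 2) (q 3) g -> g = 1.
  by move=> H; apply: quot_relators; do 2!left; right.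
have rel_iv g : relator_iv n (q 0) (q 1) (q 2) (q 3) g -> g = 1.
  by move=> H; apply: quot_relators; right.
exists f; split=> //.
- move=> u v E; apply/eqP; rewrite -divg_eq1; apply/eqP.
  apply: (core_faithful pr_ef od_ef efK two_neq0 prime_field Tu Tv TM psiM psiS psiU
    rel_i rel_ii rel_iv rho1 rhoM rho_T rho_Z rho_psi presented_gen4).
  by rewrite /rho fM fV E mulgV gv1.
pose s := [seq ef i false | i <- enum J].
have dE := dis_pr pr_ef od_ef efK.
have ps : pairwise dis s.
  rewrite pairwise_map; have := enum_uniq J; rewrite uniq_pairwise.
  by apply: sub_pairwise => i j; rewrite /= dE !pr_ef.
have ss : (2 < size s)%N by rewrite size_map size_enum_ord.
have full l : pm neg s l.
  rewrite /pm -(efK l) (neg_ef pr_ef od_ef).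
  have h i : ef i false \in s by apply/mapP; exists i; rewrite ?mem_enum.
  by case: (od l); rewrite h ?orbT.
have -> := derived_EA nK nn two_neq0 gv_inj gv1 gvM gphiE inO ps ss full.
move=> g; split.
  have gK : group_set [set h | `[< exists u, f u = h >]].
    apply/group_setP; split; first by rewrite inE; apply/asboolP; exists 1.
    move=> h h'; rewrite !inE => -[u uh] [v vh].
    by exists (u * v); rewrite fM uh vh.
  have sub : EA neg gphi predT \subset Group gK.
    apply: EA_sub => i j t _ _ dij; rewrite inE; apply/asboolP.
    have [u ru] := rho_root pr_ef od_ef efK two_neq0 Tu Tv TM rel_i
      rho1 rhoM rho_T rho_Z rho_psi t dij.
    by exists u; apply: gv_inj; rewrite [LHS]ru gphiE //; ring.
  by move/(fintype.subsetP sub); rewrite inE => /asboolP.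
move=> [u <-].
have : exists2 h, h \in EA neg gphi predT & gv h = rho u.
  apply: (rho_ind pr_ef od_ef efK two_neq0 prime_field Tu Tv TM psiM psiS psiU
      rel_i rel_ii rel_iv rho1 rhoM rho_T rho_Z rho_psi presented_gen4
      (P := fun A => exists2 h, h \in EA neg gphi predT & gv h = A)).
    by exists 1.
  move=> x y t A dxy [h Eh <-]; exists (h * gx gphi x y t).
    by rewrite groupM // gx_EA.
  by rewrite gvM gphiE //; ring.
by move=> [h Eh /gv_inj <-].
Qed.

End Assembly.

(** * Linear groups *)

Section LinearGroup.
Variables (F : finFieldType) (n : nat).

Lemma mkGL_subproof (A : 'M[F]_n.-1.+1) :
  exists g : {'GL_n[F]}, A \in unitmx -> GLval g = A.
Proof.
by have [uA|_] := boolP (A \in unitmx); [exists (FinRing.unit _ uA) | exists 1].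
Qed.

(** The identity is a default value for singular matrices. *)
Definition mkGL (A : 'M[F]_n.-1.+1) : {'GL_n[F]} := projT1 (cid (mkGL_subproof A)).

Lemma mkGLK A B : (A *m B = 1%:M)%R -> GLval (mkGL A) = A.
Proof. by case/mulmx1_unit => uA _; rewrite /mkGL; case: cid => g /= ->. Qed.

Lemma GLval_inj : injective (fun g : {'GL_n[F]} => GLval g).
Proof. exact: val_inj. Qed.

End LinearGroup.

Section SignedPermMatrix.
Variables (F : finFieldType) (n : nat).
Local Notation J := 'I_n.-1.+1.
Implicit Types (d : J -> bool) (s : 'S_n.-1.+1).

Lemma sperm_mx_row d s (i : J) : row i (sperm_mx F d s) = ((-1) ^+ d i *: delta_mx 0 (s i))%R.
Proof.
rewrite /sperm_mx row_mul; apply/rowP => j; rewrite !mxE (bigD1 i) //= big1 ?addr0.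
  by rewrite !mxE !eqxx mulr1n /= eq_sym.
by move=> k ki; rewrite !mxE eq_sym (negbTE ki) mulr0n mul0r.
Qed.

Lemma sperm_mxM d s d' s' : (sperm_mx F d s *m sperm_mx F d' s' =
  sperm_mx F (fun i => d i (+) d' (s i)) (s * s')%g)%R.
Proof.
apply/row_matrixP => i; rewrite row_mul !sperm_mx_row -scalemxAl -rowE sperm_mx_row scalerA.
by rewrite signr_addb permM.
Qed.

Lemma sperm_mx_inj d s d' s' : (2%:R != 0 :> F)%R -> sperm_mx F d s = sperm_mx F d' s' ->
  d =1 d' /\ s = s'.
Proof.
move=> two E; have H i : d i = d' i /\ s i = s' i; last first.
  by split; [move=> i; case: (H i) | apply/permP => i; case: (H i)].
have := congr1 (row i) E; rewrite !sperm_mx_row => /rowP/(_ (s i)).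
have h : (1 != -1 :> F)%R by rewrite -subr_eq0 opprK.
rewrite !mxE !eqxx /=; case: (eqVneq (s i) (s' i)) => [es|_]; last first.
  by move/eqP; rewrite mulr1 mulr0 signr_eq0.
rewrite !mulr1 => E2; split=> //; case: (d i) (d' i) E2 => [] [] //;
  rewrite ?expr0 ?expr1 => E2; case/eqP: h; [exact: esym | exact: E2].
Qed.

End SignedPermMatrix.

Section SpecialLinear.
Variable F : finFieldType.

Definition sl2 (a b c d : F) : {'GL_2[F]} := @mkGL F 2 (mx22 a b c d).

Lemma mx22M (a b c d a' b' c' d' : F) : (mx22 a b c d *m mx22 a' b' c' d' =
  mx22 (a * a' + b * c') (a * b' + b * d') (c * a' + d * c') (c * b' + d * d'))%R.
Proof.
apply/matrixP => i j; rewrite !mxE !big_ord_recl big_ord0 !mxE /= addr0.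
by case: i j => [[|[|//]] i] [[|[|//]] j].
Qed.

Lemma mx22_1 : (mx22 1 0 0 1 = 1%:M :> 'M[F]_2)%R.
Proof.
by apply/matrixP => i j; rewrite !mxE; case: i j => [[|[|//]] i] [[|[|//]] j].
Qed.

Lemma sl2E (a b c d : F) : (a * d - b * c = 1)%R -> GLval (sl2 a b c d) = mx22 a b c d.
Proof.
move=> det; apply: (@mkGLK F 2 _ (mx22 d (- b) (- c) a)%R); rewrite mx22M -mx22_1.
by congr mx22; rewrite -?det; ring.
Qed.

Lemma sl2M : sl2_mul sl2.
Proof.
move=> a b c d a' b' c' d' det det'; apply: GLval_inj; rewrite GL_ME.
rewrite -mulmxE !sl2E // ?mx22M //.
by rewrite -[RHS]mulr1 -{1}det -det'; ring.
Qed.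

Lemma sl2_inj (a b c d : F) : (a * d - b * c = 1)%R -> sl2 a b c d = sl2 1%R 0%R 0%R 1%R ->
  [/\ a = 1, b = 0, c = 0 & d = 1]%R.
Proof.
move=> det /(congr1 (fun g : {'GL_2[F]} => GLval g)); rewrite !sl2E //; last by ring.
move/matrixP=> E; have := (E 0 0, E 0 1, E 1 0, E 1 1)%R; rewrite !mxE /=.
by case=> [[[-> ->] ->] ->].
Qed.

End SpecialLinear.

Section Isometries.
Variables (F : finFieldType) (r : nat).
Local Notation n := r.+3.

Lemma orthogonal_bf (g : {'GL_(n.*2)[F]}) :
  g \in orthogonal_group F n <-> bf_isom (@gneg r) (fun h : {'GL_(n.*2)[F]} => GLval h) g.
Proof.
have nK : involutive (@gneg r) := negK (@gpr_gef r) (@god_gef r) (@gefK r).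
have bfE (u v : 'rV[F]_(n.*2.-1.+1)) :
    bf (@gneg r) u v = (u *m hyperbolic_gram F n *m v^T)%R 0%R 0%R.
  rewrite mxE; apply: eq_bigr => l _; rewrite !mxE; congr (_ * _)%R.
  rewrite (bigD1 (gneg l)) //= gramE nK eqxx mulr1 big1 ?addr0 // => k kl.
  by rewrite gramE eq_sym (inv_eq nK) (negbTE kl) mulr0.
rewrite inE; split=> [/eqP E u v|iso].
  by rewrite !bfE /act trmx_mul !mulmxA -(mulmxA u) -(mulmxA u) E.
apply/eqP/matrixP => i j.
have entry (A : 'M[F]_(n.*2.-1.+1)) : (A i j = ((delta_mx 0 i : 'rV_(n.*2.-1.+1)) *m A *m
      (delta_mx 0 j : 'rV_(n.*2.-1.+1))^T) 0 0)%R.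
  by rewrite -rowE trmx_delta -colE !mxE.
rewrite entry [RHS]entry -bfE -iso bfE /act trmx_mul.
by rewrite !mulmxA.
Qed.

End Isometries.

Lemma isomorphic_subg (G : groupType) (gT : finGroupType) (H : {group gT}) (f : G -> gT) :
  {morph f : u v / u * v} -> injective f -> (forall g, g \in H <-> exists u, f u = g) ->
  isomorphic G (subg_of H).
Proof.
move=> fM f_inj fH; have fin u : f u \in H by apply/fH; exists u.
pose f' u := Subg (fin u).
have f'_inj : injective f' by move=> u v /(congr1 val); apply: f_inj.
have /boolp.choice[f'' fK] : forall y, exists u, f' u = y.
  move=> y; have [u uy] : exists u, f u = val y by apply/fH/(valP y).
  by exists u; apply: val_inj.
exists f'; split; first by exists f'' => // u; apply: f'_inj.
by move=> u v; apply: val_inj; rewrite /= fM.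
Qed.

Section SpermHom.
Variables (F : finFieldType) (r : nat).
Hypothesis two_neq0 : (2%:R != 0 :> F)%R.
Local Notation n := r.+3.

Definition spm (a : sp r) : {'GL_n[F]} := sperm F (n := n) a.1 a.2.

Lemma eq_sperm (d d' : 'I_n -> bool) (s s' : 'S_n) : d =1 d' -> s = s' ->
  sperm_mx F d s = sperm_mx F d' s'.
Proof. by move=> E ->; congr (diag_mx _ *m _)%R; apply/rowP => i; rewrite !mxE E. Qed.

Lemma spmM a b : spm (spM a b) = spm a * spm b.
Proof.
apply: GLval_inj; apply: etrans (esym (sperm_mxM F _ _ _ _)).
by apply: eq_sperm => // i; rewrite ffunE.
Qed.

Lemma spm1 : spm (sp1 r) = 1.
Proof. by apply: (mulgI (spm (sp1 r))); rewrite -spmM spM1 mulg1. Qed.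

Lemma spm_inj : injective spm.
Proof.
move=> [d s] [d' s'] /(congr1 (fun g : {'GL_n[F]} => GLval g)) /sperm_mx_inj [] //= E Es.
by rewrite Es; congr (_, _); apply/ffunP.
Qed.

Lemma spm_U : sperm_U F n = spm (spu r).
Proof.
apply: GLval_inj; apply: eq_sperm => // i.
by rewrite ffunE -(inj_eq (@ord_inj _)) val_jj.
Qed.

Lemma spm_V : sperm_V F n = spm (spv r).
Proof. by apply: GLval_inj; apply: eq_sperm => // i; rewrite ffunE. Qed.

End SpermHom.

Lemma sl2_sigmaE (F : finFieldType) : sl2_sigma F = sl2 1%R 1%R 0%R 1%R.
Proof. by apply: GLval_inj; rewrite sl2E //; apply: sl2_sigma_det. Qed.

Lemma sl2_UE (F : finFieldType) : sl2_U F = sl2 0%R 1%R (-1)%R 0%R.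
Proof. by apply: GLval_inj; rewrite sl2E //; apply: sl2_U_det. Qed.

Local Close Scope group_scope.

Theorem theorem9p5 (p n : nat) (R_UV R_SU : set (free_group 'I_2))
    (p_prime : prime p) (p_odd : odd p) (n_ge3 : 3 <= n)
    (presUV : presents [tuple sperm_U 'F_p n; sperm_V 'F_p n] R_UV)
    (presSU : presents [tuple sl2_sigma 'F_p; sl2_U 'F_p] R_SU) :
  isomorphic (presented (omega_plus_relators n R_UV R_SU))
    [subg Omega_plus 'F_p n].
Proof.
case: n n_ge3 presUV => [|[|[|r]]] // _ presUV.
have two_neq0 : (2%:R != 0 :> 'F_p)%R.
  rewrite -(dvdn_pcharf (pchar_Fp p_prime)) dvdn_prime2 //.
  by apply: contraTneq p_odd => ->.
have prime_field (t : 'F_p) : exists k : nat, t = (k%:R)%R.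
  by exists t; rewrite natr_Zp.
rewrite spm_U spm_V in presUV; rewrite sl2_sigmaE sl2_UE in presSU.
have [f [fM f_inj fO]] := presented_derived (@gpr_gef r) (@god_gef r) (@gefK r) two_neq0
  prime_field (@GLval_inj 'F_p _) erefl (fun _ _ => erefl) (@mkGLK 'F_p (r.+3).*2)
  (spm1 'F_p r) (@spmM 'F_p r) (spm_inj two_neq0)
  (@sl2M 'F_p) (@sl2_inj 'F_p) presUV presSU (@orthogonal_bf 'F_p r).
exact: isomorphic_subg fM f_inj fO.
Qed.
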